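(* Let $h\in L^2_{loc}(\mathbb{R};H)$ be such that, for some $\eta\in(0,\nu\lambda_1]$, $$\int_{-\infty}^te^{\eta s}|h(s)|^2\,ds<\infty\quad\text{for all }t\in\mathbb{R}.$$ For $\varepsilon>0$ let $\mathcal{A}_\varepsilon=\{\mathcal{A}_\varepsilon(t)\}_{t\in\mathbb{R}}$ be the pullback attractor in $H$, with respect to the universe $\mathcal{D}_F$ of fixed nonempty bounded subsets of $H$, of problem (P) with $f(x,t)=\varepsilon h(x,t)$, and let $\mathcal{A}_0\subset H$ be the global attractor of (P) with $f=0$. Then $\mathcal{A}_\varepsilon$ is upper semi-continuous as $\varepsilon\to0^+$, that is, $$\lim_{\varepsilon\to0^+}{\rm dist}_H(\mathcal{A}_\varepsilon(t),\mathcal{A}_0)=0\quad\text{for all }t\in\mathbb{R}.$$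
   Context: Let $\Omega\subset\mathbb{R}^3$ be a bounded domain with smooth boundary and $\nu,\nu_0>0$. Let $E=\{u\in(C_0^\infty(\Omega))^3:\nabla\cdot u=0\}$; $H$ is the closure of $E$ in $(L^2(\Omega))^3$, with $L^2$ inner product $(\cdot,\cdot)$ and norm $|\cdot|$; $V$ is the closure of $E$ in $(H^1(\Omega))^3$, with inner product $((u,v))=\sum_{i,j}\int_\Omega \partial_i u_j\,\partial_i v_j\,dx$ and norm $\|\cdot\|$; $V'$ is the dual of $V$ with pairing $\langle\cdot,\cdot\rangle$, and $V\hookrightarrow H\equiv H'\hookrightarrow V'$. $\lambda_1>0$ is the first eigenvalue of the Stokes operator $A$ with Dirichlet condition ($\langle Au,v\rangle=((u,v))$). $b(u,v,w)=\sum_{i,j}\int_\Omega u_i(\partial_i v_j)w_j\,dx$. ${\rm dist}_H(B_1,B_2)=\sup_{x\in B_1}\inf_{y\in B_2}|x-y|$. Problem (P): $u_t-(\nu+\nu_0\|\nabla u\|_{L^2}^2)\Delta u+(u\cdot\nabla)u+\nabla p=f(x,t)$ in $\Omega$, $t>\tau$; $\nabla\cdot u=0$; $u|_{\partial\Omega}=0$; $u(x,\tau)=u_0(x)$. A weak solution is $u\in L^\infty(\tau,T;H)\cap L^4(\tau,T;V)$ (for every $T>\tau$) with $u(\tau)=u_0$ and $\frac{d}{dt}(u,v)+(\nu+\nu_0\|u\|^2)((u,v))+b(u,u,v)=\langle f,v\rangle$ for all $v\in V$, in the sense of distributions. For $f\in L^{4/3}_{loc}(\mathbb{R};V')$ and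 $u_0\in H$ there is a unique weak solution, it lies in $C([\tau,T];H)$, and $S(t,\tau)u_0=u(t)$ defines a continuous process on $H$ (a semigroup $S(t-\tau)$ if $f$ is independent of time). A pullback attractor with respect to $\mathcal{D}_F$ is a family $\mathcal{A}=\{\mathcal{A}(t)\}_{t\in\mathbb{R}}$ of nonempty compact subsets of $H$ with $S(t,\tau)\mathcal{A}(\tau)=\mathcal{A}(t)$ for $t\ge\tau$ and $\lim_{\tau\to-\infty}{\rm dist}_H(S(t,\tau)D,\mathcal{A}(t))=0$ for all $t\in\mathbb{R}$ and all nonempty bounded $D\subset H$; $\mathcal{A}_\varepsilon$ is the minimal one, i.e. $\mathcal{A}_\varepsilon(t)\subset C(t)$ for all $t$ for every family $\{C(t)\}$ of closed sets with the same attraction property. These attractors exist under the stated assumption on $h$. *)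

(* Defs.v *)
From HB Require Import structures.
From mathcomp Require Import all_boot all_order all_algebra.
From mathcomp Require Import all_classical all_reals all_analysis.
From mathcomp Require Import measurable_realfun ring lra.

Set Implicit Arguments.
Unset Strict Implicit.
Unset Printing Implicit Defensive.

Import Order.TTheory GRing.Theory Num.Theory.
Import numFieldNormedType.Exports.

Local Open Scope classical_set_scope.
Local Open Scope ring_scope.

Section smooth_functions.
Context {R : realType} {X : normedModType R}.

(* iter_derive [:: e1; ...; en] f = D_e1 (... (D_en f)) *)
Fixpoint iter_derive (s : seq X) (f : X -> R) : X -> R :=
  if s is e :: s' then fun x => 'D_e (iter_derive s' f) x else f.

(* class C^oo, through iterated directional derivatives *)
Definition smooth (f : X -> R) :=
  forall s : seq X, continuous (iter_derive s f) /\
    forall x e, derivable (iter_derive s f) x e.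

(* elements of C_0^oo(O), extended by 0 outside O *)
Definition test_function (O : set X) (f : X -> R) :=
  [/\ smooth f, compact (closure [set x | f x != 0])
    & closure [set x | f x != 0] `<=` O].

End smooth_functions.

(* R^3 carrying the product Borel sigma-algebra; it is convertible to
   R * R * R, which carries the normed space structure. *)
Notation mspace R :=
  (measurableTypeR R * measurableTypeR R * measurableTypeR R)%type.

Section volume.
Context (R : realType).

Definition vol : {measure set (mspace R) -> \bar R} :=
  ((@lebesgue_measure R \x @lebesgue_measure R) \x @lebesgue_measure R)%E.

Lemma open_measurable3 (A : set (R * R * R)) :
  open A -> measurable (A : set (mspace R)).
Proof.
move=> oA.
pose r n : R := n.+1%:R^-1.
pose B (q : rat * rat * rat * nat) : set (mspace R) :=
  (ball (ratr q.1.1.1 : R) (r q.2) `*` ball (ratr q.1.1.2 : R) (r q.2)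
   `*` ball (ratr q.1.2 : R) (r q.2)).
have -> : (A : set (mspace R)) = \bigcup_(q in [set q | B q `<=` A]) B q.
  apply/seteqP; split=> [[[x y] z] Axyz|x [q /= qA qx]]; last exact: qA.
  have : nbhs ((x, y, z) : R * R * R) A by exact: open_nbhs_nbhs.
  rewrite -nbhs_ballE => -[e /= e0 eA].
  have [n ne] : exists n, r n < e / 2.
    have [n _ nP] := near_infty_natSinv_lt (PosNum (divr_gt0 e0 (ltr0Sn R 1))).
    by exists n; apply: nP => /=.
  have rn0 : 0 < r n by rewrite invr_gt0.
  have H (w : R) : exists q : rat, ball w (r n) (ratr q).
    have /rat_in_itvoo[q] : w - r n < w + r n by lra.
    rewrite in_itv/= => /andP[q1 q2]; exists q.
    rewrite /ball/= ltr_norml; lra.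
  have [qx qxP] := H x; have [qy qyP] := H y; have [qz qzP] := H z.
  exists (qx, qy, qz, n) => /=.
    move=> [[a b] c] [[/= ha hb] hc]; apply: eA.
    have K (w v : R) q : ball w (r n) q -> ball q (r n) v -> ball w e v.
      move=> h1 h2; apply: (@le_ball _ _ _ (r n + r n)); first lra.
      exact: ball_triangle h1 h2.
    by split; [split|] => /=; [exact: K qxP ha|exact: K qyP hb|exact: K qzP hc].
  by split; [split|] => /=; exact: ball_sym.
rewrite bigcup_mkcond; apply: countable_bigcupT_measurable => [|q].
  exact: countableP.
case: ifPn => // _.
by apply: measurableX; [apply: measurableX|];
  apply: open_measurable; exact: ball_open.
Qed.

End volume.

Section L2.
Context {d : measure_display} {T : measurableType d} {R : realType}.
Variables (mu : {measure set T -> \bar R}) (n : nat).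

Local Notation sq := (LfunType mu (lee1n 2)).
Local Notation pre := {ffun 'I_n -> sq}.

Let LfunDE (u v : sq) x : (u + v) x = u x + v x. Proof. by []. Qed.
Let LfunNE (u : sq) x : (- u) x = - u x. Proof. by []. Qed.
Let LfunZE a (u : sq) x : (a *: u) x = a * u x. Proof. by []. Qed.

Definition L2_eq (u v : pre) : bool := `[< forall i, u i = v i %[ae mu] >].

Let L2_eq_refl : reflexive L2_eq.
Proof. by move=> u; apply/asboolP => i; exact: aeW. Qed.

Let L2_eq_sym : symmetric L2_eq.
Proof.
suff H u v : L2_eq u v -> L2_eq v u by move=> u v; apply/idP/idP; exact: H.
move=> /asboolP uv; apply/asboolP => i.
by apply: filterS (uv i) => x /(_ I) ->.
Qed.

Let L2_eq_trans : transitive L2_eq.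
Proof.
move=> v u w /asboolP uv /asboolP vw; apply/asboolP => i.
by apply: filterS2 (uv i) (vw i) => x /(_ I) -> /(_ I) ->.
Qed.

Canonical L2_eq_equiv := EquivRel L2_eq L2_eq_refl L2_eq_sym L2_eq_trans.

Local Open Scope quotient_scope.

(* L^2(mu)^n: n-tuples of square integrable functions, up to mu-a.e. equality *)
Definition L2 : Type := {eq_quot L2_eq}.
HB.instance Definition _ := Choice.on L2.
HB.instance Definition _ := EqQuotient.on L2.

Definition fld (u : L2) (i : 'I_n) : T -> R := repr u i.

Definition L2_add (u v : L2) : L2 := \pi_L2 (repr u + repr v).
Definition L2_opp (u : L2) : L2 := \pi_L2 (- repr u).
Definition L2_scale (a : R) (u : L2) : L2 := \pi_L2 (a *: repr u).
Definition L2_dot (u v : L2) : R := \sum_i \int[mu]_x (fld u i x * fld v i x).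
Definition L2_norm (u : L2) : R := Num.sqrt (L2_dot u u).

Lemma L2_piP (u v : pre) : L2_eq u v -> \pi_L2 u = \pi_L2 v.
Proof. by move=> uv; apply/eqmodP. Qed.

Lemma L2_reprP (u : pre) i : fld (\pi_L2 u) i = u i %[ae mu].
Proof.
rewrite /fld; case: piP => v /eqmodP /asboolP /(_ i).
by apply: filterS => x /(_ I) ->.
Qed.

Lemma L2_add_pi (u v : pre) : L2_add (\pi_L2 u) (\pi_L2 v) = \pi_L2 (u + v).
Proof.
apply: L2_piP; apply/asboolP => i; rewrite !ffunE.
by apply: filterS2 (L2_reprP u i) (L2_reprP v i) => x /(_ I) + /(_ I) + _;
  rewrite /fld !LfunDE => -> ->.
Qed.

Lemma L2_opp_pi (u : pre) : L2_opp (\pi_L2 u) = \pi_L2 (- u).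
Proof.
apply: L2_piP; apply/asboolP => i; rewrite !ffunE.
by apply: filterS (L2_reprP u i) => x /(_ I) + _; rewrite /fld !LfunNE => ->.
Qed.

Lemma L2_scale_pi a (u : pre) : L2_scale a (\pi_L2 u) = \pi_L2 (a *: u).
Proof.
apply: L2_piP; apply/asboolP => i; rewrite !ffunE.
by apply: filterS (L2_reprP u i) => x /(_ I) + _; rewrite /fld !LfunZE => ->.
Qed.

Let addA : associative L2_add.
Proof.
move=> x y z; elim/quotW: x => u; elim/quotW: y => v; elim/quotW: z => w.
by rewrite (L2_add_pi v w) (L2_add_pi u (v + w)) (L2_add_pi u v) L2_add_pi addrA.
Qed.

Let addC : commutative L2_add.
Proof.
move=> x y; elim/quotW: x => u; elim/quotW: y => v.
by rewrite (L2_add_pi u v) (L2_add_pi v u) addrC.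
Qed.

Let add0 : left_id (\pi_L2 0) L2_add.
Proof. by elim/quotW=> u; rewrite (L2_add_pi 0 u) add0r. Qed.

Let addN : left_inverse (\pi_L2 0) L2_opp L2_add.
Proof. by elim/quotW=> u; rewrite (L2_opp_pi u) (L2_add_pi (- u) u) addNr. Qed.

HB.instance Definition _ := GRing.isZmodule.Build L2 addA addC add0 addN.

Let scaleA a b (u : L2) : L2_scale a (L2_scale b u) = L2_scale (a * b) u.
Proof. by elim/quotW: u => u; rewrite (L2_scale_pi b u) (L2_scale_pi a (b *: u)) (L2_scale_pi _ u) scalerA. Qed.

Let scale1 : left_id 1 L2_scale.
Proof. by elim/quotW=> u; rewrite L2_scale_pi scale1r. Qed.

Let scaleDr : right_distributive L2_scale +%R.
Proof.
move=> a x y; elim/quotW: x => u; elim/quotW: y => v.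
rewrite -[LHS]/(L2_scale a (L2_add _ _)) -[RHS]/(L2_add _ _).
rewrite (L2_add_pi u v) (L2_scale_pi a u) (L2_scale_pi a v).
by rewrite (L2_scale_pi a (u + v)) (L2_add_pi (a *: u)) scalerDr.
Qed.

Let scaleDl u : {morph L2_scale^~ u : a b / a + b}.
Proof.
elim/quotW: u => u a b.
rewrite -[RHS]/(L2_add _ _) (L2_scale_pi a u) (L2_scale_pi b u).
by rewrite (L2_scale_pi _ u) (L2_add_pi (a *: u)) scalerDl.
Qed.

HB.instance Definition _ := GRing.Zmodule_isLmodule.Build R L2
  scaleA scale1 scaleDr scaleDl.

Lemma fldD (u v : L2) i : fld (u + v) i = fld u i \+ fld v i %[ae mu].
Proof.
apply: filterS (L2_reprP (repr u + repr v) i) => x /(_ I) + _ /=.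
by rewrite ffunE.
Qed.

Lemma fldZ a (u : L2) i : fld (a *: u) i = a \*o fld u i %[ae mu].
Proof.
apply: filterS (L2_reprP (a *: repr u) i) => x /(_ I) + _ /=.
by rewrite ffunE.
Qed.

Lemma fld0 i : fld 0 i = cst 0 %[ae mu].
Proof. by apply: filterS (L2_reprP 0 i) => x /(_ I) + _ /=; rewrite ffunE. Qed.

Lemma measurable_fld (u : L2) i : measurable_fun setT (fld u i).
Proof. by rewrite /fld. Qed.

Lemma integrable_fldM (u v : L2) i j :
  mu.-integrable setT (fun x => (fld u i x * fld v j x)%:E).
Proof.
by apply/(@Lfun1_integrable _ _ _ mu); apply: Lfun2_mul_Lfun1; exact: LfunP.
Qed.

Lemma L2_dotC (u v : L2) : L2_dot u v = L2_dot v u.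
Proof.
by apply: eq_bigr => i _; congr Rintegral; apply/funext => x; rewrite mulrC.
Qed.

Lemma L2_dotDl (u v w : L2) : L2_dot (u + v) w = L2_dot u w + L2_dot v w.
Proof.
rewrite /L2_dot -big_split/=; apply: eq_bigr => i _.
rewrite -RintegralD//; [|exact: integrable_fldM..].
congr fine; apply: ae_eq_integral => //.
- exact/measurable_EFinP/measurable_funM/measurable_fld/measurable_fld.
- apply/measurable_EFinP/measurable_funD;
  exact/measurable_funM/measurable_fld/measurable_fld.
- by apply: filterS (fldD u v i) => x /(_ I) + _ /=; rewrite -mulrDl => ->.
Qed.

Lemma L2_dotZl a (u v : L2) : L2_dot (a *: u) v = a * L2_dot u v.
Proof.
rewrite /L2_dot mulr_sumr; apply: eq_bigr => i _.
rewrite -RintegralZl//; last exact: integrable_fldM.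
congr fine; apply: ae_eq_integral => //.
- exact/measurable_EFinP/measurable_funM/measurable_fld/measurable_fld.
- apply/measurable_EFinP/measurable_funM => //.
  exact/measurable_funM/measurable_fld/measurable_fld.
- by apply: filterS (fldZ a u i) => x /(_ I) + _ /=; rewrite mulrA => ->.
Qed.

Lemma L2_dot_ge0 (u : L2) : 0 <= L2_dot u u.
Proof.
by apply: sumr_ge0 => i _; apply: Rintegral_ge0 => x _; rewrite -expr2 sqr_ge0.
Qed.

Lemma L2_dot_eq0 (u : L2) : L2_dot u u = 0 -> u = 0.
Proof.
move=> /eqP; rewrite psumr_eq0; last first.
  by move=> i _; apply: Rintegral_ge0 => x _; rewrite -expr2 sqr_ge0.
move=> /allP u0; rewrite -[u]reprK; apply: L2_piP; apply/asboolP => i.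
have /eqP := u0 i (mem_index_enum i); rewrite /Rintegral => ui0.
have /eqP : (\int[mu]_x (fld u i x * fld u i x)%:E = 0)%E.
  rewrite -[LHS]fineK ?ui0//.
  exact: (integrable_fin_num _ (integrable_fldM u u i i)).
move=> /eqP int0.
have abs0 : (\int[mu]_x `|(fld u i x * fld u i x)%:E| = 0)%E.
  rewrite -[RHS]int0; apply: eq_integral => x _.
  by rewrite gee0_abs// lee_fin -expr2 sqr_ge0.
have mf : measurable_fun setT (fun x => (fld u i x * fld u i x)%:E).
  exact/measurable_EFinP/measurable_funM/measurable_fld/measurable_fld.
have := (ae_eq_integral_abs mu measurableT mf).1 abs0.
apply: filterS => x /(_ I) /= [] /eqP; rewrite mulf_eq0 orbb => /eqP fx0 _.
by rewrite ffunE.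
Qed.

Lemma L2_cauchy_schwarz (u v : L2) : L2_dot u v <= L2_norm u * L2_norm v.
Proof.
have H a : 0 <= L2_dot u u + 2 * a * L2_dot u v + a ^+ 2 * L2_dot v v.
  have := L2_dot_ge0 (u + a *: v).
  rewrite L2_dotDl ![L2_dot _ (u + _)]L2_dotC !L2_dotDl !L2_dotZl.
  rewrite ![L2_dot _ (a *: _)]L2_dotC !L2_dotZl (L2_dotC v u); lra.
rewrite -sqrtrM ?L2_dot_ge0//.
have [uv0|uv0] := leP (L2_dot u v) 0; first exact: le_trans uv0 (sqrtr_ge0 _).
rewrite -[leLHS]gtr0_norm// -sqrtr_sqr ler_wsqrtr//.
have [vv0|vv0] := eqVneq (L2_dot v v) 0.
  have := H (- (L2_dot u u + 1) / (2 * L2_dot u v)).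
  rewrite vv0 mulr0 addr0.
  rewrite (_ : 2 * _ * _ = - (L2_dot u u + 1)); first lra.
  by field; rewrite gt_eqF.
have vvp : 0 < L2_dot v v by rewrite lt_neqAle eq_sym vv0 L2_dot_ge0.
have := H (- L2_dot u v / L2_dot v v).
rewrite (_ : _ + _ = L2_dot u u - L2_dot u v ^+ 2 / L2_dot v v); last by field.
by rewrite subr_ge0 ler_pdivrMr.
Qed.

Let normD (u v : L2) : L2_norm (u + v) <= L2_norm u + L2_norm v.
Proof.
rewrite -[leRHS]ger0_norm ?addr_ge0 ?sqrtr_ge0// -sqrtr_sqr ler_wsqrtr//.
rewrite L2_dotDl ![L2_dot _ (u + _)]L2_dotC !L2_dotDl (L2_dotC v u).
have := L2_cauchy_schwarz u v.
rewrite sqrrD !sqr_sqrtr ?L2_dot_ge0//; lra.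
Qed.

Let normZ a (u : L2) : L2_norm (a *: u) = `|a| * L2_norm u.
Proof.
rewrite /L2_norm L2_dotZl L2_dotC L2_dotZl mulrA -expr2.
by rewrite sqrtrM ?sqr_ge0// sqrtr_sqr.
Qed.

Let norm_eq0 (u : L2) : L2_norm u = 0 -> u = 0.
Proof.
move=> /eqP; rewrite sqrtr_eq0 => u0; apply: L2_dot_eq0.
by apply/eqP; rewrite eq_le u0 L2_dot_ge0.
Qed.

HB.instance Definition _ := Lmodule_isNormed.Build R L2 normD normZ norm_eq0.

End L2.

Section domain.
Context {R : realType}.

Definition axis (i : 'I_3) : R * R * R :=
  ((val i == 0)%N%:R, (val i == 1)%N%:R, (val i == 2)%N%:R).

(* Near each boundary point, Om is the negativity set of a smooth function
   whose differential does not vanish at that point. *)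
Definition smooth_boundary (Om : set (R * R * R)) :=
  forall x, (closure Om `\` Om) x ->
    exists (U : set (R * R * R)) (rho : R * R * R -> R),
      [/\ open U, U x, smooth rho, exists e, 'D_e rho x != 0
        & Om `&` U = [set y | rho y < 0] `&` U].

End domain.

Record smooth_domain (R : realType) := SmoothDomain {
  domain_set :> set (R * R * R);
  domain_open : open domain_set;
  domain_connected : connected domain_set;
  domain_nonempty : domain_set !=set0;
  domain_bounded : bounded_set domain_set;
  domain_smooth : smooth_boundary domain_set }.

Definition domain_measure (R : realType) (Om : smooth_domain R) :
    {measure set (mspace R) -> \bar R} :=
  mrestr (vol R) (open_measurable3 (@domain_open R Om)).

Notation L2field Om := (L2 (domain_measure Om) 3).

Section spaces.
Context {R : realType} (Om : smooth_domain R).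
Local Notation mu := (domain_measure Om).
Local Notation sq := (LfunType mu (lee1n 2)).
Implicit Types u v w : L2field Om.

Definition E_set : set (L2field Om) :=
  [set u : L2field Om | exists phi : 'I_3 -> R * R * R -> R,
    [/\ forall i, test_function Om (phi i),
        forall x, \sum_i 'D_(axis i) (phi i) x = 0
      & forall i, fld u i = phi i %[ae mu]]].

Definition H_set : set (L2field Om) := closure E_set.

Definition weak_partial (i : 'I_3) (f : mspace R -> R) (g : sq) :=
  forall phi : R * R * R -> R, test_function Om phi ->
    \int[mu]_x (f x * 'D_(axis i) phi x) = - \int[mu]_x (g x * phi x).

(* the weak derivative in L^2(Om), unique a.e. when it exists; 0 otherwise *)
Definition wpartial (i : 'I_3) (f : mspace R -> R) : sq :=
  xget 0 [set g | weak_partial i f g].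

Definition H1_set : set (L2field Om) :=
  [set u : L2field Om | forall i j, exists g, weak_partial i (fld u j) g].

Definition dotV u v : R :=
  \sum_i \sum_j
    \int[mu]_x (wpartial i (fld u j) x * wpartial i (fld v j) x).

Definition normV u : R := Num.sqrt (dotV u u).

Definition normH1 u : R := Num.sqrt (`|u| ^+ 2 + normV u ^+ 2).

Definition V_set : set (L2field Om) :=
  [set u : L2field Om | H1_set u /\
    forall e, 0 < e -> exists2 phi, E_set phi & normH1 (u - phi) < e].

Definition trilinear u v w : R :=
  \sum_i \sum_j
    \int[mu]_x (fld u i x * wpartial i (fld v j) x * fld w j x).

(* A w = lambda w in V', where <A w, v> = ((w, v)) and H is embedded in V'
   through the inner product of H *)
Definition stokes_eigenvalue (lambda : R) :=
  exists w, [/\ V_set w, w != 0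
    & forall v, V_set v -> dotV w v = lambda * L2_dot w v].

Definition first_stokes_eigenvalue (lambda : R) :=
  stokes_eigenvalue lambda /\
  forall kappa, stokes_eigenvalue kappa -> lambda <= kappa.

End spaces.

Arguments E_set {R} Om _.
Arguments H_set {R} Om _.
Arguments H1_set {R} Om _.
Arguments V_set {R} Om _.
Arguments stokes_eigenvalue {R} Om lambda.
Arguments first_stokes_eigenvalue {R} Om lambda.

(* Vector-valued Lebesgue spaces of a subset X normed by N *)
Section bochner.
Context {R : realType} {W : normedModType R}.
Variables (D : set R) (X : set W) (N : W -> R).
Implicit Types u s : R -> W.

Definition simple_in s :=
  [/\ finite_set (range s), range s `<=` X
    & forall y, measurable (s @^-1` [set y])].

Definition strongly_measurable u :=
  exists s : nat -> R -> W, (forall k, simple_in (s k)) /\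
    {ae @lebesgue_measure R, forall t, D t ->
      X (u t) /\ N (s k t - u t) @[k --> \oo] --> (0 : R)}.

Definition bochner_Lp (p : nat) u := strongly_measurable u /\
  (\int[@lebesgue_measure R]_(t in D) (N (u t) ^+ p)%:E < +oo)%E.

Definition bochner_Linfty u := strongly_measurable u /\
  exists M, {ae @lebesgue_measure R, forall t, D t -> N (u t) <= M}.

End bochner.

Section problem.
Context {R : realType} {Om : smooth_domain R}.
Variables (nu nu0 : R).
Local Notation leb := (@lebesgue_measure R).
Local Notation H := (H_set Om).
Local Notation V := (V_set Om).
Local Notation normH := (fun u : L2field Om => `|u|).

(* the element of V' given by f in H *)
Definition dual_of (f : L2field Om) : L2field Om -> R := L2_dot f.

(* f t is the functional <f(t), .>. The solution is taken to be its
   representative in C([tau, T]; H), which gives u tau and u t a meaning. *)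
Definition weak_solution (f : R -> L2field Om -> R) (tau : R)
    (u0 : L2field Om) (u : R -> L2field Om) :=
  [/\ u tau = u0,
      {within `[tau, +oo[, continuous u},
      forall T, tau < T -> bochner_Linfty `]tau, T[ H normH u,
      forall T, tau < T -> bochner_Lp `]tau, T[ V (fun v => normV v) 4 u
    & forall v, V v -> forall phi : R -> R, test_function `]tau, +oo[ phi ->
        - (\int[leb]_(t in `]tau, +oo[) (L2_dot (u t) v * derive1 phi t))
        + (\int[leb]_(t in `]tau, +oo[)
            (((nu + nu0 * normV (u t) ^+ 2) * dotV (u t) v
              + trilinear (u t) (u t) v) * phi t))
        = \int[leb]_(t in `]tau, +oo[) (f t v * phi t)].

(* S t tau u0 is the value at time t of the weak solution starting from u0 at
   time tau; weak solutions being unique, this determines S t tau on H for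
   t >= tau. *)
Definition solution_process (f : R -> L2field Om -> R)
    (S : R -> R -> L2field Om -> L2field Om) :=
  forall tau u0, H u0 -> weak_solution f tau u0 (fun t => S t tau u0).

End problem.

Section attractors.
Context {R : realType} {Om : smooth_domain R}.
Local Notation H := (H_set Om).
Implicit Types (B C : set (L2field Om)) (A : R -> set (L2field Om)).
Implicit Types (S : R -> R -> L2field Om -> L2field Om).

Definition distH B C : \bar R :=
  ereal_sup [set ereal_inf [set `|x - y|%:E | y in C] | x in B].

Definition bounded_in_H B := [/\ B `<=` H, B !=set0 & bounded_set B].

Definition pullback_attracting S A :=
  forall t B, bounded_in_H B ->
    distH (S t tau @` B) (A t) @[tau --> -oo] --> 0%E.

Definition pullback_attractor S A :=
  [/\ forall t, [/\ A t `<=` H, A t !=set0 & compact (A t)],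
      forall tau t, tau <= t -> S t tau @` A tau = A t,
      pullback_attracting S A
    & forall C : R -> set (L2field Om),
        (forall t, C t `<=` H /\ closed (C t)) -> pullback_attracting S C ->
        forall t, A t `<=` C t].

Definition global_attractor (G : R -> L2field Om -> L2field Om) B :=
  [/\ B `<=` H, B !=set0, compact B, forall t, 0 <= t -> G t @` B = B
    & forall D, bounded_in_H D -> distH (G t @` D) B @[t --> +oo] --> 0%E].

End attractors.

(* Main.v *)
From HB Require Import structures.
Require Import Defs.
From mathcomp Require Import all_boot all_order all_algebra.
From mathcomp Require Import all_classical all_reals all_analysis.
From mathcomp Require Import measurable_realfun ring lra.

Set Implicit Arguments.
Unset Strict Implicit.
Unset Printing Implicit Defensive.

Import Order.TTheory GRing.Theory Num.Theory.
Import numFieldNormedType.Exports.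

Local Open Scope classical_set_scope.
Local Open Scope ring_scope.

(** The cubic damping makes solutions forget their initial datum at a rate
    that does not depend on it, so that both attractors can be located
    explicitly.

    Put [Y = |u|^2].  Testing the equation with [u] and using
    [b(u, u, u) = 0], the Poincare inequality [|u| <= C ||u||] and Young's
    inequality gives, with [c = nu0 / C^4] and forcing [eps h],
    [Y(t) + c * int_s^t Y^2 <= Y(s) + int_s^t (eps |h|^2 + eps^2 / (4 c))].
    A function with [Z' <= - c Z^2] is at most of order [1 / (c (t - s))] at
    time [t], whatever [Z(s)] is ([absorption]).  Hence a solution started at
    time [t - T] satisfies
    [|u(t)|^2 <= 4 / (c T) + eps * int |h|^2 + eps^2 T / (8 c)]
    ([absorbing_bound]).  By invariance, each point of [A_eps(t)] is the value
    at [t] of a solution started at [t - T], for every [T > 0], and likewise for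
    [A_0] with [eps = 0].  So [A_0 = {0}], the distance to [A_0] is the norm,
    and it is made small by taking first [T] large and then [eps] small.

    The energy inequality is proved without a time derivative in [V'].  The
    weak formulation against a fixed [v] says that
    [(u(t) - u(s), v) = - int_s^t G v] ([weak_primitive]), where [G v r] is the
    equation at time [r] tested with [v].  As
    [|x|^2 - |y|^2 <= 2 (x - y, x)], the backward difference quotients of
    [|u|^2 / 2] at [s] are at most the averages of [- G v] over short intervals
    ending at [s], with the test field frozen at [v = u(s)].  For almost every
    [s] these averages converge to [- G (u s) s]: it suffices to apply
    Lebesgue's differentiation theorem to the countably many values of simple
    functions that approximate [u] in [V].  Integrating the resulting pointwise
    bound over [s] ([dini_integral]) gives [energy_inequality].

    In space, the Poincare inequality and the bound of the [L^4] norm by the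
    gradient are proved for compactly supported [C^1] functions by integrating
    along coordinate lines ([C1c_estimates]) and extended to [V] by density
    ([V_bounds]).  They give the continuity of the trilinear form
    ([trilinear_bound]) and the extension of [b(u, u, u) = 0] from
    divergence-free test fields to [V] ([trilinear_eq0]). *)

(** * Integrals and null sets *)

Section null_sets.
Context d (T : measurableType d) (R : realType) (mu : {measure set T -> \bar R}).
Import HBNNSimple.

(** The integrands of a weak formulation are known only up to Lebesgue-null sets
    and may fail to be Borel measurable, so [f] and [g] are arbitrary: every
    simple function below [f] is replaced by its product with the indicator of
    the complement of [N]. *)
Lemma ge0_le_integral_null (N : set T) (f g : T -> \bar R) :
  measurable N -> mu N = 0%E ->
  (forall x, 0 <= f x)%E -> (forall x, 0 <= g x)%E ->
  (forall x, ~ N x -> f x <= g x)%E ->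
  (\int[mu]_x f x <= \int[mu]_x g x)%E.
Proof.
move=> mN N0 f0 g0 fg; rewrite !ge0_integralTE//.
apply: ge_ereal_sup => _ [/= h hf <-].
apply: (@le_trans _ _ (sintegral mu (proj_nnsfun h (measurableC mN)))).
  rewrite -!integralT_nnsfun le_eqVlt; apply/orP; left; apply/eqP.
  apply: ge0_ae_eq_integral => //.
  - exact/measurable_EFinP.
  - exact/measurable_EFinP.
  - by move=> x _; rewrite lee_fin; exact: fun_ge0.
  - by move=> x _; rewrite lee_fin; exact: fun_ge0.
  - exists N; split => //= x /=; apply: contra_notP => Nx _.
    by congr EFin; rewrite mindicE mem_set//= mulr1.
apply: ereal_sup_ubound; exists (proj_nnsfun h (measurableC mN)) => // x.
rewrite /= mindicE; have [Nx|Nx] := pselect (N x).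
  by rewrite memNset ?mulr0//= => /(_ Nx).
by rewrite mem_set//= mulr1; exact: le_trans (hf x) (fg x Nx).
Qed.

Lemma integral_null_eq (D N : set T) (f g : T -> \bar R) :
  measurable N -> mu N = 0%E -> (forall x, D x -> ~ N x -> f x = g x) ->
  (\int[mu]_(x in D) f x = \int[mu]_(x in D) g x)%E.
Proof.
move=> mN N0 fg; rewrite [LHS]integralE [RHS]integralE.
have H (a b : T -> \bar R) : (forall x, 0 <= a x)%E -> (forall x, 0 <= b x)%E ->
    (forall x, D x -> ~ N x -> a x = b x) ->
    (\int[mu]_(x in D) a x = \int[mu]_(x in D) b x)%E.
  move=> a0 b0 ab; rewrite integral_mkcond [RHS]integral_mkcond.
  have pos (c : T -> \bar R) x : (forall x, 0 <= c x)%E -> (0 <= (c \_ D) x)%E.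
    by rewrite patchE; case: ifP.
  apply/eqP; rewrite eq_le; apply/andP; split;
    apply: (ge0_le_integral_null mN N0) => x; try exact: pos;
    move=> Nx; rewrite !patchE; case: ifPn => //; rewrite inE => Dx;
    by rewrite ab.
congr (_ - _)%E; apply: H => // x Dx Nx.
  by rewrite !funeposE fg.
by rewrite !funenegE fg.
Qed.

Lemma Rintegral_null_eq (D N : set T) (f g : T -> R) :
  measurable N -> mu N = 0%E -> (forall x, D x -> ~ N x -> f x = g x) ->
  \int[mu]_(x in D) f x = \int[mu]_(x in D) g x.
Proof.
move=> mN N0 fg; congr fine; apply: integral_null_eq mN N0 _ => x Dx Nx.
by rewrite fg.
Qed.

End null_sets.

Lemma quadratic_ge0_discriminant (R : realType) (a b c : R) : 0 <= a -> 0 <= c ->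
  (forall t, 0 <= a + 2 * t * b + t ^+ 2 * c) -> b ^+ 2 <= a * c.
Proof.
move=> a0 c0 H; have [ceq0|cneq0] := eqVneq c 0.
  have [->|b0] := eqVneq b 0; first by rewrite expr0n/= mulr_ge0.
  have := H (- (a + 1) / (2 * b)).
  rewrite ceq0 mulr0 addr0 (_ : 2 * _ * _ = - (a + 1)); first lra.
  by field.
have cp : 0 < c by rewrite lt_neqAle eq_sym cneq0.
have := H (- b / c).
rewrite (_ : _ + _ = a - b ^+ 2 / c); last by field.
by rewrite subr_ge0 ler_pdivrMr.
Qed.

Section real_integrals.
Context d (T : measurableType d) (R : realType) (mu : {measure set T -> \bar R}).
Implicit Types (f g : T -> R) (D : set T).

Lemma integrable_EFin_ge0 D f : measurable D -> measurable_fun D f ->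
  (forall x, D x -> 0 <= f x) -> (\int[mu]_(x in D) (f x)%:E < +oo)%E ->
  mu.-integrable D (EFin \o f).
Proof.
move=> mD mf f0 fi; apply/integrableP; split; first exact/measurable_EFinP.
rewrite (eq_integral (EFin \o f))// => x; rewrite inE => Dx.
by rewrite /= ger0_norm// f0.
Qed.

Lemma le_integrable_EFin D f g : measurable D -> measurable_fun D f ->
  (forall x, D x -> `|f x| <= g x) -> mu.-integrable D (EFin \o g) ->
  mu.-integrable D (EFin \o f).
Proof.
move=> mD mf fg; apply: le_integrable => //; first exact/measurable_EFinP.
move=> x Dx /=; rewrite lee_fin (le_trans (fg _ Dx))// ler_norm//.
Qed.

Lemma EFin_Rintegral D f : measurable D -> mu.-integrable D (EFin \o f) ->
  (\int[mu]_(x in D) f x)%:E = (\int[mu]_(x in D) (f x)%:E)%E.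
Proof. by move=> mD fi; rewrite fineK//; exact: integrable_fin_num fi. Qed.

Lemma Rintegral_CS D f g : measurable D ->
  measurable_fun D f -> measurable_fun D g ->
  mu.-integrable D (EFin \o (fun x => f x ^+ 2)) ->
  mu.-integrable D (EFin \o (fun x => g x ^+ 2)) ->
  mu.-integrable D (EFin \o (fun x => f x * g x)) /\
  (\int[mu]_(x in D) (f x * g x)) ^+ 2
    <= (\int[mu]_(x in D) f x ^+ 2) * (\int[mu]_(x in D) g x ^+ 2).
Proof.
move=> mD mf mg f2 g2.
have fg : mu.-integrable D (EFin \o (fun x => f x * g x)).
  apply: (@le_integrable_EFin _ _ (fun x => f x ^+ 2 + g x ^+ 2)) => //.
  - exact: measurable_funM.
  - move=> x _; rewrite ler_norml; apply/andP; split.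
      by have := sqr_ge0 (f x + g x); nra.
    by have := sqr_ge0 (f x - g x); nra.
  - by have := integrableD mD f2 g2.
split => //.
set a := \int[mu]_(x in D) f x ^+ 2; set b := \int[mu]_(x in D) (f x * g x).
set c := \int[mu]_(x in D) g x ^+ 2.
have H t : 0 <= a + t * (2 * b) + t ^+ 2 * c.
  have i1 : mu.-integrable D (EFin \o (fun x => t * (2 * (f x * g x)))).
    have := integrableZl mD t (integrableZl mD 2 fg).
    by apply: eq_integrable.
  have i2 : mu.-integrable D (EFin \o (fun x => t ^+ 2 * g x ^+ 2)).
    by have := integrableZl mD (t ^+ 2) g2; apply: eq_integrable.
  have -> : a + t * (2 * b) + t ^+ 2 * c = \int[mu]_(x in D) (f x + t * g x) ^+ 2.
    rewrite (@eq_Rintegral _ _ _ _ _ (fun x => f x ^+ 2 + t * (2 * (f x * g x)) + t ^+ 2 * g x ^+ 2)); last first.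
      by move=> x _; ring.
    rewrite RintegralD//; last first.
      by have := integrableD mD f2 i1.
    rewrite RintegralD// RintegralZl//; last first.
      by have := integrableZl mD 2 fg; apply: eq_integrable.
    by rewrite RintegralZl// RintegralZl.
  by apply: Rintegral_ge0 => x _; exact: sqr_ge0.
have a0 : 0 <= a by apply: Rintegral_ge0 => x _; exact: sqr_ge0.
have c0 : 0 <= c by apply: Rintegral_ge0 => x _; exact: sqr_ge0.
apply: quadratic_ge0_discriminant => // t.
by rewrite [2 * t]mulrC -mulrA; exact: H.
Qed.

End real_integrals.

(** * Functions of class C^n and smooth steps *)
Section Cn.
Context {R : realType} {X : normedModType R}.
Implicit Types (f g : X -> R) (n : nat).

(** An induction on [n] proves stability under products and inverses, which
    [smooth], being about all lists of directions at once, does not give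
    directly. *)
Fixpoint Cn n f : Prop :=
  if n is m.+1 then
    [/\ continuous f, forall x e, derivable f x e
      & forall e, Cn m (fun x => 'D_e f x)]
  else continuous f.

Lemma Cn_smooth f : (forall n, Cn n f) -> smooth f.
Proof.
move=> fC s; have {fC} : forall n, Cn n (iter_derive s f).
  elim: s => [//|e s ih n /=].
  by have [_ _] := ih n.+1; apply.
move=> H; have [c d _] := H 1%N.
by split => // x e; exact: d.
Qed.

Lemma CnW n f : Cn n.+1 f -> Cn n f.
Proof.
elim: n f => [|n ih] f; first by case.
by move=> [c d H]; split => // e; apply: ih; exact: H.
Qed.

Lemma Cn_cst n (c : R) : Cn n (fun=> c).
Proof.
elim: n c => [|n ih] c /=; first by move=> x; exact: cvg_cst.
split; first by move=> x; exact: cvg_cst.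
- by move=> x e; exact: derivable_cst.
- move=> e; have -> : (fun x => 'D_e (fun=> c) x) = (fun=> 0) :> (X -> R); last exact: ih.
  by apply/funext => x; rewrite derive_cst.
Qed.

Lemma CnD n f g : Cn n f -> Cn n g -> Cn n (fun x => f x + g x).
Proof.
elim: n f g => [|n ih] f g /=; first by move=> cf cg x; apply: continuousD; [exact: cf|exact: cg].
move=> [cf df Hf] [cg dg Hg]; split.
- by move=> x; apply: continuousD; [exact: cf|exact: cg].
- by move=> x e; apply: derivableD.
- move=> e; have := ih _ _ (Hf e) (Hg e).
  by congr (Cn n _); apply/funext => x; rewrite -deriveD.
Qed.

Lemma CnM n f g : Cn n f -> Cn n g -> Cn n (fun x => f x * g x).
Proof.
elim: n f g => [|n ih] f g /=; first by move=> cf cg x; apply: continuousM; [exact: cf|exact: cg].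
move=> [cf df Hf] [cg dg Hg]; split.
- by move=> x; apply: continuousM; [exact: cf|exact: cg].
- by move=> x e; apply: derivableM.
- move=> e.
  have f' : Cn n f by apply: CnW; split.
  have g' : Cn n g by apply: CnW; split.
  have := CnD (ih _ _ f' (Hg e)) (ih _ _ g' (Hf e)).
  by congr (Cn n _); apply/funext => x; rewrite deriveM.
Qed.

Lemma CnV n f : (forall x, f x != 0) -> Cn n f -> Cn n (fun x => (f x)^-1).
Proof.
move=> f0; elim: n f f0 => [|n ih] f f0 /=; first by move=> cf x; apply: cvgV; [exact: f0|exact: cf].
move=> [cf df Hf]; split.
- by move=> x; apply: cvgV; [exact: f0|exact: cf].
- by move=> x e; apply: derivableV.
- move=> e.
  have fV : Cn n (fun x => (f x)^-1) by apply: ih => //; apply: CnW; split.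
  have := CnM (Cn_cst n (-1)) (CnM (CnM fV fV) (Hf e)).
  congr (Cn n _); apply/funext => x; rewrite deriveV//.
  by rewrite -exprVn expr2 scaleNr mulN1r.
Qed.

End Cn.

Section Cn_real.
Context {R : realType}.
Implicit Types (f g : R -> R) (n : nat).

Lemma derive_dir f (x e : R) : derivable f x 1 ->
  derivable f x e /\ 'D_e f x = e * 'D_1 f x.
Proof.
move=> /derivable1_diffP df; split; first exact: diff_derivable.
rewrite !deriveE// -[X in 'd f x X](mulr1 e) -[_ * 1]/(e *: (1 : R)) linearZ//.
Qed.

Lemma CnS_real n f (f' : R -> R) :
  (forall x : R, is_derive x 1 f (f' x)) -> Cn n f' -> Cn n.+1 f.
Proof.
move=> df Cf'; split.
- move=> x; apply: differentiable_continuous; apply/derivable1_diffP.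
  by have [] := df x.
- by move=> x e; have [] := @derive_dir f x e (@ex_derive _ _ _ _ _ _ _ (df x)).
- move=> e; have := CnM (Cn_cst n e) Cf'; congr (Cn n _).
  apply/funext => x; have dx := df x.
  by rewrite (derive_dir e _).2 // derive_val.
Qed.

Lemma CnS_derive1 n f : Cn n.+1 f -> Cn n (derive1 f).
Proof.
by move=> [_ _ /(_ 1)]; congr (Cn n _); apply/funext => x; rewrite derive1E.
Qed.

Lemma Cn_is_derive n f (x : R) : Cn n.+1 f -> is_derive x 1 f (derive1 f x).
Proof. by move=> [_ /(_ x 1) df _]; rewrite derive1E; exact: DeriveDef. Qed.

Lemma Cn_comp_affine n f (a b : R) : Cn n f -> Cn n (fun x => f (a * x + b)).
Proof.
elim: n f => [|n ih] f Cf.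
  move=> x; apply: (@continuous_comp _ _ _ (fun x => a * x + b)); last exact: Cf.
  by apply: continuousD; [apply: continuousM; [exact: cvg_cst|exact: cvg_id]|exact: cvg_cst].
apply: (@CnS_real n (fun x => f (a * x + b)) (fun x => derive1 f (a * x + b) * a)).
  move=> x; have -> : (fun x => f (a * x + b)) = f \o (fun x => a * x + b) by [].
  apply: is_derive1_comp; first exact: Cn_is_derive Cf.
  have H := is_deriveD (is_deriveZ a (is_derive_id x (1 : R))) (is_derive_cst b x (1 : R)).
  by apply: is_derive_eq; rewrite addr0 [_ *: _]mulr1.
by apply: CnM; [apply: ih; exact: CnS_derive1|exact: Cn_cst].
Qed.

(** The functions [x^-k exp(-1/x)] on [x > 0]: a family that is closed under
    differentiation. *)
Definition expVn k (x : R) : R := if 0 < x then x^-1 ^+ k * expR (- x^-1) else 0.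

Lemma expVn_ge0 k x : 0 <= expVn k x.
Proof.
rewrite /expVn; case: ifP => // x0.
by rewrite mulr_ge0 ?expR_ge0// exprn_ge0// invr_ge0 ltW.
Qed.

Lemma expVn_gt0 k x : 0 < x -> 0 < expVn k x.
Proof. by move=> x0; rewrite /expVn x0 mulr_gt0 ?expR_gt0// exprn_gt0// invr_gt0. Qed.

(** A quadratic bound, so that the difference quotient at 0 tends to 0; it
    comes from [exp y >= y^(k+2) / (k+2)!] at [y = 1/x]. *)
Lemma expVn_le k x : expVn k x <= (k.+2)`!%:R * x ^+ 2.
Proof.
rewrite /expVn; case: ifPn => x0; last by rewrite mulr_ge0// sqr_ge0.
rewrite expRN ler_pdivrMr ?expR_gt0//.
have y0 : 0 <= x^-1 by rewrite invr_ge0 ltW.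
have := @expR_ge1Dxn _ _ k.+1 y0.
set y := x^-1 in y0 *; set F := (k.+2)`!%:R : R => H.
have F0 : 0 < F by rewrite ltr0n fact_gt0.
have -> : x = y^-1 by rewrite invrK.
have yp : 0 < y by rewrite invr_gt0.
have : y ^+ k.+2 / F <= expR y by lra.
rewrite ler_pdivrMr// => {}H.
have -> : y ^+ k = y ^+ k.+2 * y^-1 ^+ 2.
  by rewrite -addn2 exprD exprVn mulfK// expf_neq0// gt_eqF.
have : 0 <= y^-1 ^+ 2 by exact: sqr_ge0.
nra.
Qed.

Lemma is_derive_expVn k (x : R) :
  is_derive x 1 (expVn k) (expVn k.+2 x - k%:R * expVn k.+1 x).
Proof.
have [x0|x0|->] := ltgtP x 0.
- rewrite {2 3}/expVn ltNge (ltW x0)/= mulr0 subr0.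
  apply: (@near_eq_is_derive _ _ _ (cst 0)).
  near=> y; rewrite /expVn ltNge (ltW _)//.
  by near: y; exact: lt_nbhsl.
- rewrite {2 3}/expVn x0.
  apply: (@near_eq_is_derive _ _ _ ((fun y : R => y^-1 ^+ k * expR (- y^-1)) : R -> R)).
    near=> y; rewrite /expVn ifT//.
    by near: y; exact: lt_nbhsr.
  have xn0 : x != 0 by rewrite gt_eqF.
  have dV : is_derive x 1 (fun y : R => y^-1) (- x ^- 2).
    have := @is_deriveV _ (id : R -> R) x 1 1 xn0 (is_derive_id _ _).
    by move=> H; apply: is_derive_eq => //; rewrite /GRing.scale/= mulr1.
  have dE : is_derive x 1 (fun y : R => expR (- y^-1)) (expR (- x^-1) * x ^- 2).
    have -> : (fun y : R => expR (- y^-1)) = expR \o (fun y => - y^-1) by [].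
    apply: is_derive1_comp.
    apply: (is_derive_eq (is_deriveN dV)).
    by rewrite opprK.
  have dX : is_derive x 1 (fun y : R => y^-1 ^+ k) ((k%:R * x^-1 ^+ k.-1) *: - x ^- 2).
    have := is_deriveX k dV; congr (is_derive _ _ _ _).
    by apply/funext => y; elim: k => [|k ih]; rewrite ?expr0// !exprS -ih.
  apply: (is_derive_eq (is_deriveM dX dE)).
  rewrite /GRing.scale/=.
  case: k {dX} => [|k] /=; rewrite -exprVn; first by ring.
  by rewrite !exprS; ring.
- rewrite {2 3}/expVn ltxx mulr0 subr0.
  have H : h^-1 *: ((expVn k \o shift 0) (h *: (1:R)) - expVn k 0) @[h --> 0^'] --> (0 : R).
    apply/cvgrPdist_le => /= e e0.
    have C0 : 0 < (k.+2)`!%:R :> R by rewrite ltr0n fact_gt0.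
    near=> h.
    rewrite sub0r normrN {2}/expVn ltxx subr0 addr0 normrZ.
    rewrite [`|expVn _ _|]ger0_norm ?expVn_ge0//.
    have hn0 : h != 0 by near: h; exact: nbhs_dnbhs_neq.
    apply: (le_trans (ler_wpM2l (normr_ge0 _) (expVn_le _ _))).
    rewrite [_ *: _]mulr1 -real_normK ?num_real// normfV mulrCA expr2 mulKf ?normr_eq0//.
    rewrite -ler_pdivlMl//.
    near: h; apply: dnbhs0_le.
    by rewrite mulr_gt0// invr_gt0.
  by apply: DeriveDef; [apply/cvg_ex; exists 0|exact/cvg_lim].
Unshelve. all: by end_near. Qed.

Lemma Cn_expVn n k : Cn n (expVn k).
Proof.
elim: n k => [|n ih] k.
  move=> x; apply: differentiable_continuous; apply/derivable1_diffP.
  by have [] := is_derive_expVn k x.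
apply: (CnS_real (is_derive_expVn k)).
have := CnD (ih k.+2) (CnM (Cn_cst n (- k%:R)) (ih k.+1)).
by congr (Cn n _); apply/funext => x; rewrite mulNr.
Qed.

Definition smooth_step (x : R) : R := expVn 0 x / (expVn 0 x + expVn 0 (1 - x)).

Lemma smooth_step_den x : 0 < expVn 0 x + expVn 0 (1 - x).
Proof.
have [x0|x0] := ltP 0 x; first by rewrite ltr_pwDl ?expVn_gt0 ?expVn_ge0.
by rewrite addrC ltr_pwDl ?expVn_ge0// expVn_gt0//; lra.
Qed.

Lemma Cn_smooth_step n : Cn n smooth_step.
Proof.
apply: CnM; first exact: Cn_expVn.
apply: CnV => [x|]; first by rewrite gt_eqF ?smooth_step_den.
apply: CnD; first exact: Cn_expVn.
have := @Cn_comp_affine n (expVn 0) (-1) 1 (Cn_expVn _ _).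
by congr (Cn n _); apply/funext => x; congr expVn; ring.
Qed.

Lemma smooth_step_ge0 x : 0 <= smooth_step x.
Proof. by rewrite divr_ge0 ?expVn_ge0// ltW// smooth_step_den. Qed.

Lemma smooth_step_le1 x : smooth_step x <= 1.
Proof. by rewrite ler_pdivrMr ?smooth_step_den// mul1r lerDl expVn_ge0. Qed.

Lemma smooth_step_eq0 x : x <= 0 -> smooth_step x = 0.
Proof. by move=> x0; rewrite /smooth_step {1}/expVn ltNge x0 mul0r. Qed.

Lemma smooth_step_eq1 x : 1 <= x -> smooth_step x = 1.
Proof.
move=> x1; rewrite /smooth_step {3}/expVn ltNge subr_le0 x1 /= addr0 divff//.
by rewrite gt_eqF// expVn_gt0//; lra.
Qed.

Lemma smooth_step_gt0 x : 0 < x -> 0 < smooth_step x.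
Proof. by move=> x0; rewrite divr_gt0 ?expVn_gt0// smooth_step_den. Qed.

End Cn_real.

(** * Test functions determine integrable functions *)
Section mspace_measurability.
Context {R : realType}.

Definition octant (a b c : R) : set (mspace R) :=
  [set p | [/\ a < p.1.1, b < p.1.2 & c < p.2]].

Definition octants : set (set (mspace R)) :=
  [set O | exists a b c, O = octant a b c].

Lemma measurable_octant a b c : measurable (octant a b c).
Proof.
rewrite (_ : octant a b c = `]a, +oo[%classic `*` `]b, +oo[%classic `*` `]c, +oo[%classic).
  by apply: measurableX => //; apply: measurableX.
apply/seteqP; split => -[[x y] z]; rewrite /octant /= !in_itv/= !andbT.
  by case.
by case=> -[].
Qed.

Lemma setI_closed_octants : setI_closed octants.
Proof.
move=> _ _ [a [b [c ->]]] [a' [b' [c' ->]]].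
exists (Num.max a a'), (Num.max b b'), (Num.max c c').
apply/seteqP; split => p; rewrite /octant/= !gt_max.
  by case=> -[-> -> ->] [-> -> ->].
by case=> /andP[-> ->] /andP[-> ->] /andP[-> ->].
Qed.

Lemma archi_Nnat (x : R) : exists n : nat, - n%:R < x.
Proof.
exists (Num.truncn `|x|).+1; rewrite ltrNl.
have : `|x| < (Num.truncn `|x|).+1%:R by exact: truncnS_gt.
by apply: le_lt_trans; rewrite -normrN ler_norm.
Qed.

Lemma measurable_mspaceE : @measurable _ (mspace R) = <<s octants >>.
Proof.
apply/seteqP; split; last first.
  apply: smallest_sub; first exact: sigma_algebra_measurable.
  by move=> _ [a [b [c ->]]]; exact: measurable_octant.
pose Y := g_sigma_algebraType octants.
have mpr (pr : mspace R -> R) :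
    (forall a, exists F : nat -> set (mspace R), (forall n, octants (F n)) /\
       pr @^-1` `]a, +oo[%classic = \bigcup_n F n) ->
    measurable_fun setT (pr : Y -> measurableTypeR R).
  move=> H; apply: (measurability _ (@RGenOInfty.measurableE R)).
  move=> _ [_ [a ->] <-]; rewrite setTI; have [F [FO ->]] := H a.
  by apply: bigcupT_measurable => n; exact: sub_sigma_algebra.
have m1 : measurable_fun setT (fun p : Y => p.1.1 : measurableTypeR R).
  apply: mpr => a; exists (fun n => octant a (- n%:R) (- n%:R)); split.
    by move=> n; exists a, (- n%:R), (- n%:R).
  apply/seteqP; split => -[[x y] z]; rewrite /= ?in_itv/= ?andbT; [move=> ax|by move=> [n _ []]].
  have [n nP] := archi_Nnat (Num.min y z); exists n => //.
  by move: nP; rewrite lt_min => /andP[].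
have m2 : measurable_fun setT (fun p : Y => p.1.2 : measurableTypeR R).
  apply: mpr => a; exists (fun n => octant (- n%:R) a (- n%:R)); split.
    by move=> n; exists (- n%:R), a, (- n%:R).
  apply/seteqP; split => -[[x y] z]; rewrite /= ?in_itv/= ?andbT; [move=> ax|by move=> [n _ []]].
  have [n nP] := archi_Nnat (Num.min x z); exists n => //.
  by move: nP; rewrite lt_min => /andP[].
have m3 : measurable_fun setT (fun p : Y => p.2 : measurableTypeR R).
  apply: mpr => a; exists (fun n => octant (- n%:R) (- n%:R) a); split.
    by move=> n; exists (- n%:R), (- n%:R), a.
  apply/seteqP; split => -[[x y] z]; rewrite /= ?in_itv/= ?andbT; [move=> ax|by move=> [n _ []]].
  have [n nP] := archi_Nnat (Num.min x y); exists n => //.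
  by move: nP; rewrite lt_min => /andP[].
have m := measurable_fun_pair (measurable_fun_pair m1 m2) m3.
move=> E mE; have := m measurableT E mE; rewrite setTI.
by rewrite (_ : _ @^-1` E = E)//; apply/seteqP; split => -[[]].
Qed.

Lemma continuous_measurable3 (f : R * R * R -> R) :
  continuous f -> measurable_fun setT (f : mspace R -> R).
Proof.
move=> cf; apply: (measurability _ (@RGenOInfty.measurableE R)).
move=> _ [_ [a ->] <-]; rewrite setTI; apply: open_measurable3.
apply: open_comp; first by move=> x _; exact: cf.
by rewrite set_itvE; exact: open_gt.
Qed.

(** The measurable sets on which [F] has integral 0 form a Dynkin system, and the
    octants are stable under intersection. *)
Lemma integral_octants_eq0 (mu : {measure set (mspace R) -> \bar R})
    (F : mspace R -> R) :
  mu.-integrable setT (EFin \o F) ->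
  (\int[mu]_x (F x)%:E = 0)%E ->
  (forall a b c, (\int[mu]_(x in octant a b c) (F x)%:E = 0)%E) ->
  F = (fun=> 0) %[ae mu].
Proof.
move=> iF intT H.
have iFS E : measurable E -> mu.-integrable E (EFin \o F).
  by move=> mE; apply: integrableS iF.
have all0 E : measurable E -> (\int[mu]_(x in E) (F x)%:E = 0)%E.
  move=> mE; have := mE; rewrite measurable_mspaceE => sE.
  move: E sE {mE}; apply: (dynkin_induction measurable_mspaceE setI_closed_octants) => //.
  - by move=> _ [a [b [c ->]]].
  - move=> S mS S0.
    have : (\int[mu]_(x in S `|` ~` S) (F x)%:E = 0)%E by rewrite setUv.
    rewrite (@integral_setU _ _ _ _ S (~` S) (EFin \o F))//.
    + by rewrite [X in (X + _)%E](_ : _ = 0%E) ?add0e.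
    + exact: measurableC.
    + by rewrite setUv; exact: measurable_int iF.
    + by apply/disj_setPS => x [].
  - move=> E mE tE E0.
    rewrite (@integral_bigcup _ _ _ _ E (EFin \o F))//.
    + by rewrite eseries0// => i _ _; exact: E0.
    + by apply: iFS; exact: bigcupT_measurable.
have := @integral_ae_eq _ _ _ mu setT measurableT (fun=> 0%E) (EFin \o F) iF.
have m0 : measurable_fun [set: mspace R] (fun=> 0%E : \bar R) by [].
move=> /(_ m0); have EE : forall E : set (mspace R), E `<=` setT -> measurable E ->
   (\int[mu]_(x in E) (EFin \o F) x = \int[mu]_(x in E) (0%E : \bar R))%E.
  by move=> E _ mE; rewrite integral0; exact: all0.
move=> /(_ EE); apply: filterS => x /(_ I) /= [->].
by move=> _.
Qed.

End mspace_measurability.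

Section box_functions.
Context {R : realType}.
Local Notation X := (R * R * R)%type.

Lemma Cn_proj n (f : R -> R) (pr : X -> R) : continuous pr ->
  (forall h e x, pr (h *: e + x) = h *: pr e + pr x) ->
  Cn n f -> Cn n (fun x => f (pr x)).
Proof.
move=> cpr lpr; elim: n f => [|n ih] f Cf.
  by move=> x; apply: (@continuous_comp _ _ _ pr f); [exact: cpr|exact: Cf].
have [cf df _] := Cf.
have E x e : (fun h : R => h^-1 *: (((fun x => f (pr x)) \o shift x) (h *: e) - f (pr x)))
    = (fun h : R => h^-1 *: ((f \o shift (pr x)) (h *: pr e) - f (pr x))).
  by apply/funext => h /=; rewrite lpr.
split.
- by move=> x; apply: (@continuous_comp _ _ _ pr f); [exact: cpr|exact: cf].
- by move=> x e; rewrite /derivable E; exact: df.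
- move=> e; have := CnM (Cn_cst n (pr e)) (ih _ (CnS_derive1 Cf)).
  congr (Cn n _); apply/funext => x.
  have [_] := @derive_dir _ f (pr x) (pr e) (df _ _).
  by rewrite derive1E => <-; rewrite /derive E.
Qed.

Definition tensor3 (f g h : R -> R) (p : X) : R := f p.1.1 * g p.1.2 * h p.2.

Lemma continuous_pr1 : continuous (fun p : X => p.1.1).
Proof. by move=> x; apply: continuous_comp; exact: cvg_fst. Qed.

Lemma continuous_pr2 : continuous (fun p : X => p.1.2).
Proof. by move=> x; apply: continuous_comp; [exact: cvg_fst|exact: cvg_snd]. Qed.

Lemma continuous_pr3 : continuous (fun p : X => p.2).
Proof. by move=> x; exact: cvg_snd. Qed.

Lemma Cn_tensor3 n (f g h : R -> R) :
  Cn n f -> Cn n g -> Cn n h -> Cn n (tensor3 f g h).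
Proof.
move=> Cf Cg Ch; apply: CnM; first apply: CnM.
- by apply: Cn_proj => //; exact: continuous_pr1.
- by apply: Cn_proj => //; exact: continuous_pr2.
- by apply: Cn_proj => //; exact: continuous_pr3.
Qed.

Definition bump (c r x : R) : R := smooth_step (x - (c - r)) * smooth_step (c + r - x).

Lemma Cn_bump n c r : Cn n (bump c r).
Proof.
apply: CnM.
  have := @Cn_comp_affine _ n smooth_step 1 (- (c - r)) (Cn_smooth_step n).
  by congr (Cn n _); apply/funext => x; rewrite mul1r.
have := @Cn_comp_affine _ n smooth_step (-1) (c + r) (Cn_smooth_step n).
by congr (Cn n _); apply/funext => x; rewrite mulN1r addrC.
Qed.

Lemma bump_gt0 c r x : `|c - x| < r -> 0 < bump c r x.
Proof.
rewrite ltr_norml => /andP[h1 h2].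
by rewrite mulr_gt0// smooth_step_gt0//; lra.
Qed.

Lemma bump_neq0 c r x : bump c r x != 0 -> `|c - x| <= r.
Proof.
apply: contraR; rewrite -ltNge lter_normr => /orP[H|H].
  by rewrite /bump smooth_step_eq0 ?mul0r//; lra.
by rewrite /bump [X in _ * X]smooth_step_eq0 ?mulr0//; lra.
Qed.

Lemma bump01 c r x : 0 <= bump c r x <= 1.
Proof.
rewrite mulr_ge0 ?smooth_step_ge0//= -[leRHS]mulr1.
by rewrite ler_pM ?smooth_step_ge0 ?smooth_step_le1.
Qed.

Lemma tensor3_01 (f g h : R -> R) x : (forall x, 0 <= f x <= 1) ->
  (forall x, 0 <= g x <= 1) -> (forall x, 0 <= h x <= 1) ->
  0 <= tensor3 f g h x <= 1.
Proof.
move=> f01 g01 h01; rewrite /tensor3.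
have /andP[f0 f1] := f01 x.1.1; have /andP[g0 g1] := g01 x.1.2.
have /andP[h0 h1] := h01 x.2.
rewrite !mulr_ge0//= -[leRHS]mulr1 ler_pM ?mulr_ge0//.
by rewrite -[leRHS]mulr1 ler_pM.
Qed.

(** Tends pointwise to the indicator of [`]b, +oo[], the value at [b] included. *)
Definition ramp (b : R) (n : nat) (x : R) : R := smooth_step (n%:R * x + - (n%:R * b)).

Lemma Cn_ramp k b n : Cn k (ramp b n).
Proof. exact/Cn_comp_affine/Cn_smooth_step. Qed.

Lemma ramp01 b n x : 0 <= ramp b n x <= 1.
Proof. by rewrite smooth_step_ge0 smooth_step_le1. Qed.

Lemma near_ramp b x : \forall n \near \oo, ramp b n x = (b < x)%R%:R.
Proof.
have [bx|xb] := ltP b x; last first.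
  near=> n; rewrite /ramp smooth_step_eq0// subr_le0.
  by rewrite ler_wpM2l.
near=> n; rewrite /ramp smooth_step_eq1// -mulrBr.
rewrite -ler_pdivrMr ?subr_gt0// div1r.
by near: n; exact: nbhs_infty_ger.
Unshelve. all: by end_near. Qed.

Lemma test_function_bump (O : set X) (a : X) (r : R) (f : X -> R) :
  0 < r -> ball a (r *+ 2) `<=` O -> (forall n, Cn n f) ->
  test_function O (fun x => tensor3 (bump a.1.1 r) (bump a.1.2 r) (bump a.2 r) x * f x).
Proof.
move=> r0 aO Cf; set g := fun x => _.
pose K : set X := `[a.1.1 - r, a.1.1 + r]%classic `*` `[a.1.2 - r, a.1.2 + r]%classic
                  `*` `[a.2 - r, a.2 + r]%classic.
have cK : compact K.
  by apply: compact_setX; [apply: compact_setX|]; exact: segment_compact.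
have sK : closure [set x | g x != 0] `<=` K.
  have clK : closed K by apply: compact_closed => //; exact: norm_hausdorff.
  rewrite [X in _ `<=` X](closure_id _).1//; apply: closureS.
  move=> [[x y] z] /=; rewrite /g /tensor3/= 3!mulf_eq0 !negb_or.
  move=> /andP[/andP[/andP[/bump_neq0 + /bump_neq0 +] /bump_neq0 +] _].
  rewrite !ler_norml => hx hy hz.
  by split; [split|] => /=; rewrite in_itv/=; lra.
split.
- apply: Cn_smooth => n; apply: CnM => //.
  by apply: Cn_tensor3; exact: Cn_bump.
- by apply: (subclosed_compact _ cK) => //; exact: closed_closure.
- apply: (subset_trans sK) => -[[x y] z] [[/= hx hy] hz]; apply: aO.
  move: hx hy hz; rewrite !in_itv/= => hx hy hz.
  by split; [split|] => /=; rewrite /ball/= ltr_norml; lra.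
Qed.

End box_functions.

Section cube.
Context {R : realType}.
Local Notation X := (R * R * R)%type.
Implicit Types L : R.

Definition cube L : set X := [set x | [/\ `|x.1.1| <= L, `|x.1.2| <= L & `|x.2| <= L]].

Lemma cube_setX L :
  cube L = `[- L, L]%classic `*` `[- L, L]%classic `*` `[- L, L]%classic.
Proof.
apply/seteqP; split => -[[x y] z]; rewrite /cube/= !in_itv/= -!ler_norml.
  by case.
by case=> -[].
Qed.

Lemma compact_cube L : compact (cube L).
Proof.
rewrite cube_setX.
by apply: compact_setX; [apply: compact_setX|]; exact: segment_compact.
Qed.

Lemma measurable_cube L : measurable (cube L : set (mspace R)).
Proof.
rewrite cube_setX.
by apply: measurableX; [apply: measurableX|]; exact: measurable_itv.
Qed.

Lemma vol_cube L : (vol R (cube L) < +oo)%E.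
Proof.
rewrite cube_setX; pose I : set (measurableTypeR R) := `[- L, L]%classic.
have mI : measurable I by exact: measurable_itv.
rewrite (_ : vol R _ = ((lebesgue_measure \x lebesgue_measure) (I `*` I) * lebesgue_measure I)%E); last first.
  by apply: product_measure1E => //; exact: measurableX.
rewrite product_measure1E//.
have lI : (@lebesgue_measure R I < +oo)%E.
  by rewrite /I lebesgue_measure_itv/= lte_fin; case: ifP => // _; rewrite -EFinB ltry.
by rewrite lte_mul_pinfty ?mule_ge0 ?measure_ge0// ?fin_numM ?ge0_fin_numE ?measure_ge0.
Qed.

End cube.

Section du_Bois_Reymond.
Context {R : realType} (Om : smooth_domain R).
Local Notation X := (R * R * R)%type.
Local Notation mu := (domain_measure Om).

Lemma domain_measure_setC : mu (~` (Om : set (mspace R))) = 0%E.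
Proof. by rewrite /domain_measure /= /mrestr setICl measure0. Qed.

Lemma measurable_domain : measurable (Om : set (mspace R)).
Proof. exact: open_measurable3 (@domain_open R Om). Qed.

Lemma domain_ae (P : mspace R -> Prop) :
  (forall x, (Om : set (mspace R)) x -> P x) -> {ae mu, forall x, P x}.
Proof.
move=> H; exists (~` (Om : set (mspace R))); split.
- by apply: measurableC; exact: measurable_domain.
- exact: domain_measure_setC.
- by move=> x /= nP Ox; apply: nP; exact: H.
Qed.

Lemma domain_cube : exists2 L : R, 0 < L & (Om : set X) `<=` cube L.
Proof.
have [M [Mr H]] := @domain_bounded R Om.
exists (`|M| + 1) => [|x Ox]; first by rewrite ltr_pwDr.
have : `|x| <= `|M| + 1 by apply: H => //; rewrite (le_lt_trans (ler_norm M))// ltrDl.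
rewrite prod_normE prod_normE => hM.
by move: hM; rewrite !ge_max => /andP[/andP[h1 h2] h3].
Qed.

Lemma domain_measure_fin : (mu [set: mspace R] < +oo)%E.
Proof.
rewrite /domain_measure/= /mrestr setTI; have [L L0 HL] := domain_cube.
apply: le_lt_trans (vol_cube L); apply: le_measure => //; rewrite inE.
  exact: measurable_domain.
exact: measurable_cube.
Qed.

(** Multiply [g] by a bump supported in [Om]; the product integrates to 0 against
    products of ramps, hence over all octants, so it vanishes almost everywhere.
    Countably many bumps, with rational centres, cover [Om]. *)
Lemma test_function_integral_eq0 (g : mspace R -> R) :
  mu.-integrable setT (EFin \o g) ->
  (forall phi : X -> R, test_function Om phi -> \int[mu]_x (g x * phi x) = 0) ->
  g = (fun=> 0) %[ae mu].
Proof.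
move=> ig H.
have mg : measurable_fun setT g.
  by apply/measurable_EFinP; exact: measurable_int ig.
have step (a : X) (r : R) : 0 < r -> ball a (r *+ 2) `<=` Om ->
    (fun x => g x * tensor3 (bump a.1.1 r) (bump a.1.2 r) (bump a.2 r) x) = (fun=> 0) %[ae mu].
  move=> r0 aO; set psi := tensor3 _ _ _.
  have psi01 x : 0 <= psi x <= 1 by apply: tensor3_01 => y; exact: bump01.
  have Cpsi n : Cn n psi by apply: Cn_tensor3; exact: Cn_bump.
  have mpsi : measurable_fun setT (psi : mspace R -> R) by apply: continuous_measurable3; exact: (Cpsi 0%N).
  have iF : mu.-integrable setT (EFin \o (fun x => g x * psi x)).
    apply: (@le_integrable_EFin _ _ _ _ _ _ (fun x => `|g x|)) => //.
    - exact: measurable_funM.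
    - move=> x _; rewrite normrM ler_piMr//.
      by have /andP[p0 p1] := psi01 x; rewrite ger0_norm.
    - exact: integrable_norm.
  have H1 (f : X -> R) : (forall n, Cn n f) -> \int[mu]_x (g x * psi x * f x) = 0.
    move=> Cf; under eq_Rintegral do rewrite -mulrA.
    by apply: H; exact: test_function_bump.
  have Rint0 (f : mspace R -> R) : mu.-integrable setT (EFin \o f) ->
      \int[mu]_x f x = 0 -> (\int[mu]_x (f x)%:E = 0)%E.
    by move=> fi f0; rewrite -EFin_Rintegral// f0.
  apply: integral_octants_eq0 => //.
    apply: Rint0 => //; have := H1 (fun=> 1) (fun n => Cn_cst n 1).
    by under eq_Rintegral do rewrite mulr1.
  move=> b c d.
  pose phi n : X -> R := tensor3 (ramp b n) (ramp c n) (ramp d n).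
  have phi01 n x : 0 <= phi n x <= 1 by apply: tensor3_01 => y; exact: ramp01.
  have Cphi n k : Cn k (phi n) by apply: Cn_tensor3; exact: Cn_ramp.
  have mphi n : measurable_fun setT (phi n : mspace R -> R) by apply: continuous_measurable3; exact: (Cphi n 0%N).
  have mF := measurable_int _ iF.
  have := @dominated_convergence _ _ _ mu setT measurableT
    (fun n x => (g x * psi x * phi n x)%:E)
    ((EFin \o (fun x => g x * psi x)) \_ (octant b c d))
    (fun x => `|(g x * psi x)%:E|%E).
  have mFn n : measurable_fun setT (fun x => (g x * psi x * phi n x)%:E).
    apply/measurable_EFinP; apply: measurable_funM => //.
    exact: measurable_funM.
  have mFo : measurable_fun setT ((EFin \o (fun x => g x * psi x)) \_ (octant b c d)).
    apply/(measurable_restrictT _ _).1; first exact: measurable_octant.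
    exact: measurable_funS mF.
  move=> /(_ mFn mFo) [].
  - apply: aeW => -[[x y] z] _; apply: cvg_near_cst.
    near=> n; rewrite /phi /tensor3/=.
    have -> : ramp b n x = (b < x)%R%:R by near: n; exact: near_ramp.
    have -> : ramp c n y = (c < y)%R%:R by near: n; exact: near_ramp.
    have -> : ramp d n z = (d < z)%R%:R by near: n; exact: near_ramp.
    rewrite patchE; case: ifPn; rewrite ?inE ?notin_setE /octant/=.
      by move=> [-> -> ->]; rewrite !mulr1.
    move=> H0; congr EFin; apply/eqP; rewrite mulf_eq0; apply/orP; right.
    case: ltP => [bx|_]; rewrite ?mul0r//; case: ltP => [cy|_]; rewrite ?mulr0 ?mul0r//.
    by case: ltP => [dz|_]; rewrite ?mulr0//; exfalso; apply: H0.
  - exact: integrable_abse.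
  - apply: aeW => x n _; rewrite lee_fin normrM ler_piMr//.
    by have /andP[p0 p1] := phi01 n x; rewrite ger0_norm.
  - move=> _ _; rewrite -integral_mkcond => /cvg_lim <-//.
    apply: lim_near_cst => //; apply: nearW => n; apply: Rint0; last exact: H1.
    apply: (@le_integrable_EFin _ _ _ _ _ _ (fun x => `|g x * psi x|)) => //.
    + by apply: measurable_funM => //; exact: measurable_funM.
    + move=> x _; rewrite normrM ler_piMr//.
      by have /andP[p0 p1] := phi01 n x; rewrite ger0_norm.
    + exact: integrable_norm.
pose Q := (rat * rat * rat * nat)%type.
pose c (q : Q) : X := (ratr q.1.1.1, ratr q.1.1.2, ratr q.1.2).
pose r (q : Q) : R := q.2.+1%:R^-1.
pose P (q : Q) (x : mspace R) := ball (c q) (r q *+ 2) `<=` Om ->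
  g x * tensor3 (bump (c q).1.1 (r q)) (bump (c q).1.2 (r q)) (bump (c q).2 (r q)) x = 0.
have aeP : {ae mu, forall x, forall n, if unpickle n is Some q then P q x else True}.
  apply: ae_foralln => n; case: unpickle => [q|]; last exact: aeW.
  have [qO|qO] := pselect (ball (c q) (r q *+ 2) `<=` Om).
    have r0 : 0 < r q by rewrite invr_gt0.
    by have := step _ _ r0 qO; apply: filterS => x /(_ I) /= gx _.
  by apply: aeW => x /qO.
have aeO : {ae mu, forall x, (Om : set (mspace R)) x} by apply: domain_ae.
apply: filterS2 aeP aeO => x xP Ox _.
have : nbhs (x : X) (Om : set X) by apply: open_nbhs_nbhs; split => //; exact: domain_open.
rewrite -nbhs_ballE => -[e /= e0 eO].
have [n ne] : exists n, n.+1%:R^-1 < e / 3.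
  have [n _ nP] := near_infty_natSinv_lt (PosNum (divr_gt0 e0 (ltr0Sn R 2))).
  by exists n; apply: nP => /=.
have rn0 : 0 < n.+1%:R^-1 :> R by rewrite invr_gt0.
have Hq (w : R) : exists q : rat, `|ratr q - w| < n.+1%:R^-1.
  move: rn0; set t := _^-1 => t0.
  have /rat_in_itvoo[q] : w - t < w + t by lra.
  rewrite in_itv/= => /andP[q1 q2]; exists q.
  by rewrite ltr_norml; lra.
case: x Ox xP eO => [[x y] z] Ox xP eO.
have [qx qxP] := Hq x; have [qy qyP] := Hq y; have [qz qzP] := Hq z.
have := xP (pickle ((qx, qy, qz, n) : Q)); rewrite pickleK /P => /(_ _)/eqP.
rewrite mulf_eq0 => H0; apply/eqP; apply: contraTT (H0 _) => [gn0|].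
  rewrite negb_or gn0/= gt_eqF//.
  exact: (mulr_gt0 (mulr_gt0 (bump_gt0 qxP) (bump_gt0 qyP)) (bump_gt0 qzP)).
apply: subset_trans eO => -[[x' y'] z'] [[/= hx hy] hz].
move: hx hy hz; rewrite /ball/= !ltr_norml /r /=.
move: ne qxP qyP qzP; rewrite !ltr_norml; set t := _^-1 => te hx' hy' hz' hx hy hz.
split; [split|] => /=; rewrite /ball/= ltr_norml; lra.
Unshelve. all: by end_near. Qed.

End du_Bois_Reymond.

(** * Poincare and L^4 inequalities for compactly supported functions *)
Section line.
Context {R : realType}.
Local Notation leb := (@lebesgue_measure R).

Lemma compact_support_FTC (g g' : R -> R) (L : R) :
  (forall x : R, is_derive x 1 g (g' x)) -> continuous g' ->
  (forall x, g x != 0 -> `|x| <= L) ->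
  (forall x, g' x != 0 -> `|x| <= L) ->
  (\int[leb]_x (g' x)%:E = 0)%E /\
  forall x, (`|g x|%:E <= \int[leb]_x `|g' x|%:E)%E.
Proof.
move=> dg cg' gL g'L.
have cg : continuous g.
  move=> x; apply: differentiable_continuous; apply/derivable1_diffP.
  by have [] := dg x.
have mg' : measurable_fun setT g' by exact: continuous_measurable_fun.
have ftc a b : a < b -> (\int[leb]_(x in `[a, b]) (g' x)%:E = (g b)%:E - (g a)%:E)%E.
  move=> ab; apply: continuous_FTC2 => //.
  - exact: continuous_subspaceT.
  - split.
    + by move=> x _; have [] := dg x.
    + by apply: cvg_at_right_filter; exact: cg.
    + by apply: cvg_at_left_filter; exact: cg.
  - by move=> x _; rewrite derive1E; have dx := dg x; rewrite derive_val.
pose K : R := `|L| + 1.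
have K0 : 0 < K by rewrite /K ltr_pwDr.
have gK x : K <= `|x| -> g x = 0.
  move=> Kx; apply/eqP; apply: contraTT Kx => /gL xL.
  by rewrite -ltNge /K (le_lt_trans xL)// (le_lt_trans (ler_norm L))// ltrDl.
have g'K x : K <= `|x| -> g' x = 0.
  move=> Kx; apply/eqP; apply: contraTT Kx => /g'L xL.
  by rewrite -ltNge /K (le_lt_trans xL)// (le_lt_trans (ler_norm L))// ltrDl.
split.
  transitivity (\int[leb]_(x in `[(- K)%R, K]) (g' x)%:E)%E.
    rewrite [RHS]integral_mkcond; apply: eq_integral => x _.
    rewrite patchE; case: ifPn => //; rewrite notin_setE /= in_itv/= => H.
    by rewrite g'K// leNgt; apply/negP => xK; apply: H; rewrite -ler_norml ltW.
  rewrite ftc; last by rewrite gtrN.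
  by rewrite !gK ?subee// ?normrN ger0_norm// ltW.
move=> x; have [xK|xK] := leP x (- K).
  have gx : g x = 0.
    apply: gK; rewrite lerNr in xK; apply: (le_trans xK).
    by rewrite -normrN ler_norm.
  by rewrite gx normr0; exact: integral_ge0.
have := ftc _ _ xK; rewrite (gK (- K)) ?sube0 => [E|]; last first.
  by rewrite normrN ger0_norm// ltW.
rewrite -abse_EFin -E.
apply: (@le_trans _ _ (\int[leb]_(x in `[(- K)%R, x]) `|(g' x)%:E|)%E).
  apply: le_abse_integral => //.
  by apply/measurable_EFinP; exact: measurable_funS mg'.
apply: ge0_subset_integral => //.
by do 2 apply: measurableT_comp => //.
Qed.

End line.

Section product_integrals.
Context d1 d2 (T1 : measurableType d1) (T2 : measurableType d2) (R : realType).
Variables (m1 : {sigma_finite_measure set T1 -> \bar R})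
          (m2 : {sigma_finite_measure set T2 -> \bar R}).
Local Open Scope ereal_scope.

(** The Loomis-Whitney inequality in dimension 2: the integral of the product of
    a function of [x] and a function of [y] factors. *)
Lemma integral_le_mul_marginals (u F1 F2 : T1 * T2 -> \bar R) :
  measurable_fun setT u -> measurable_fun setT F1 -> measurable_fun setT F2 ->
  (forall p, 0 <= u p) -> (forall p, 0 <= F1 p) -> (forall p, 0 <= F2 p) ->
  (forall x y, u (x, y) <= (\int[m1]_x' F1 (x', y)) * \int[m2]_y' F2 (x, y')) ->
  \int[m1 \x m2]_p u p <= (\int[m1 \x m2]_p F1 p) * \int[m1 \x m2]_p F2 p.
Proof.
move=> mu mF1 mF2 u0 F10 F20 H.
pose P y := \int[m1]_x' F1 (x', y); pose Q x := \int[m2]_y' F2 (x, y').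
have P0 y : 0 <= P y by apply: integral_ge0 => x _; exact: F10.
have Q0 x : 0 <= Q x by apply: integral_ge0 => y _; exact: F20.
have mP : measurable_fun setT P by exact: measurable_fun_fubini_tonelli_G.
have mQ : measurable_fun setT Q by exact: measurable_fun_fubini_tonelli_F.
have mPQ : measurable_fun setT (fun p : T1 * T2 => P p.2 * Q p.1).
  by apply: emeasurable_funM; [exact: measurableT_comp mP _|exact: measurableT_comp mQ _].
apply: (@le_trans _ _ (\int[m1 \x m2]_p (P p.2 * Q p.1))).
  apply: ge0_le_integral => //.
  by move=> [x y] _; exact: H.
rewrite fubini_tonelli1//; last by move=> p; rewrite mule_ge0.
rewrite /fubini_F/=.
have -> : \int[m1 \x m2]_p F1 p = \int[m2]_y P y by rewrite fubini_tonelli2.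
have -> : \int[m1 \x m2]_p F2 p = \int[m1]_x Q x by rewrite fubini_tonelli1.
rewrite -ge0_integralZl//; last exact: integral_ge0.
rewrite (_ : (fun x => _) = (fun x => (\int[m2]_y P y) * Q x))//.
by apply/funext => x; rewrite ge0_integralZr.
Qed.

End product_integrals.

Section area.
Context (R : realType).

(** A copy of the product measure that carries a sigma-finite structure, so that
    the volume can be handled as the product of [area] and a line. *)
Definition area : set (measurableTypeR R * measurableTypeR R) -> \bar R :=
  (@lebesgue_measure R \x @lebesgue_measure R)%E.

HB.instance Definition _ := Measure.copy area
  ((@lebesgue_measure R \x @lebesgue_measure R)%E : {measure set (measurableTypeR R * measurableTypeR R)%type -> \bar R}).

Lemma area_square (L : R) :
  measurable (`[- L, L]%classic `*` `[- L, L]%classic : set (measurableTypeR R * measurableTypeR R)) /\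
  (area (`[(- L)%R, L]%classic `*` `[(- L)%R, L]%classic) < +oo)%E.
Proof.
pose I : set (measurableTypeR R) := `[- L, L]%classic.
have mI : measurable I by exact: measurable_itv.
split; first exact: measurableX.
rewrite [ltLHS](_ : _ = (@lebesgue_measure R I * @lebesgue_measure R I)%E); last exact: product_measure1E.
have lI : (@lebesgue_measure R I < +oo)%E.
  by rewrite /I lebesgue_measure_itv/= lte_fin; case: ifP => // _; rewrite -EFinB ltry.
by rewrite lte_mul_pinfty ?measure_ge0// ge0_fin_numE ?measure_ge0.
Qed.

Lemma area_sigma_finite : sigma_finite setT area.
Proof.
exists (fun n => `[- n%:R, n%:R]%classic `*` `[- n%:R, n%:R]%classic); last first.
  by move=> n; exact: area_square.
apply/seteqP; split => // -[x y] _; exists (Num.truncn (Num.max `|x| `|y|)).+1 => //.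
have : Num.max `|x| `|y| < (Num.truncn (Num.max `|x| `|y|)).+1%:R by exact: truncnS_gt.
rewrite gt_max => /andP[/ltW + /ltW].
by rewrite !ler_norml => ? ?; split; rewrite /= in_itv.
Qed.

HB.instance Definition _ := Measure_isSigmaFinite.Build _ _ _ area area_sigma_finite.

End area.

Section C1c.
Context {R : realType}.
Local Notation X := (R * R * R)%type.
Local Notation leb := (@lebesgue_measure R).
Local Notation leb2 := (@area R).
Implicit Types (f g : X -> R) (L : R).

Definition C0c L f := continuous f /\ forall x, f x != 0 -> cube L x.

Definition C1c L f :=
  [/\ C0c L f, forall i x, derivable f x (axis i)
    & forall i, C0c L (fun x => 'D_(axis i) f x)].

Lemma C0c_bounded L f : C0c L f -> exists M, forall x, `|f x| <= M.
Proof.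
move=> [cf fL].
have /compact_bounded[M [_ HM]] : compact (f @` cube L).
  by apply: continuous_compact; [exact: continuous_subspaceT|exact: compact_cube].
exists (`|M| + 1) => x; have [->|/fL xL] := eqVneq (f x) 0.
  by rewrite normr0 addr_ge0.
by apply: (HM (`|M| + 1)); [rewrite (le_lt_trans (ler_norm M))// ltrDl|exists x].
Qed.

Lemma C0c_measurable L f : C0c L f -> measurable_fun setT (f : mspace R -> R).
Proof. by move=> [cf _]; exact: continuous_measurable3. Qed.

Lemma C0c_integrable L f : C0c L f -> (vol R).-integrable setT (EFin \o (f : mspace R -> R)).
Proof.
move=> Cf; have [M HM] := C0c_bounded Cf; have [cf fL] := Cf.
have mf := C0c_measurable Cf.
rewrite (_ : EFin \o (f : mspace R -> R) = (EFin \o (f : mspace R -> R)) \_ (cube L)).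
  apply/(integrable_mkcond _ (measurable_cube L)).1.
  apply: measurable_bounded_integrable.
  - exact: measurable_cube.
  - exact: vol_cube.
  - exact: measurable_funS mf.
  - exists M; split; first exact: num_real.
    by move=> N MN x _ /=; rewrite (le_trans (HM _))// ltW.
apply/funext => x; rewrite patchE; case: ifPn => //; rewrite notin_setE => xL.
by congr EFin; apply/eqP; apply: contra_notT xL => /fL.
Qed.

Lemma C0c_mul L f g : C0c L f -> continuous g -> C0c L (fun x => f x * g x).
Proof.
move=> [cf fL] cg; split.
  by move=> x; apply: continuousM; [exact: cf|exact: cg].
by move=> x; rewrite mulf_eq0 negb_or => /andP[/fL].
Qed.

Lemma C0c_add L f g : C0c L f -> C0c L g -> C0c L (fun x => f x + g x).
Proof.
move=> [cf fL] [cg gL]; split.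
  by move=> x; apply: continuousD; [exact: cf|exact: cg].
move=> x; have [->|/fL//] := eqVneq (f x) 0; rewrite add0r; exact: gL.
Qed.

Lemma C1c_mul L f g : C1c L f -> C1c L g -> C1c L (fun x => f x * g x) /\
  forall i x, 'D_(axis i) (fun x => f x * g x) x
    = f x * 'D_(axis i) g x + g x * 'D_(axis i) f x.
Proof.
move=> [Cf df Df] [Cg dg Dg].
have E i x : 'D_(axis i) (fun x => f x * g x) x
    = f x * 'D_(axis i) g x + g x * 'D_(axis i) f x.
  by have := deriveM (df i x) (dg i x).
split; last exact: E.
split.
- exact: C0c_mul Cg.1.
- by move=> i x; exact: derivableM.
- move=> i; rewrite (_ : (fun x => _) = (fun x => f x * 'D_(axis i) g x + g x * 'D_(axis i) f x)).
    by apply: C0c_add; apply: C0c_mul => //; [exact: (Dg i).1|exact: (Df i).1].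
  by apply/funext => x; exact: E.
Qed.

Lemma axis_shift (x y z h : R) :
  [/\ h *: axis 0 + (x, y, z) = (h + x, y, z),
      h *: axis 1 + (x, y, z) = (x, h + y, z)
    & h *: axis 2 + (x, y, z) = (x, y, h + z)].
Proof.
have s0 (a : R) : h *: (0 : R) + a = a by rewrite scaler0 add0r.
have s1 (a : R) : h *: (1 : R) + a = h + a by rewrite [_ *: _]mulr1.
by split; congr (_, _, _).
Qed.

Lemma C1c_slice0 L f y z : C1c L f -> forall x : R,
  is_derive x 1 (fun x => f (x, y, z)) ('D_(axis 0) f (x, y, z)).
Proof.
move=> [_ df _] x.
have E : (fun h : R => h^-1 *: ((f \o shift (x, y, z)) (h *: axis 0) - f (x, y, z)))
  = (fun h : R => h^-1 *: (((fun x => f (x, y, z)) \o shift x) (h *: 1) - f (x, y, z))).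
  by apply/funext => h /=; have [-> _ _] := axis_shift x y z h; rewrite [h *: 1]mulr1.
have := df 0 (x, y, z); rewrite /derivable E => dx.
by rewrite /derive E; exact: DeriveDef.
Qed.

Lemma C1c_slice1 L f x z : C1c L f -> forall y : R,
  is_derive y 1 (fun y => f (x, y, z)) ('D_(axis 1) f (x, y, z)).
Proof.
move=> [_ df _] y.
have E : (fun h : R => h^-1 *: ((f \o shift (x, y, z)) (h *: axis 1) - f (x, y, z)))
  = (fun h : R => h^-1 *: (((fun y => f (x, y, z)) \o shift y) (h *: 1) - f (x, y, z))).
  by apply/funext => h /=; have [_ -> _] := axis_shift x y z h; rewrite [h *: 1]mulr1.
have := df 1 (x, y, z); rewrite /derivable E => dx.
by rewrite /derive E; exact: DeriveDef.
Qed.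

Lemma C1c_slice2 L f x y : C1c L f -> forall z : R,
  is_derive z 1 (fun z => f (x, y, z)) ('D_(axis 2) f (x, y, z)).
Proof.
move=> [_ df _] z.
have E : (fun h : R => h^-1 *: ((f \o shift (x, y, z)) (h *: axis 2) - f (x, y, z)))
  = (fun h : R => h^-1 *: (((fun z => f (x, y, z)) \o shift z) (h *: 1) - f (x, y, z))).
  by apply/funext => h /=; have [_ _ ->] := axis_shift x y z h; rewrite [h *: 1]mulr1.
have := df 2 (x, y, z); rewrite /derivable E => dx.
by rewrite /derive E; exact: DeriveDef.
Qed.

Lemma continuous_pair (A B C : topologicalType) (f : A -> B) (g : A -> C) :
  continuous f -> continuous g -> continuous (fun x => (f x, g x)).
Proof. by move=> cf cg x; exact: (@cvg_pair _ _ _ _ _ _ _ _ _ f g (cf x) (cg x)). Qed.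

Lemma continuous_mk0 (y z : R) : continuous (fun x : R => (x, y, z)).
Proof.
apply: continuous_pair; last by move=> x; exact: cvg_cst.
by apply: continuous_pair => x; [exact: cvg_id|exact: cvg_cst].
Qed.

Lemma continuous_mk1 (x z : R) : continuous (fun y : R => (x, y, z)).
Proof.
apply: continuous_pair; last by move=> y; exact: cvg_cst.
by apply: continuous_pair => y; [exact: cvg_cst|exact: cvg_id].
Qed.

Lemma continuous_mk2 (x y : R) : continuous (fun z : R => (x, y, z)).
Proof. by apply: continuous_pair => z; [exact: cvg_cst|exact: cvg_id]. Qed.

Lemma C0c_slice_measurable L f z : C0c L f ->
  measurable_fun setT (fun p : measurableTypeR R * measurableTypeR R => f (p, z)).
Proof.
by move=> /C0c_measurable mf; apply: measurableT_comp mf _; exact: measurable_pair2.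
Qed.

Lemma C0c_slice_integrable L f z : C0c L f ->
  (leb2).-integrable setT (EFin \o (fun p : measurableTypeR R * measurableTypeR R => f (p, z))).
Proof.
move=> Cf; have [M HM] := C0c_bounded Cf; have [cf fL] := Cf.
have mf := C0c_slice_measurable z Cf.
pose I : set (measurableTypeR R) := `[- L, L]%classic.
have [mII aII] := area_square L.
rewrite (_ : EFin \o _ = (EFin \o (fun p : measurableTypeR R * measurableTypeR R => f (p, z))) \_ (I `*` I)).
  apply/(integrable_mkcond _ mII).1.
  apply: measurable_bounded_integrable => //.
  - exact: measurable_funS mf.
  - exists M; split; first exact: num_real.
    by move=> N MN x _ /=; rewrite (le_trans (HM _))// ltW.
apply/funext => -[x y]; rewrite patchE; case: ifPn => //; rewrite notin_setE => xL.
congr EFin; apply/eqP; apply: contra_notT xL => /fL [/= h1 h2 h3].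
by split; rewrite /I/= in_itv/= -ler_norml.
Qed.

Lemma C1c_line L f : C1c L f ->
  [/\ forall y z, (\int[leb]_x ('D_(axis 0) f (x, y, z))%:E = 0)%E /\
        forall x, (`|f (x, y, z)|%:E <= \int[leb]_x `|'D_(axis 0) f (x, y, z)|%:E)%E,
      forall x z, (\int[leb]_y ('D_(axis 1) f (x, y, z))%:E = 0)%E /\
        forall y, (`|f (x, y, z)|%:E <= \int[leb]_y `|'D_(axis 1) f (x, y, z)|%:E)%E
    & forall x y, (\int[leb]_z ('D_(axis 2) f (x, y, z))%:E = 0)%E /\
        forall z, (`|f (x, y, z)|%:E <= \int[leb]_z `|'D_(axis 2) f (x, y, z)|%:E)%E].
Proof.
move=> Cf; have [[_ fL] _ Df] := Cf; split.
- move=> y z; apply: (@compact_support_FTC _ _ _ L); first exact: C1c_slice0 Cf.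
  + by move=> x; apply: (@continuous_comp _ _ _ (fun x => (x, y, z)) ('D_(axis 0) f)); [exact: continuous_mk0|exact: (Df 0).1].
  + by move=> x /fL [].
  + by move=> x /(Df 0).2 [].
- move=> x z; apply: (@compact_support_FTC _ _ _ L); first exact: C1c_slice1 Cf.
  + by move=> y; apply: (@continuous_comp _ _ _ (fun y => (x, y, z)) ('D_(axis 1) f)); [exact: continuous_mk1|exact: (Df 1).1].
  + by move=> y /fL [].
  + by move=> y /(Df 1).2 [].
- move=> x y; apply: (@compact_support_FTC _ _ _ L); first exact: C1c_slice2 Cf.
  + by move=> z; apply: (@continuous_comp _ _ _ (fun z => (x, y, z)) ('D_(axis 2) f)); [exact: continuous_mk2|exact: (Df 2).1].
  + by move=> z /fL [].
  + by move=> z /(Df 2).2 [].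
Qed.

Lemma ord3P (P : 'I_3 -> Prop) : P 0 -> P 1 -> P 2 -> forall i, P i.
Proof.
move=> P0 P1 P2 [[|[|[|//]]] Hi].
- by rewrite (_ : Ordinal Hi = 0)//; exact: val_inj.
- by rewrite (_ : Ordinal Hi = 1)//; exact: val_inj.
- by rewrite (_ : Ordinal Hi = 2)//; exact: val_inj.
Qed.

Lemma vol_fubini21 (F : mspace R -> \bar R) : (vol R).-integrable setT F ->
  (\int[vol R]_p F p = \int[leb]_z \int[leb2]_p F (p, z))%E.
Proof.
move=> iF; apply: esym.
exact: (@integral21_prod_meas1 _ _ _ (measurableTypeR R) R (@area R) (@lebesgue_measure R) F iF).
Qed.

Lemma vol_fubini12 (F : mspace R -> \bar R) : (vol R).-integrable setT F ->
  (\int[vol R]_p F p = \int[leb2]_p \int[leb]_z F (p, z))%E.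
Proof.
move=> iF; apply: esym.
exact: (@integral12_prod_meas1 _ _ _ (measurableTypeR R) R (@area R) (@lebesgue_measure R) F iF).
Qed.

Lemma leb2_fubini12 (F : measurableTypeR R * measurableTypeR R -> \bar R) :
  (leb2).-integrable setT F ->
  (\int[leb2]_p F p = \int[leb]_x \int[leb]_y F (x, y))%E.
Proof.
move=> iF; apply: esym.
exact: (@integral12_prod_meas1 _ _ (measurableTypeR R) (measurableTypeR R) R (@lebesgue_measure R) (@lebesgue_measure R) F iF).
Qed.

Lemma leb2_fubini21 (F : measurableTypeR R * measurableTypeR R -> \bar R) :
  (leb2).-integrable setT F ->
  (\int[leb2]_p F p = \int[leb]_y \int[leb]_x F (x, y))%E.
Proof.
move=> iF; apply: esym.
exact: (@integral21_prod_meas1 _ _ (measurableTypeR R) (measurableTypeR R) R (@lebesgue_measure R) (@lebesgue_measure R) F iF).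
Qed.

Lemma C1c_integral_derive L f i : C1c L f ->
  (\int[vol R]_x ('D_(axis i) f x)%:E = 0)%E.
Proof.
move=> Cf; have [l0 l1 l2] := C1c_line Cf.
have [_ _ Df] := Cf.
move: i; apply: ord3P.
- rewrite (vol_fubini21 (C0c_integrable (Df 0))).
  apply: integral0_eq => z _.
  rewrite (leb2_fubini21 (C0c_slice_integrable z (Df 0))).
  by apply: integral0_eq => y _; exact: (l0 y z).1.
- rewrite (vol_fubini21 (C0c_integrable (Df 1))).
  apply: integral0_eq => z _.
  rewrite (leb2_fubini12 (C0c_slice_integrable z (Df 1))).
  by apply: integral0_eq => x _; exact: (l1 x z).1.
- rewrite (vol_fubini12 (C0c_integrable (Df 2))).
  by apply: integral0_eq => -[x y] _; exact: (l2 x y).1.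
Qed.

End C1c.

Section Sobolev.
Context {R : realType}.
Local Notation X := (R * R * R)%type.
Local Notation leb := (@lebesgue_measure R).
Local Notation leb2 := (@area R).
Implicit Types (f g : X -> R) (L : R).

Lemma vol_tonelli21 (F : mspace R -> \bar R) : measurable_fun setT F ->
  (forall x, 0 <= F x)%E ->
  measurable_fun setT (fun z => \int[leb2]_p F (p, z))%E /\
  (\int[vol R]_p F p = \int[leb]_z \int[leb2]_p F (p, z))%E.
Proof.
move=> mF F0; split.
  exact: (@measurable_fun_fubini_tonelli_G _ _ _ (measurableTypeR R) R (@area R) F mF F0).
exact: (@fubini_tonelli2 _ _ _ (measurableTypeR R) R (@area R) (@lebesgue_measure R) F mF F0).
Qed.

Lemma vol_tonelli12 (F : mspace R -> \bar R) : measurable_fun setT F ->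
  (forall x, 0 <= F x)%E ->
  measurable_fun setT (fun p => \int[leb]_z F (p, z))%E /\
  (\int[vol R]_p F p = \int[leb2]_p \int[leb]_z F (p, z))%E.
Proof.
move=> mF F0; split.
  exact: (@measurable_fun_fubini_tonelli_F _ _ _ (measurableTypeR R) R (@lebesgue_measure R) F mF F0).
exact: (@fubini_tonelli1 _ _ _ (measurableTypeR R) R (@area R) (@lebesgue_measure R) F mF F0).
Qed.

Lemma sum_ord3 (F : 'I_3 -> R) : \sum_i F i = F 0 + F 1 + F 2.
Proof.
rewrite !big_ord_recl big_ord0 addr0 addrA.
by congr (F _ + F _ + F _); exact: val_inj.
Qed.

Lemma C0c_norm L f : C0c L f -> C0c L (fun x => `|f x|).
Proof.
move=> [cf fL]; split; last by move=> x; rewrite normr_eq0 => /fL.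
by move=> x; apply: continuous_comp; [exact: cf|exact: norm_continuous].
Qed.

Lemma C0c_sqr L f : C0c L f -> C0c L (fun x => f x ^+ 2).
Proof.
move=> Cf; rewrite (_ : (fun x => _) = (fun x => f x * f x)).
  by apply: C0c_mul => //; exact: Cf.1.
by apply/funext => x; rewrite expr2.
Qed.

Lemma mul_le_of_sqr (P Q M a b : R) :
  P ^+ 2 <= 4 * M * a -> Q ^+ 2 <= 4 * M * b -> P * Q <= 2 * M * (a + b).
Proof. by have := sqr_ge0 (P - Q); nra. Qed.

(** On a horizontal slice, [f^2] is bounded at each point by the integrals of
    [|d(f^2)|] along the two coordinate lines through it, so Loomis-Whitney bounds
    the integral of [f^4] by the product of the integrals of [F0] and [F1].  By
    Cauchy-Schwarz each of these is at most [2 M^(1/2)] times the norm of a partial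
    derivative. *)
Lemma slice_estimate L f (F0 F1 d0 d1 : X -> R) (M : R) z :
  C0c L f -> C0c L F0 -> C0c L F1 -> C0c L d0 -> C0c L d1 ->
  (forall x, F0 x = 2 * (`|f x| * `|d0 x|)) ->
  (forall x, F1 x = 2 * (`|f x| * `|d1 x|)) ->
  (forall x y, (`|f (x, y, z) * f (x, y, z)|%:E <= \int[leb]_x (F0 (x, y, z))%:E)%E) ->
  (forall x y, (`|f (x, y, z) * f (x, y, z)|%:E <= \int[leb]_y (F1 (x, y, z))%:E)%E) ->
  (\int[leb2]_p (f (p, z) ^+ 2)%:E <= M%:E)%E ->
  (\int[leb2]_p (f (p, z) ^+ 4)%:E <= (2 * M)%:E *
   \int[leb2]_p (d0 (p, z) ^+ 2 + d1 (p, z) ^+ 2)%:E)%E.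
Proof.
move=> Cf CF0 CF1 Cd0 Cd1 FE0 FE1 l0 l1 slice.
have Cf2 := C0c_sqr Cf.
have Cf4 : C0c L (fun x => f x ^+ 4).
  rewrite (_ : (fun x => _) = (fun x => (f x ^+ 2) ^+ 2)); first exact/C0c_sqr/C0c_sqr.
  by apply/funext => x; rewrite -exprM.
have CS : C0c L (fun x => (d0 x) ^+ 2 + (d1 x) ^+ 2).
  by apply: C0c_add; exact: C0c_sqr.
have rint g : C0c L g -> (\int[leb2]_p g (p, z))%:E = (\int[leb2]_p (g (p, z))%:E)%E.
  by move=> Cg; rewrite EFin_Rintegral//; exact: C0c_slice_integrable Cg.
apply: (@le_trans _ _ ((\int[leb2]_p (F0 (p, z))%:E) * (\int[leb2]_p (F1 (p, z))%:E))%E).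
  apply: (@integral_le_mul_marginals _ _ (measurableTypeR R) (measurableTypeR R) R
    (@lebesgue_measure R) (@lebesgue_measure R) (fun p => (f (p, z) ^+ 4)%:E)
    (fun p => (F0 (p, z))%:E) (fun p => (F1 (p, z))%:E)).
  - by apply/measurable_EFinP; exact: C0c_slice_measurable Cf4.
  - by apply/measurable_EFinP; exact: C0c_slice_measurable CF0.
  - by apply/measurable_EFinP; exact: C0c_slice_measurable CF1.
  - by move=> p; rewrite lee_fin exprn_even_ge0.
  - by move=> p; rewrite lee_fin ?FE0 ?FE1 !mulr_ge0.
  - by move=> p; rewrite lee_fin ?FE0 ?FE1 !mulr_ge0.
  - move=> x y.
    have h0 := l0 x y; have h1 := l1 x y.
    rewrite [X in X%:E](_ : f (x, y, z) ^+ 4 = `|f (x, y, z) * f (x, y, z)| * `|f (x, y, z) * f (x, y, z)|).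
      rewrite EFinM; apply: (lee_pmul _ _ h0 h1); by rewrite lee_fin normr_ge0.
    by rewrite -normrM ger0_norm; [ring|rewrite -expr2 sqr_ge0].
have bound (F d : X -> R) : C0c L d -> (forall x, F x = 2 * (`|f x| * `|d x|)) ->
    (\int[leb2]_p F (p, z)) ^+ 2 <= 4 * M * \int[leb2]_p (d (p, z)) ^+ 2.
  move=> Cd FE.
  have [_] := @Rintegral_CS _ _ _ leb2 setT (fun p => `|f (p, z)|) (fun p => `|d (p, z)|) measurableT
    (C0c_slice_measurable z (C0c_norm Cf)) (C0c_slice_measurable z (C0c_norm Cd))
    (C0c_slice_integrable z (C0c_sqr (C0c_norm Cf))) (C0c_slice_integrable z (C0c_sqr (C0c_norm Cd))).
  move=> H; set P := \int[leb2]_p F (p, z).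
  have -> : P = 2 * \int[leb2]_p (`|f (p, z)| * `|d (p, z)|).
    rewrite -RintegralZl//; last first.
      by have := C0c_slice_integrable z (C0c_mul (C0c_norm Cf) (C0c_norm Cd).1).
    by apply: eq_Rintegral => x _; rewrite FE.
  have E (g : X -> R) : \int[leb2]_p `|g (p, z)| ^+ 2 = \int[leb2]_p g (p, z) ^+ 2.
    by apply: eq_Rintegral => x _; rewrite real_normK// num_real.
  rewrite (E f) (E (d)) in H; rewrite exprMn (_ : 2 ^+ 2 = 4); last by ring.
  rewrite -mulrA ler_pM2l//; apply: (le_trans H).
  apply: ler_wpM2r; first by apply: Rintegral_ge0 => p _; exact: sqr_ge0.
  rewrite -lee_fin (rint _ Cf2); exact: slice.
rewrite -(rint _ CF0) -(rint _ CF1) -(rint _ CS).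
rewrite -EFinM -EFinM lee_fin RintegralD//; last 2 first.
- exact: C0c_slice_integrable (C0c_sqr Cd0).
- exact: C0c_slice_integrable (C0c_sqr Cd1).
have := bound _ _ Cd0 FE0; have := bound _ _ Cd1 FE1 => /=.
set P := \int[leb2]_p F0 (p, z); set Q := \int[leb2]_p F1 (p, z).
set a := \int[leb2]_p d0 (p, z) ^+ 2; set b := \int[leb2]_p d1 (p, z) ^+ 2.
by move=> Hb Ha; exact: mul_le_of_sqr.
Qed.

(** Integrating along vertical lines, the integral of [f^2] over any horizontal
    slice is at most [M], the integral of [|d_z (f^2)|].  There are slices for
    [|z| <= L] only, so [N <= 2 L M] for the integral [N] of [f^2], while
    Cauchy-Schwarz gives [M^2 <= 4 N G]; together, [M <= 8 L G].  This yields the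
    Poincare inequality, and the integral of [slice_estimate] over [z] yields the
    other one. *)
Lemma C1c_estimates L f : 0 < L -> C1c L f ->
  let G := \sum_i \int[vol R]_x ('D_(axis i) f x) ^+ 2 in
  \int[vol R]_x f x ^+ 2 <= 16 * L ^+ 2 * G /\
  \int[vol R]_x f x ^+ 4 <= 16 * L * G ^+ 2.
Proof.
move=> L0 C1f; have [Cf df Df] := C1f.
have [C1ff Dff] := C1c_mul C1f C1f.
have [l0 l1 l2] := C1c_line C1ff.
have [Cff _ CDff] := C1ff.
move=> G; pose N := \int[vol R]_x f x ^+ 2.
pose Gi i := \int[vol R]_x ('D_(axis i) f x) ^+ 2.
have Gi0 i : 0 <= Gi i by apply: Rintegral_ge0 => x _; exact: sqr_ge0.
have GE : G = Gi 0 + Gi 1 + Gi 2 by exact: (sum_ord3 Gi).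
pose F i x := `|'D_(axis i) (fun x => f x * f x) x|.
have CF i : C0c L (F i) by apply: C0c_norm; exact: CDff.
have mF i := C0c_measurable (CF i).
have F0 i x : 0 <= F i x by exact: normr_ge0.
have FE i x : F i x = 2 * (`|f x| * `|'D_(axis i) f x|).
  rewrite /F Dff -normrM; set t := f x * _.
  by rewrite -mulr2n normrMn mulr_natl.
pose M := \int[vol R]_x F 2 x.
have ME : M%:E = (\int[vol R]_x (F 2 x)%:E)%E.
  by rewrite EFin_Rintegral//; exact: C0c_integrable (CF 2).
have M0 : 0 <= M by apply: Rintegral_ge0 => x _.
have Cf2 := C0c_sqr Cf.
have mf2 := C0c_measurable Cf2.
have NE : N%:E = (\int[vol R]_x (f x ^+ 2)%:E)%E.
  by rewrite EFin_Rintegral//; exact: C0c_integrable Cf2.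
have slice z : (\int[leb2]_p (f (p, z) ^+ 2)%:E <= M%:E)%E.
  have [mm E] := @vol_tonelli12 (fun x => (F 2 x)%:E)
    (proj2 (measurable_EFinP _ _) (mF 2)) (fun x => F0 2 x).
  rewrite ME E.
  apply: ge0_le_integral => //.
  - by move=> p _; rewrite lee_fin sqr_ge0.
  - by apply/measurable_EFinP; exact: C0c_slice_measurable Cf2.
  - move=> [x y] _; apply: le_trans ((l2 x y).2 z).
    by rewrite lee_fin expr2 ler_norm.
have N1 : N <= 2 * L * M.
  rewrite -lee_fin NE.
  have [mm ->] := @vol_tonelli21 (fun x => (f x ^+ 2)%:E)
    (proj2 (measurable_EFinP _ _) mf2) (fun x => sqr_ge0 (f x)).
  pose I : set R := `[- L, L]%classic.
  have mI : measurable (I : set (measurableTypeR R)) by exact: measurable_itv.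
  rewrite (_ : (\int[leb]_z _)%E = (\int[leb]_(z in I) \int[leb2]_p (f (p, z) ^+ 2)%:E)%E); last first.
    rewrite [RHS]integral_mkcond; apply: eq_integral => z _.
    rewrite patchE; case: ifPn => //; rewrite notin_setE /I/= in_itv/= => zL.
    apply: integral0_eq => -[x y] _; congr EFin.
    apply/eqP; rewrite sqrf_eq0; apply: contra_notT zL => /(Cf.2) [_ _ /=].
    by rewrite -ler_norml.
  apply: (@le_trans _ _ (\int[leb]_(z in I) (cst M%:E) z)%E).
    apply: ge0_le_integral => //.
    - by move=> z _; apply: integral_ge0 => p _; rewrite lee_fin sqr_ge0.
    - exact: measurable_funS mm.
  rewrite integral_cst//= lebesgue_measure_itv/= lte_fin gtrN//.
  by rewrite -EFinB -EFinM lee_fin le_eqVlt; apply/orP; left; apply/eqP; ring.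
have M2 : M ^+ 2 <= 4 * N * Gi 2.
  have [_] := @Rintegral_CS _ _ _ (vol R) setT (fun x => `|f x|) (fun x => `|'D_(axis 2) f x|) measurableT
    (C0c_measurable (C0c_norm Cf)) (C0c_measurable (C0c_norm (Df 2)))
    (C0c_integrable (C0c_sqr (C0c_norm Cf))) (C0c_integrable (C0c_sqr (C0c_norm (Df 2)))).
  have -> : M = 2 * \int[vol R]_x (`|f x| * `|'D_(axis 2) f x|).
    rewrite -RintegralZl//; last first.
      by have := C0c_integrable (C0c_mul (C0c_norm Cf) (C0c_norm (Df 2)).1).
    by apply: eq_Rintegral => x _; rewrite FE.
  have E (g : X -> R) : \int[vol R]_x `|g x| ^+ 2 = \int[vol R]_x g x ^+ 2.
    by apply: eq_Rintegral => x _; rewrite real_normK// num_real.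
  rewrite !E exprMn -/N -/(Gi 2) => H.
  by rewrite (_ : 2 ^+ 2 = 4) -?mulrA ?ler_pM2l//; ring.
have G0 : 0 <= G by rewrite GE !addr_ge0.
have MG : M <= 8 * L * G.
  have N0 : 0 <= N by apply: Rintegral_ge0 => x _; exact: sqr_ge0.
  have : M * M <= 8 * L * G * M.
    rewrite -expr2; apply: (le_trans M2).
    have G2G : Gi 2 <= G by rewrite GE lerDr addr_ge0.
    rewrite (_ : 8 * L * G * M = 4 * (2 * L * M) * G); last by ring.
    by apply: ler_pM => //; [rewrite mulr_ge0|rewrite ler_pM2l].
  have [->|Mn0] := eqVneq M 0; first by rewrite !mulr_ge0// ltW.
  by rewrite ler_pM2r// lt_neqAle eq_sym Mn0.
split.
  apply: (le_trans N1); rewrite (_ : 16 * L ^+ 2 * G = 2 * L * (8 * L * G)); last by ring.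
  by rewrite ler_pM2l// mulr_gt0.
have Cf4 : C0c L (fun x => f x ^+ 4).
  rewrite (_ : (fun x => _) = (fun x => (f x ^+ 2) ^+ 2)); first exact/C0c_sqr/C0c_sqr.
  by apply/funext => x; rewrite -exprM.
have mf4 := C0c_measurable Cf4.
suff H4 : \int[vol R]_x f x ^+ 4 <= 2 * M * (Gi 0 + Gi 1).
  apply: (le_trans H4); have G01 : Gi 0 + Gi 1 <= G by rewrite GE lerDl.
  rewrite (_ : 16 * L * G ^+ 2 = 2 * (8 * L * G) * G); last by ring.
  by apply: ler_pM; [exact: mulr_ge0|exact: addr_ge0|rewrite ler_pM2l|exact: G01].
have CS : C0c L (fun x => ('D_(axis 0) f x) ^+ 2 + ('D_(axis 1) f x) ^+ 2).
  by apply: C0c_add; exact: C0c_sqr.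
have slice4 z : (\int[leb2]_p (f (p, z) ^+ 4)%:E <= (2 * M)%:E *
   \int[leb2]_p (('D_(axis 0) f (p, z)) ^+ 2 + ('D_(axis 1) f (p, z)) ^+ 2)%:E)%E.
  by apply: (slice_estimate Cf (CF 0) (CF 1) (Df 0) (Df 1) (FE 0) (FE 1));
    [move=> x y; exact: (l0 y z).2|move=> x y; exact: (l1 x z).2|exact: slice].
rewrite -lee_fin EFin_Rintegral//; last exact: C0c_integrable Cf4.
have f40 x : 0 <= f x ^+ 4 by rewrite exprn_even_ge0.
have [mm ->] := @vol_tonelli21 (fun x => (f x ^+ 4)%:E)
  (proj2 (measurable_EFinP _ _) mf4) f40.
have mS := C0c_measurable CS.
have S0 x : 0 <= ('D_(axis 0) f x) ^+ 2 + ('D_(axis 1) f x) ^+ 2 by rewrite addr_ge0 ?sqr_ge0.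
have [mm' E'] := @vol_tonelli21 (fun x => (('D_(axis 0) f x) ^+ 2 + ('D_(axis 1) f x) ^+ 2)%:E)
  (proj2 (measurable_EFinP _ _) mS) S0.
rewrite -RintegralD//; last 2 first.
- exact: C0c_integrable (C0c_sqr (Df 0)).
- exact: C0c_integrable (C0c_sqr (Df 1)).
rewrite EFinM EFin_Rintegral//; last exact: C0c_integrable CS.
rewrite E' -ge0_integralZl//; last 2 first.
- by move=> z _; apply: integral_ge0 => p _; rewrite lee_fin.
- by rewrite lee_fin mulr_ge0.
apply: ge0_le_integral => //.
- by move=> z _; apply: integral_ge0 => p _; rewrite lee_fin exprn_even_ge0.
- exact: measurable_funeM.
Qed.

End Sobolev.

(** * Weak derivatives and the space H^1 *)
Section sqi.
Context d (T : measurableType d) (R : realType) (mu : {measure set T -> \bar R}).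
Local Notation sq := (LfunType mu (lee1n 2)).
Implicit Types f g : T -> R.

Definition sqi f := measurable_fun setT f /\
  mu.-integrable setT (EFin \o (fun x => f x ^+ 2)).

Lemma sqi_Lfun (f : sq) : sqi f.
Proof. by split => //; apply: Lfun2_integrable_sqr; exact: LfunP. Qed.

Lemma Lfun_sqi f : sqi f -> exists g : sq, g = f :> (T -> R).
Proof.
move=> [mf if2].
have fL : f \in Lfun mu 2%:E.
  apply/andP; split; rewrite inE//=.
  rewrite /finite_norm unlock poweR_lty//.
  have /integrableP[_] := if2; apply: le_lt_trans.
  rewrite le_eqVlt; apply/orP; left; apply/eqP; apply: eq_integral => x _.
  by rewrite /= powR_mulrn ?normr_ge0// normrX.
by exists (Lfun_Sub (lee1n 2) fL).
Qed.

Lemma sqiM f g : sqi f -> sqi g -> mu.-integrable setT (EFin \o (fun x => f x * g x)).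
Proof. by move=> [mf f2] [mg g2]; have [] := Rintegral_CS measurableT mf mg f2 g2. Qed.

Lemma sqi_CS f g : sqi f -> sqi g ->
  (\int[mu]_x (f x * g x)) ^+ 2 <= (\int[mu]_x f x ^+ 2) * (\int[mu]_x g x ^+ 2).
Proof. by move=> [mf f2] [mg g2]; have [] := Rintegral_CS measurableT mf mg f2 g2. Qed.

Lemma sqiD f g : sqi f -> sqi g -> sqi (fun x => f x + g x).
Proof.
move=> sf sg; have [mf f2] := sf; have [mg g2] := sg; split.
  exact: measurable_funD.
have := integrableD measurableT (integrableD measurableT f2 (integrableZl measurableT 2 (sqiM sf sg))) g2.
by apply: eq_integrable => // x _ /=; rewrite -EFinM -!EFinD; congr EFin; ring.
Qed.

Lemma sqiZ a f : sqi f -> sqi (fun x => a * f x).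
Proof.
move=> [mf f2]; split; first exact: measurable_funM.
have := integrableZl measurableT (a ^+ 2) f2.
by apply: eq_integrable => // x _ /=; rewrite -EFinM exprMn.
Qed.

Lemma sqi_ae f g : measurable_fun setT g -> f = g %[ae mu] -> sqi f -> sqi g.
Proof.
move=> mg fg [mf f2]; split => //.
have mg2 : measurable_fun setT (EFin \o (fun x => g x ^+ 2)).
  by apply/measurable_EFinP; exact: measurable_funX.
have /integrableP[_ H] := f2; apply/integrableP; split => //.
rewrite (ae_eq_integral (abse \o (EFin \o (fun x => f x ^+ 2))))//.
- exact: measurableT_comp.
- by apply: measurableT_comp => //; apply/measurable_EFinP; exact: measurable_funX.
- by apply: filterS fg => x /(_ I) + _ /= => ->.
Qed.

Lemma ae_eq_Rintegral f g : measurable_fun setT f -> measurable_fun setT g ->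
  f = g %[ae mu] -> \int[mu]_x f x = \int[mu]_x g x.
Proof.
move=> mf mg fg; congr fine; apply: ae_eq_integral => //.
- exact/measurable_EFinP.
- exact/measurable_EFinP.
- by apply: filterS fg => x /(_ I) + _ /= => ->.
Qed.

End sqi.

Lemma test_function_eq0 (R : realType) (X : normedModType R) (O : set X) (phi : X -> R) x :
  test_function O phi -> ~ O x -> phi x = 0 /\ forall e, 'D_e phi x = 0.
Proof.
move=> [_ _ sO] nOx.
have nS : (~` closure [set x | phi x != 0]) x by move=> /sO.
have S0 y : (~` closure [set x | phi x != 0]) y -> phi y = 0.
  by move=> ny; apply/eqP; apply: contrapT => /negP py; apply: ny; exact: subset_closure.
split=> [|e]; first exact: S0.
rewrite -(derive_cst (0 : R) x e); apply: near_eq_derive.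
have : nbhs x (~` closure [set x | phi x != 0]).
  by apply: open_nbhs_nbhs; split => //; rewrite openC; exact: closed_closure.
by apply: filterS => y /S0 ->.
Qed.

Section bounded_measure.
Context {R : realType} (Om : smooth_domain R).
Local Notation X := (R * R * R)%type.
Local Notation mu := (domain_measure Om).
Local Notation sq := (LfunType mu (lee1n 2)).
Implicit Types (f g : X -> R).

Lemma integral_domain (F : mspace R -> \bar R) :
  (forall x, ~ (Om : set (mspace R)) x -> F x = 0%E) ->
  (\int[mu]_x F x = \int[vol R]_x F x)%E.
Proof.
move=> F0; have FE : F = F \_ (Om : set (mspace R)).
  by apply/funext => x; rewrite patchE; case: ifPn => //; rewrite notin_setE => /F0.
rewrite FE -!integral_mkcond; apply: eq_measure_integral => A mA AO.
by rewrite /domain_measure/= /mrestr setIidl.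
Qed.

Lemma Rintegral_domain (F : mspace R -> R) :
  (forall x, ~ (Om : set (mspace R)) x -> F x = 0) ->
  \int[mu]_x F x = \int[vol R]_x F x.
Proof. by move=> F0; rewrite /Rintegral integral_domain// => x Ox; rewrite F0. Qed.

Lemma bounded_integrable_domain (F : mspace R -> R) M : measurable_fun setT F ->
  (forall x, `|F x| <= M) -> mu.-integrable setT (EFin \o F).
Proof.
move=> mF FM; apply: measurable_bounded_integrable => //.
- exact: domain_measure_fin.
- exists M; split; first exact: num_real.
  by move=> N MN x _ /=; rewrite (le_trans (FM _))// ltW.
Qed.

Lemma C0c_sqi L f : C0c L f -> sqi mu f.
Proof.
move=> Cf; have mf := C0c_measurable Cf; split => //.
have [M HM] := C0c_bounded Cf.
apply: (@bounded_integrable_domain _ (M ^+ 2)); first exact: measurable_funX.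
by move=> x; rewrite normrX lerXn2r// ?nnegrE// (le_trans (normr_ge0 _) (HM x)).
Qed.

Lemma sqi_integrable (F : mspace R -> R) : sqi mu F -> mu.-integrable setT (EFin \o F).
Proof.
move=> [mF F2].
apply: (@le_integrable_EFin _ _ _ _ _ _ (fun x => 1 + F x ^+ 2)) => //.
  by move=> x _; rewrite ler_norml; have := sqr_ge0 (F x - 1); have := sqr_ge0 (F x + 1); nra.
have i1 : mu.-integrable setT (EFin \o (fun=> 1 : R)).
  by apply: (@bounded_integrable_domain _ 1) => // x; rewrite normr1.
by have := integrableD measurableT i1 F2.
Qed.

Lemma test_functions_C1c : exists2 L : R, 0 < L &
  forall phi : X -> R, test_function Om phi ->
    [/\ C1c L phi, forall x, ~ (Om : set X) x -> phi x = 0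
      & forall i x, ~ (Om : set X) x -> 'D_(axis i) phi x = 0].
Proof.
have [L L0 HL] := domain_cube Om; exists L => // phi tphi.
have out x (Ox : ~ (Om : set X) x) := test_function_eq0 tphi Ox.
have [sphi _ _] := tphi; have := sphi [::] => -[/= cphi dphi].
split.
- split; first split => //.
  + by move=> x px; apply: HL; apply: contrapT => /out[p0 _]; rewrite p0 eqxx in px.
  + by move=> i x; exact: dphi.
  + move=> i; have := sphi [:: axis i] => -[/= cD _]; split => // x Dx.
    by apply: HL; apply: contrapT => /out[_ D0]; rewrite D0 eqxx in Dx.
- by move=> x /out[].
- by move=> i x /out[].
Qed.

End bounded_measure.

Lemma norm_le_sqrt_mul (R : realType) (a b c : R) : 0 <= a -> b ^+ 2 <= a * c ->
  `|b| <= Num.sqrt a * Num.sqrt c.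
Proof. by move=> a0 bac; rewrite -sqrtrM// -sqrtr_sqr ler_wsqrtr. Qed.

Lemma polarized_le (R : realType) (x y a b c : R) :
  x ^+ 2 = a -> y ^+ 2 = b -> c <= x * y -> a + 2 * c + b <= (x + y) ^+ 2.
Proof. by move=> <- <- cxy; rewrite sqrrD -mulr_natl; lra. Qed.

Section weak_partials.
Context {R : realType} (Om : smooth_domain R).
Local Notation X := (R * R * R)%type.
Local Notation mu := (domain_measure Om).
Local Notation sq := (LfunType mu (lee1n 2)).
Local Notation wp i u j := (wpartial Om i (fld u j)).
Implicit Types (u v w : L2field Om) (f : mspace R -> R).

Lemma sqi_fld u j : sqi mu (fld u j).
Proof. exact: sqi_Lfun. Qed.

Lemma sqi_test phi i : test_function Om phi ->
  sqi mu phi /\ sqi mu (fun x => 'D_(axis i) phi x).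
Proof.
have [L L0 H] := test_functions_C1c Om => /H[[C0 _ CD] _ _].
by split; apply: (@C0c_sqi _ _ L) => //; exact: CD.
Qed.

Lemma weak_partial_unique i f (g g' : sq) :
  weak_partial i f g -> weak_partial i f g' -> g = g' %[ae mu].
Proof.
move=> wg wg'.
have sg := sqi_Lfun g; have sg' := sqi_Lfun g'.
have sN := sqiD sg (sqiZ (-1) sg').
have iN := sqi_integrable sN.
have H : (fun x => g x + -1 * g' x) = (fun=> 0) %[ae mu].
  apply: test_function_integral_eq0 => // phi tphi.
  have [sphi _] := @sqi_test phi 0 tphi.
  have := wg _ tphi; rewrite wg'// => /oppr_inj E.
  rewrite (@eq_Rintegral _ _ _ _ _ (fun x => g x * phi x + -1 * (g' x * phi x))); last first.
    by move=> x _; ring.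
  have i1 := sqiM sg sphi; have i2 := sqiM sg' sphi.
  rewrite RintegralD//; last by have := integrableZl measurableT (-1) i2.
  by rewrite RintegralZl// E; ring.
by apply: filterS H => x /(_ I) H _; lra.
Qed.

Lemma weak_partial_ae i f f' (g : sq) : measurable_fun setT f ->
  measurable_fun setT f' -> f = f' %[ae mu] ->
  weak_partial i f g -> weak_partial i f' g.
Proof.
move=> mf mf' ff' wg phi tphi; rewrite -wg//.
have [_ [mD _]] := @sqi_test phi i tphi.
apply: ae_eq_Rintegral; [exact: measurable_funM|exact: measurable_funM|].
by apply: filterS ff' => x /(_ I) -> .
Qed.

Lemma weak_partialD i f f' (g g' : sq) : sqi mu f -> sqi mu f' ->
  weak_partial i f g -> weak_partial i f' g' ->
  weak_partial i (fun x => f x + f' x) (g + g').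
Proof.
move=> sf sf' wg wg' phi tphi.
have [sphi sD] := @sqi_test phi i tphi.
under eq_Rintegral do rewrite mulrDl.
rewrite RintegralD//; [|exact: sqiM|exact: sqiM].
under [in RHS]eq_Rintegral do rewrite mulrDl.
rewrite RintegralD//; [|by apply: sqiM => //; exact: sqi_Lfun|by apply: sqiM => //; exact: sqi_Lfun].
by rewrite wg// wg'// opprD.
Qed.

Lemma weak_partialZ i a f (g : sq) : sqi mu f ->
  weak_partial i f g -> weak_partial i (fun x => a * f x) (a *: g).
Proof.
move=> sf wg phi tphi.
have [sphi sD] := @sqi_test phi i tphi.
under eq_Rintegral do rewrite -mulrA.
rewrite RintegralZl//; last exact: sqiM.
under [in RHS]eq_Rintegral do rewrite -mulrA.
rewrite RintegralZl//; last by apply: sqiM => //; exact: sqi_Lfun.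
by rewrite wg// mulrN.
Qed.

Lemma wpartialP i j u : H1_set Om u -> weak_partial i (fld u j) (wp i u j).
Proof. by move=> /(_ i j) [g wg]; exact: (xgetPex 0 (ex_intro _ g wg)). Qed.

Lemma H1D u v : H1_set Om u -> H1_set Om v ->
  H1_set Om (u + v) /\
  forall i j, wp i (u + v) j = (fun x => wp i u j x + wp i v j x) %[ae mu].
Proof.
move=> Hu Hv.
have W i j : weak_partial i (fld (u + v) j) (wp i u j + wp i v j).
  apply: (@weak_partial_ae i (fun x => fld u j x + fld v j x)).
  - by apply: measurable_funD; exact: measurable_fld.
  - exact: measurable_fld.
  - by apply: filterS (fldD u v j) => x /(_ I) ->.
  - by apply: weak_partialD; [exact: sqi_fld|exact: sqi_fld|exact: wpartialP|exact: wpartialP].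
have H : H1_set Om (u + v) by move=> i j; exists (wp i u j + wp i v j).
split=> // i j; apply: (@weak_partial_unique i (fld (u + v) j) _ (wp i u j + wp i v j)) => //.
exact: wpartialP.
Qed.

Lemma H1Z a u : H1_set Om u ->
  H1_set Om (a *: u) /\
  forall i j, wp i (a *: u) j = (fun x => a * wp i u j x) %[ae mu].
Proof.
move=> Hu.
have W i j : weak_partial i (fld (a *: u) j) (a *: wp i u j).
  apply: (@weak_partial_ae i (fun x => a * fld u j x)).
  - by apply: measurable_funM => //; exact: measurable_fld.
  - exact: measurable_fld.
  - by apply: filterS (fldZ a u j) => x /(_ I) ->.
  - by apply: weak_partialZ; [exact: sqi_fld|exact: wpartialP].
have H : H1_set Om (a *: u) by move=> i j; exists (a *: wp i u j).
split=> // i j; apply: (@weak_partial_unique i (fld (a *: u) j) _ (a *: wp i u j)) => //.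
exact: wpartialP.
Qed.

Lemma sqi_wp i u j : sqi mu (wp i u j).
Proof. exact: sqi_Lfun. Qed.

Lemma dotVC u v : dotV u v = dotV v u.
Proof.
by apply: eq_bigr => i _; apply: eq_bigr => j _; apply: eq_Rintegral => x _; rewrite mulrC.
Qed.

Lemma dotVDl u v w : H1_set Om u -> H1_set Om v ->
  dotV (u + v) w = dotV u w + dotV v w.
Proof.
move=> Hu Hv; have [_ E] := H1D Hu Hv.
rewrite /dotV -big_split; apply: eq_bigr => i _ /=.
rewrite -big_split; apply: eq_bigr => j _ /=.
rewrite -RintegralD//; [|by apply: sqiM; exact: sqi_wp|by apply: sqiM; exact: sqi_wp].
apply: ae_eq_Rintegral.
- by apply: measurable_funM; exact: (sqi_wp _ _ _).1.
- by apply: measurable_funD; apply: measurable_funM; exact: (sqi_wp _ _ _).1.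
- by apply: filterS (E i j) => x /(_ I) + _ => ->; rewrite mulrDl.
Qed.

Lemma dotVZl a u w : H1_set Om u -> dotV (a *: u) w = a * dotV u w.
Proof.
move=> Hu; have [_ E] := H1Z a Hu.
rewrite /dotV mulr_sumr; apply: eq_bigr => i _ /=.
rewrite mulr_sumr; apply: eq_bigr => j _ /=.
rewrite -RintegralZl//; last by apply: sqiM; exact: sqi_wp.
apply: ae_eq_Rintegral.
- by apply: measurable_funM; exact: (sqi_wp _ _ _).1.
- by apply: measurable_funM => //; apply: measurable_funM; exact: (sqi_wp _ _ _).1.
- by apply: filterS (E i j) => x /(_ I) + _ => ->; rewrite mulrA.
Qed.

Lemma dotV_ge0 u : 0 <= dotV u u.
Proof.
by apply: sumr_ge0 => i _; apply: sumr_ge0 => j _; apply: Rintegral_ge0 => x _;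
  rewrite -expr2 sqr_ge0.
Qed.

Lemma sqr_normV u : normV u ^+ 2 = dotV u u.
Proof. by rewrite sqr_sqrtr// dotV_ge0. Qed.

Lemma normV_ge0 u : 0 <= normV u.
Proof. exact: sqrtr_ge0. Qed.

Lemma normVE u : normV u = Num.sqrt (dotV u u).
Proof. by []. Qed.

#[local] Opaque dotV normV.

Lemma dotV_sqrD u v : H1_set Om u -> H1_set Om v ->
  dotV (u + v) (u + v) = dotV u u + 2 * dotV u v + dotV v v.
Proof.
move=> Hu Hv; rewrite (dotVDl _ Hu Hv) (dotVC u) (dotVC v).
rewrite (dotVDl u Hu Hv) (dotVDl v Hu Hv) (dotVC v u).
by move: (dotV u u) (dotV u v) (dotV v v) => a b c; ring.
Qed.

Lemma dotV_CS u v : H1_set Om u -> H1_set Om v ->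
  `|dotV u v| <= normV u * normV v.
Proof.
move=> Hu Hv.
have H a : 0 <= dotV u u + 2 * a * dotV u v + a ^+ 2 * dotV v v.
  have [Hav _] := H1Z a Hv.
  have := dotV_ge0 (u + a *: v).
  rewrite (dotV_sqrD Hu Hav) (dotVC u) (dotVZl _ _ Hv) (dotVZl _ _ Hv) (dotVC v (a *: v)) (dotVZl _ _ Hv) (dotVC v u).
  move: (dotV u u) (dotV u v) (dotV v v) => x y z.
  by have -> : x + 2 * (a * y) + a * (a * z) = x + 2 * a * y + a ^+ 2 * z by ring.
rewrite !normVE; apply: norm_le_sqrt_mul (dotV_ge0 u) _.
exact: quadratic_ge0_discriminant (dotV_ge0 u) (dotV_ge0 v) H.
Qed.

Lemma normVD u v : H1_set Om u -> H1_set Om v ->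
  normV (u + v) <= normV u + normV v.
Proof.
move=> Hu Hv; rewrite normVE -[leRHS]ger0_norm ?addr_ge0 ?normV_ge0// -sqrtr_sqr ler_wsqrtr//.
rewrite (dotV_sqrD Hu Hv).
apply: (polarized_le (sqr_normV u) (sqr_normV v)).
exact: le_trans (ler_norm _) (dotV_CS Hu Hv).
Qed.

Lemma normVZ a u : H1_set Om u -> normV (a *: u) = `|a| * normV u.
Proof.
move=> Hu; rewrite !normVE dotVZl// dotVC dotVZl// mulrA -expr2.
by rewrite sqrtrM ?sqr_ge0// sqrtr_sqr.
Qed.

Lemma H1N u : H1_set Om u -> H1_set Om (- u).
Proof. by move=> /(H1Z (-1))[]; rewrite scaleN1r. Qed.

Lemma H1B u v : H1_set Om u -> H1_set Om v -> H1_set Om (u - v).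
Proof. by move=> Hu Hv; exact: (H1D Hu (H1N Hv)).1. Qed.

Lemma normVN u : H1_set Om u -> normV (- u) = normV u.
Proof. by move=> Hu; rewrite -scaleN1r normVZ// normrN normr1 mul1r. Qed.

End weak_partials.

(** * Divergence-free test fields *)
Lemma term_le_sum (R : realType) (I : finType) (F : I -> R) j :
  (forall k, 0 <= F k) -> F j <= \sum_k F k.
Proof. by move=> F0; rewrite (bigD1 j)//= lerDl sumr_ge0. Qed.

(** The index pattern of an integration by parts: [a i j] carries the divergence
    when summed over [i], and [b i j] is a term of the trilinear form. *)
Lemma double_sum_eq0 (R : realType) (a b : 'I_3 -> 'I_3 -> R) :
  (forall i j, a i j + 2 * b i j = 0) -> (forall j, \sum_i a i j = 0) ->
  \sum_i \sum_j b i j = 0.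
Proof.
move=> ab a0; have : \sum_i \sum_j (a i j + 2 * b i j) = 0.
  by rewrite big1// => i _; rewrite big1.
under eq_bigr do rewrite big_split/= -mulr_sumr.
rewrite big_split/= -mulr_sumr exchange_big/= big1 ?add0r; last by move=> j _; exact: a0.
by move=> /eqP; rewrite mulf_eq0 pnatr_eq0/= => /eqP.
Qed.

Section divergence_free.
Context {R : realType} (Om : smooth_domain R).
Local Notation X := (R * R * R)%type.
Local Notation mu := (domain_measure Om).
Local Notation sq := (LfunType mu (lee1n 2)).
Local Notation wp i u j := (wpartial Om i (fld u j)).
Implicit Types (u v w : L2field Om).

Lemma C1c_Rintegral_derive L (f : X -> R) i : C1c L f ->
  \int[vol R]_x 'D_(axis i) f x = 0.
Proof. by move=> Cf; rewrite /Rintegral (C1c_integral_derive i Cf). Qed.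

Lemma C0c_RintegralD L (f g : X -> R) : C0c L f -> C0c L g ->
  \int[vol R]_x (f x + g x) = \int[vol R]_x f x + \int[vol R]_x g x.
Proof.
by move=> Cf Cg; apply: RintegralD => //; [exact: C0c_integrable Cf|exact: C0c_integrable Cg].
Qed.

Lemma C0c_RintegralZ L (f : X -> R) a : C0c L f ->
  \int[vol R]_x (a * f x) = a * \int[vol R]_x f x.
Proof. by move=> Cf; apply: RintegralZl => //; exact: C0c_integrable Cf. Qed.

Lemma C0cZ L (f : X -> R) a : C0c L f -> C0c L (fun x => a * f x).
Proof.
move=> [cf fL]; split; last by move=> x; rewrite mulf_eq0 negb_or => /andP[_ /fL].
by move=> x; apply: continuousM; [exact: cvg_cst|exact: cf].
Qed.

Lemma addr_eq0_opp (a b : R) : a + b = 0 -> a = - b.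
Proof. by move/eqP; rewrite addr_eq0 => /eqP. Qed.

Lemma L2_normE u : `|u| = L2_norm u. Proof. by []. Qed.

Lemma sqr_L2_norm u : `|u| ^+ 2 = L2_dot u u.
Proof. by rewrite L2_normE sqr_sqrtr// L2_dot_ge0. Qed.

(** Integration by parts: the integral of [d_i (phi psi)] is 0. *)
Lemma C1c_weak_partial L i (phi : X -> R) (g : sq) : 
  (forall psi : X -> R, test_function Om psi -> C1c L psi) ->
  C1c L phi ->
  (forall x, ~ (Om : set X) x -> phi x = 0) ->
  (forall x, ~ (Om : set X) x -> 'D_(axis i) phi x = 0) ->
  g = 'D_(axis i) phi :> (mspace R -> R) ->
  weak_partial i (phi : mspace R -> R) g.
Proof.
move=> HL Cphi phi0 Dphi0 gE psi tpsi.
have Cpsi := HL _ tpsi.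
have [C0phi _ CDphi] := Cphi; have [C0psi _ CDpsi] := Cpsi.
have e1 := @Rintegral_domain _ Om (fun x => phi x * 'D_(axis i) psi x)
  (fun x Ox => etrans (congr1 ( *%R^~ _) (phi0 x Ox)) (mul0r _)).
have e2 := @Rintegral_domain _ Om (fun x => 'D_(axis i) phi x * psi x)
  (fun x Ox => etrans (congr1 ( *%R^~ _) (Dphi0 x Ox)) (mul0r _)).
rewrite [LHS]e1 gE [X in - X]e2.
have [Cpp E] := C1c_mul Cphi Cpsi.
apply: addr_eq0_opp.
have e3 : \int[vol R]_x ('D_(axis i) phi x * psi x) = \int[vol R]_x (psi x * 'D_(axis i) phi x).
  by apply: eq_Rintegral => x _; exact: mulrC.
rewrite [X in _ + X]e3.
rewrite -[LHS](C0c_RintegralD (C0c_mul C0phi (CDpsi i).1) (C0c_mul C0psi (CDphi i).1)).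
rewrite -(C1c_Rintegral_derive i Cpp); apply: eq_Rintegral => x _; exact/esym/E.
Qed.

(** All that the estimates need from a smooth representative.  The cube of side
    [2 L] depends on [Om] only, which makes their constants uniform. *)
Definition E_repr L u (phi : 'I_3 -> X -> R) :=
  [/\ forall j, C1c L (phi j), forall x, \sum_i 'D_(axis i) (phi i) x = 0,
      forall j x, ~ (Om : set X) x -> phi j x = 0,
      forall i j x, ~ (Om : set X) x -> 'D_(axis i) (phi j) x = 0
    & (forall j, fld u j = phi j %[ae mu]) /\
      forall i j, wp i u j = 'D_(axis i) (phi j) %[ae mu]].

Lemma E_set_repr : exists2 L : R, 0 < L & forall u, E_set Om u ->
  H1_set Om u /\ exists phi, E_repr L u phi.
Proof.
have [L L0 HL] := test_functions_C1c Om; exists L => // u [phi [tphi div_phi fphi]].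
have H1 j := HL _ (tphi j).
have HC psi : test_function Om psi -> C1c L psi by move=> /HL[].
have D i j : exists2 g : sq, weak_partial i (fld u j) g & g = 'D_(axis i) (phi j) :> (mspace R -> R).
  have [Cj p0 Dp0] := H1 j; have [_ _ CD] := Cj.
  have [g gE] := Lfun_sqi (C0c_sqi Om (CD i)).
  exists g => //; apply: (@weak_partial_ae _ _ i (phi j : mspace R -> R)).
  - by have [C0 _ _] := Cj; exact: C0c_measurable C0.
  - exact: measurable_fld.
  - by apply: filterS (fphi j) => x /(_ I) ->.
  - exact: (C1c_weak_partial HC Cj p0 (Dp0 i) gE).
have Hu : H1_set Om u by move=> i j; have [g wg _] := D i j; exists g.
split => //; exists phi; split => //.
- by move=> j; have [] := H1 j.
- by move=> j; have [] := H1 j.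
- by move=> i j; have [_ _] := H1 j; exact.
split => // i j; have [g wg gE] := D i j.
have := weak_partial_unique (wpartialP i j Hu) wg.
by apply: filterS => x /(_ I) ->; rewrite gE.
Qed.

Section representative.
Variables (L : R) (L0 : 0 < L) (u : L2field Om) (phi : 'I_3 -> X -> R).
Hypothesis uphi : E_repr L u phi.

Lemma E_repr_norm : `|u| ^+ 2 = \sum_j \int[vol R]_x phi j x ^+ 2.
Proof.
have [C _ p0 _ [fphi _]] := uphi.
rewrite sqr_L2_norm; apply: eq_bigr => j _.
rewrite -(@Rintegral_domain _ Om); last by move=> x Ox; rewrite p0// expr0n.
apply: ae_eq_Rintegral.
- by apply: measurable_funM; exact: measurable_fld.
- by apply: measurable_funX; have [C0 _ _] := C j; exact: C0c_measurable C0.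
- by apply: filterS (fphi j) => x /(_ I) -> _; rewrite expr2.
Qed.

Lemma E_repr_dotV : dotV u u = \sum_j \sum_i \int[vol R]_x ('D_(axis i) (phi j) x) ^+ 2.
Proof.
have [C _ p0 Dp0 [_ wphi]] := uphi.
rewrite /dotV [LHS]exchange_big; apply: eq_bigr => j _; apply: eq_bigr => i _.
rewrite -(@Rintegral_domain _ Om); last by move=> x Ox; rewrite Dp0// expr0n.
apply: ae_eq_Rintegral.
- by apply: measurable_funM; exact: (sqi_wp _ _ _).1.
- by apply: measurable_funX; have [_ _ CD] := C j; exact: C0c_measurable (CD i).
- by apply: filterS (wphi i j) => x /(_ I) -> _; rewrite expr2.
Qed.

Lemma E_repr_Poincare : `|u| ^+ 2 <= 16 * L ^+ 2 * dotV u u.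
Proof.
have [C _ _ _ _] := uphi.
rewrite E_repr_norm E_repr_dotV mulr_sumr; apply: ler_sum => j _.
by have [] := C1c_estimates L0 (C j).
Qed.

Lemma E_repr_L4 j : 
  mu.-integrable setT (EFin \o (fun x => fld u j x ^+ 4)) /\
  \int[mu]_x fld u j x ^+ 4 <= 16 * L * dotV u u ^+ 2.
Proof.
have [C _ p0 _ [fphi _]] := uphi; have [C0 _ _] := C j.
have mp := C0c_measurable C0.
have fp : (fun x => phi j x ^+ 4) = (fun x => fld u j x ^+ 4) %[ae mu].
  by apply: filterS (fphi j) => x /(_ I) -> _.
have [M HM] := C0c_bounded C0.
split.
  have : mu.-integrable setT (EFin \o (fun x : mspace R => phi j x ^+ 4)).
    apply: (@bounded_integrable_domain _ _ _ (M ^+ 4)); first exact: measurable_funX.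
    by move=> x; rewrite normrX lerXn2r// ?nnegrE// (le_trans (normr_ge0 _) (HM x)).
  move=> ip; have sp : sqi mu (fun x : mspace R => phi j x ^+ 2).
    by split; [exact: measurable_funX|apply: eq_integrable ip => // x _ /=; rewrite -exprM].
  have : sqi mu (fun x => fld u j x ^+ 2).
    apply: sqi_ae sp; first by apply: measurable_funX; exact: measurable_fld.
    by apply: filterS (fphi j) => x /(_ I) -> _.
  by move=> [_]; apply: eq_integrable => // x _ /=; rewrite -exprM.
rewrite -(ae_eq_Rintegral _ _ fp); last 2 first.
- exact: measurable_funX.
- by apply: measurable_funX; exact: measurable_fld.
rewrite (@Rintegral_domain _ Om); last by move=> x Ox; rewrite p0// expr0n.
have [_ H] := C1c_estimates L0 (C j); apply: (le_trans H).
have Gle : \sum_i \int[vol R]_x ('D_(axis i) (phi j) x) ^+ 2 <= dotV u u.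
  rewrite E_repr_dotV.
  apply: (term_le_sum (F := fun j => \sum_i \int[vol R]_x ('D_(axis i) (phi j) x) ^+ 2)) => k.
  by apply: sumr_ge0 => i _; apply: Rintegral_ge0 => x _; exact: sqr_ge0.
apply: ler_wpM2l; first by rewrite mulr_ge0// ltW.
rewrite lerXn2r// nnegrE ?dotV_ge0//.
by apply: sumr_ge0 => i _; apply: Rintegral_ge0 => x _; exact: sqr_ge0.
Qed.

(** Since [d_i (phi_i phi_j^2)] has integral 0, twice the term [i, j] of the
    trilinear form is minus the integral of [phi_j^2 d_i phi_i], and the latter
    sum to 0 over [i]. *)
Lemma E_repr_trilinear0 : trilinear u u u = 0.
Proof.
have [C div0 p0 Dp0 [fphi wphi]] := uphi.
have E : trilinear u u u =
    \sum_i \sum_j \int[vol R]_x (phi i x * 'D_(axis i) (phi j) x * phi j x).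
  apply: eq_bigr => i _; apply: eq_bigr => j _.
  rewrite -(@Rintegral_domain _ Om); last by move=> x Ox; rewrite p0// !mul0r.
  have mp k : measurable_fun setT (phi k : mspace R -> R).
    by have [C0 _ _] := C k; exact: C0c_measurable C0.
  apply: ae_eq_Rintegral.
  - by apply: measurable_funM; [apply: measurable_funM|]; exact: (sqi_wp _ _ _).1 || exact: measurable_fld.
  - apply: measurable_funM; [apply: measurable_funM|] => //.
    by have [_ _ CD] := C j; exact: C0c_measurable (CD i).
  - apply: filterS3 (fphi i) (fphi j) (wphi i j) => x.
    by move=> /(_ I) -> /(_ I) -> /(_ I) ->.
have CC i j : C0c L (fun x => phi i x * 'D_(axis i) (phi j) x * phi j x).
  have [C0i _ _] := C i; have [C0j _ CD] := C j.
  exact: (C0c_mul (C0c_mul C0i (CD i).1) C0j.1).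
have CD2 i j : C0c L (fun x => phi j x ^+ 2 * 'D_(axis i) (phi i) x).
  have [C0i _ CD] := C i; have [C0j _ _] := C j.
  exact: (C0c_mul (C0c_sqr C0j) (CD i).1).
have IBP i j : \int[vol R]_x (phi j x ^+ 2 * 'D_(axis i) (phi i) x) +
    2 * \int[vol R]_x (phi i x * 'D_(axis i) (phi j) x * phi j x) = 0.
  rewrite -(C0c_RintegralZ 2 (CC i j)).
  rewrite -[LHS](C0c_RintegralD (CD2 i j) (C0cZ 2 (CC i j))).
  have [Cjj Ejj] := C1c_mul (C j) (C j).
  have [Cijj Eijj] := C1c_mul (C i) Cjj.
  rewrite -(C1c_Rintegral_derive i Cijj).
  by apply: eq_Rintegral => x _; rewrite Eijj Ejj; ring.
rewrite E.
apply: (double_sum_eq0 (a := fun i j => \int[vol R]_x (phi j x ^+ 2 * 'D_(axis i) (phi i) x))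
  (b := fun i j => \int[vol R]_x (phi i x * 'D_(axis i) (phi j) x * phi j x)) IBP) => j.
rewrite (sum_ord3 (fun i => \int[vol R]_x (phi j x ^+ 2 * 'D_(axis i) (phi i) x))).
  rewrite -(C0c_RintegralD (CD2 0 j) (CD2 1 j)).
  rewrite -[LHS](C0c_RintegralD (C0c_add (CD2 0 j) (CD2 1 j)) (CD2 2 j)).
  rewrite -[RHS](mul0r (fine (vol R setT))) -(Rintegral_cst _ measurableT).
  apply: eq_Rintegral => x _ /=.
  by rewrite -!mulrDr -(sum_ord3 (fun i => 'D_(axis i) (phi i) x)) div0 mulr0.
Qed.

End representative.

End divergence_free.

(** * The space V *)
Section V_space.
Context {R : realType} (Om : smooth_domain R).
Local Notation X := (R * R * R)%type.
Local Notation mu := (domain_measure Om).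
Local Notation wp i u j := (wpartial Om i (fld u j)).
Implicit Types (u v w : L2field Om).

Lemma smooth_Cn (Y : normedModType R) (f : Y -> R) : smooth f -> forall n, Cn n f.
Proof.
move=> sf n; rewrite -[f]/(iter_derive [::] f).
elim: n [::] => [|n ih] s /=; first by have [] := sf s.
have [cs ds] := sf s; split => // e.
exact: (ih (e :: s)).
Qed.

Lemma closure_support_sub (f g h : X -> R) :
  (forall x, h x != 0 -> f x != 0 \/ g x != 0) ->
  closure [set x | h x != 0] `<=`
    closure [set x | f x != 0] `|` closure [set x | g x != 0].
Proof.
move=> H.
rewrite [X in _ `<=` X](closure_id _).1; last first.
  by apply: closedU; exact: closed_closure.
apply: closureS => x /= /H [fx|gx].
  by left; exact: subset_closure.
by right; exact: subset_closure.
Qed.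

Lemma test_functionD (O : set X) (f g : X -> R) : test_function O f ->
  test_function O g -> test_function O (fun x => f x + g x).
Proof.
move=> [sf cf fO] [sg cg gO].
have sub := @closure_support_sub f g (fun x => f x + g x) _.
have {}sub : closure [set x | f x + g x != 0] `<=`
    closure [set x | f x != 0] `|` closure [set x | g x != 0].
  apply: sub => x; have [->|] := eqVneq (f x) 0; last by left.
  by rewrite add0r; right.
split.
- by apply: Cn_smooth => n; apply: CnD; exact: smooth_Cn.
- apply: subclosed_compact sub; first exact: closed_closure.
  exact: compactU.
- by apply: (subset_trans sub) => x [/fO|/gO].
Qed.

Lemma test_functionZ (O : set X) (a : R) (f : X -> R) : test_function O f ->
  test_function O (fun x => a * f x).
Proof.
move=> [sf cf fO].
have sub : closure [set x | a * f x != 0] `<=` closure [set x | f x != 0].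
  by apply: closureS => x /=; rewrite mulf_eq0 negb_or => /andP[].
split.
- by apply: Cn_smooth => n; apply: CnM; [exact: Cn_cst|exact: smooth_Cn].
- by apply: subclosed_compact sub; first exact: closed_closure.
- by apply: (subset_trans sub) => x /fO.
Qed.

Lemma test_function_derivable (O : set X) (f : X -> R) x e :
  test_function O f -> derivable f x e.
Proof. by move=> [/(_ [::])[_ df] _ _]; exact: df. Qed.

Lemma E_setD u v : E_set Om u -> E_set Om v -> E_set Om (u + v).
Proof.
move=> [phi [tphi dphi uphi]] [psi [tpsi dpsi vpsi]].
exists (fun i x => phi i x + psi i x); split.
- by move=> i; exact: test_functionD.
- move=> x; have -> : \sum_i 'D_(axis i) (fun x => phi i x + psi i x) x =
      \sum_i ('D_(axis i) (phi i) x + 'D_(axis i) (psi i) x).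
    apply: eq_bigr => i _.
    by have := deriveD (@test_function_derivable Om (phi i) x (axis i) (tphi i)) (@test_function_derivable Om (psi i) x (axis i) (tpsi i)).
  by rewrite big_split/= dphi dpsi addr0.
- move=> i; apply: filterS3 (fldD u v i) (uphi i) (vpsi i) => x.
  by move=> /(_ I) -> /(_ I) /= -> /(_ I) ->.
Qed.

Lemma E_setZ a u : E_set Om u -> E_set Om (a *: u).
Proof.
move=> [phi [tphi dphi uphi]].
exists (fun i x => a * phi i x); split.
- by move=> i; exact: test_functionZ.
- move=> x; have -> : \sum_i 'D_(axis i) (fun x => a * phi i x) x =
      \sum_i a * ('D_(axis i) (phi i) x).
    apply: eq_bigr => i _.
    by have := deriveZ a (@test_function_derivable Om (phi i) x (axis i) (tphi i)).
  by rewrite -mulr_sumr dphi mulr0.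
- move=> i; apply: filterS2 (fldZ a u i) (uphi i) => x.
  by move=> /(_ I) -> /(_ I) /= ->.
Qed.

Lemma E_set_H1 u : E_set Om u -> H1_set Om u.
Proof. by have [L L0 H] := E_set_repr Om => /H[]. Qed.

Lemma V_H1 u : V_set Om u -> H1_set Om u. Proof. by case. Qed.

#[local] Opaque dotV normV.

Lemma V_approx u e : V_set Om u -> 0 < e ->
  exists phi, [/\ E_set Om phi, `|u - phi| < e & normV (u - phi) < e].
Proof.
move=> [_ Vu] e0; have [phi Ephi nphi] := Vu e e0; exists phi.
have lt (a b : R) : 0 <= a -> 0 <= b -> Num.sqrt (a ^+ 2 + b ^+ 2) < e -> a < e /\ b < e.
  move=> a0 b0 abe; split; apply: le_lt_trans abe.
    by rewrite -{1}[a]ger0_norm// -sqrtr_sqr ler_wsqrtr// lerDl sqr_ge0.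
  by rewrite -{1}[b]ger0_norm// -sqrtr_sqr ler_wsqrtr// lerDr sqr_ge0.
by have [] := lt _ _ (normr_ge0 _) (normV_ge0 _) nphi; split.
Qed.

Lemma V_intro u : H1_set Om u -> (forall e, 0 < e ->
  exists phi, [/\ E_set Om phi, `|u - phi| <= e & normV (u - phi) <= e]) -> V_set Om u.
Proof.
move=> Hu H; split => // e e0.
have [phi [Ephi n1 n2]] := H (e / 2) (divr_gt0 e0 (ltr0Sn _ 1)).
exists phi => //; rewrite /normH1.
have lt (a b : R) : 0 <= a -> 0 <= b -> a <= e / 2 -> b <= e / 2 -> Num.sqrt (a ^+ 2 + b ^+ 2) < e.
  move=> a0 b0 ae be; rewrite -[ltRHS]gtr0_norm// -sqrtr_sqr ltr_sqrt ?exprn_gt0//.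
  by nra.
by apply: lt => //; exact: normV_ge0.
Qed.

Lemma VD u v : V_set Om u -> V_set Om v -> V_set Om (u + v).
Proof.
move=> Vu Vv; have Hu := V_H1 Vu; have Hv := V_H1 Vv.
apply: V_intro; first exact: (H1D Hu Hv).1.
move=> e e0; have e20 : 0 < e / 2 by rewrite divr_gt0.
have [phi [Ephi n1 n2]] := V_approx Vu e20.
have [psi [Epsi m1 m2]] := V_approx Vv e20.
exists (phi + psi).
have -> : u + v - (phi + psi) = (u - phi) + (v - psi) by rewrite opprD addrACA.
split; first exact: E_setD.
  by apply: (le_trans (ler_normD _ _)); rewrite [leRHS]splitr; exact: lerD (ltW n1) (ltW m1).
apply: (le_trans (normVD (H1B Hu (E_set_H1 Ephi)) (H1B Hv (E_set_H1 Epsi)))).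
by rewrite [leRHS]splitr; exact: lerD (ltW n2) (ltW m2).
Qed.

Lemma VZ a u : V_set Om u -> V_set Om (a *: u).
Proof.
move=> Vu; have Hu := V_H1 Vu.
apply: V_intro; first exact: (H1Z a Hu).1.
move=> e e0; have e20 : 0 < e / (1 + `|a|) by rewrite divr_gt0// ltr_pwDl.
have [phi [Ephi n1 n2]] := V_approx Vu e20.
exists (a *: phi); rewrite -scalerBr.
have lt (x : R) : 0 <= x -> x < e / (1 + `|a|) -> `|a| * x <= e.
  move=> x0; rewrite ltr_pdivlMr ?ltr_pwDl//; have := normr_ge0 a; nra.
split; first exact: E_setZ.
  by rewrite normrZ; exact: lt.
by rewrite (normVZ _ (H1B Hu (E_set_H1 Ephi))); apply: lt => //; exact: normV_ge0.
Qed.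

Lemma VB u v : V_set Om u -> V_set Om v -> V_set Om (u - v).
Proof. by move=> Vu Vv; have := VD Vu (VZ (-1) Vv); rewrite scaleN1r. Qed.

Lemma V0 : V_set Om 0.
Proof.
have K0 : [set _ : X | (0 : R) != 0] = set0.
  by apply/seteqP; split => // x /=; rewrite eqxx.
have E0 : E_set Om 0.
  exists (fun _ _ => 0); split.
  - move=> i; split.
    + by apply: Cn_smooth => n; exact: Cn_cst.
    + by rewrite K0 closure0; exact: compact0.
    + by rewrite K0 closure0.
  - by move=> x; rewrite big1// => i _; rewrite derive_cst.
  - by move=> i; exact: fld0.
have H0 := E_set_H1 E0.
apply: V_intro => // e e0; exists 0; split => //.
  by rewrite subr0 normr0 ltW.
by rewrite subr0 -(scale0r (0 : L2field Om)) normVZ// normr0 mul0r ltW.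
Qed.

Lemma E_set_bounds : exists2 C : R, 0 < C & forall u, E_set Om u ->
  [/\ `|u| <= C * normV u, trilinear u u u = 0
    & forall j, mu.-integrable setT (EFin \o (fun x => fld u j x ^+ 4)) /\
        \int[mu]_x fld u j x ^+ 4 <= C * normV u ^+ 4].
Proof.
have [L L0 H] := E_set_repr Om.
exists (4 * L + 16 * L); first by rewrite addr_gt0 ?mulr_gt0.
move=> u /H[Hu [phi Hphi]]; split.
- have := E_repr_Poincare L0 Hphi; rewrite -sqr_normV.
  have := normV_ge0 u; have := normr_ge0 u.
  move: (`|u|) (normV u) => x y x0 y0 xy.
  apply: (@le_trans _ _ (4 * L * y)); last by rewrite ler_wpM2r// lerDl mulr_ge0// ltW.
  rewrite -(@ler_pXn2r _ 2)// ?nnegrE ?mulr_ge0//; last exact: ltW.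
  by apply: (le_trans xy); rewrite le_eqVlt; apply/orP; left; apply/eqP; ring.
- exact: E_repr_trilinear0 Hphi.
- move=> j; have [i4 l4] := E_repr_L4 L0 Hphi j; split => //.
  apply: (le_trans l4); rewrite -sqr_normV -exprM.
  by rewrite ler_wpM2r ?exprn_ge0 ?normV_ge0// lerDr mulr_ge0// ltW.
Qed.

End V_space.

Section scalar_limits.
Context {R : realType}.

Lemma le_of_le_addMe (x y B : R) : 0 <= B ->
  (forall e, 0 < e -> e <= 1 -> x <= y + e * B) -> x <= y.
Proof.
move=> B0 H; apply/ler_addgt0Pr => e e0.
have d0 : 0 < Num.min 1 (e / (B + 1)) by rewrite lt_min ltr01/= divr_gt0// ltr_wpDl.
have := H _ d0 _; rewrite ge_min lexx => /(_ isT) xy.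
apply: (le_trans xy); rewrite lerD2l.
have : Num.min 1 (e / (B + 1)) <= e / (B + 1) by rewrite ge_min lexx orbT.
rewrite ler_pdivlMr ?ltr_wpDl//; nra.
Qed.

Lemma pow4_add_le (a e : R) : 0 <= a -> 0 <= e -> e <= 1 ->
  (a + e) ^+ 4 <= a ^+ 4 + e * (4 * a ^+ 3 + 6 * a ^+ 2 + 4 * a + 1).
Proof.
move=> a0 e0 e1.
have -> : (a + e) ^+ 4 = a ^+ 4 + e * (4 * a ^+ 3 + 6 * a ^+ 2 * e + 4 * a * e ^+ 2 + e ^+ 3) by ring.
rewrite lerD2l ler_wpM2l//.
have e2 : e ^+ 2 <= 1 by rewrite expr_le1.
have e3 : e ^+ 3 <= 1 by rewrite expr_le1.
by rewrite !lerD// ler_piMr// ?mulr_ge0// sqr_ge0.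
Qed.

Lemma pow4_min_le (a b K : R) : 0 <= K ->
  Num.min `|a| K ^+ 4 <= b ^+ 4 + 4 * K ^+ 3 * `|a - b|.
Proof.
move=> K0.
have -> : b ^+ 4 = `|b| ^+ 4.
  by rewrite -[LHS]ger0_norm ?normrX// exprn_even_ge0.
have : `|a| - `|b| <= `|a - b| by exact: lerB_dist.
set x := `|a|; set y := `|b|; set d := `|a - b| => xyd.
have x0 : 0 <= x by exact: normr_ge0.
have y0 : 0 <= y by exact: normr_ge0.
have d0 : 0 <= d by exact: normr_ge0.
set m := Num.min x K.
have m0 : 0 <= m by rewrite le_min x0.
have mx : m <= x by rewrite ge_min lexx.
have mK : m <= K by rewrite ge_min lexx orbT.
have [my|ym] := leP m y.
  by apply: (@le_trans _ _ (y ^+ 4)); [rewrite lerXn2r|rewrite lerDl !mulr_ge0// exprn_ge0].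
have -> : m ^+ 4 = y ^+ 4 + (m - y) * (m ^+ 3 + m ^+ 2 * y + m * y ^+ 2 + y ^+ 3) by ring.
rewrite lerD2l mulrC.
have yK : y <= K by apply: le_trans mK; exact: ltW.
apply: ler_pM => //.
- by rewrite !addr_ge0// ?mulr_ge0// ?exprn_ge0.
- by rewrite subr_ge0 ltW.
- have -> : 4 * K ^+ 3 = K ^+ 3 + K ^+ 2 * K + K * K ^+ 2 + K ^+ 3 by ring.
  by rewrite !lerD// ?ler_pM// ?lerXn2r// ?mulr_ge0// ?exprn_ge0.
- by apply: le_trans xyd; rewrite lerB.
Qed.

Lemma limn_einf_le_cst (u : (\bar R)^nat) (c : \bar R) :
  (forall n, u n <= c)%E -> (limn_einf u <= c)%E.
Proof.
move=> uc; rewrite limn_einf_lim; apply: lime_le; first exact: is_cvg_einfs.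
apply: nearW => n; apply: le_trans (uc n).
by apply: ereal_inf_lbound; exists n => /=.
Qed.

End scalar_limits.

Section V_estimates.
Context {R : realType} (Om : smooth_domain R).
Local Notation X := (R * R * R)%type.
Local Notation mu := (domain_measure Om).
Local Notation wp i u j := (wpartial Om i (fld u j)).
Implicit Types (u v w : L2field Om).

#[local] Opaque dotV normV.

Lemma fldB u v j : fld (u - v) j = (fun x => fld u j x - fld v j x) %[ae mu].
Proof.
have H1 := fldD u (-1 *: v) j; have H2 := fldZ (-1) v j.
rewrite -scaleN1r; apply: filterS2 H1 H2 => x /(_ I) -> /(_ I) /= -> _.
by rewrite mulN1r.
Qed.

Lemma fld_sqr_le u j : \int[mu]_x fld u j x ^+ 2 <= `|u| ^+ 2.
Proof.
rewrite sqr_L2_norm /L2_dot.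
have -> : \int[mu]_x fld u j x ^+ 2 = \int[mu]_x (fld u j x * fld u j x).
  by apply: eq_Rintegral => x _; rewrite expr2.
apply: (term_le_sum (F := fun j => \int[mu]_x (fld u j x * fld u j x))) => k.
by apply: Rintegral_ge0 => x _; rewrite -expr2 sqr_ge0.
Qed.

Lemma wp_sqr_le u i j : \int[mu]_x wp i u j x ^+ 2 <= normV u ^+ 2.
Proof.
rewrite sqr_normV.
have -> : \int[mu]_x wp i u j x ^+ 2 = \int[mu]_x (wp i u j x * wp i u j x).
  by apply: eq_Rintegral => x _; rewrite expr2.
have G0 a b : 0 <= \int[mu]_x (wp a u b x * wp a u b x).
  by apply: Rintegral_ge0 => x _; rewrite -expr2 sqr_ge0.
apply: (le_trans (term_le_sum (F := fun b => \int[mu]_x (wp i u b x * wp i u b x)) j (G0 i))).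
apply: (term_le_sum (F := fun a => \sum_b \int[mu]_x (wp a u b x * wp a u b x))) => a.
by apply: sumr_ge0 => b _; exact: G0.
Qed.

Lemma fld_L1_le : exists2 M : R, 0 <= M & forall u j,
  \int[mu]_x `|fld u j x| <= M * `|u|.
Proof.
pose m := \int[mu]_x (1 : R) ^+ 2.
have m0 : 0 <= m by apply: Rintegral_ge0 => x _; exact: sqr_ge0.
exists (Num.sqrt m); first exact: sqrtr_ge0.
move=> u j.
have s1 : sqi mu (fun=> 1).
  by split => //; apply: (@bounded_integrable_domain _ _ _ 1) => // x; rewrite expr1n normr1.
have [mf f2] := sqi_fld u j.
have sf : sqi mu (fun x => `|fld u j x|).
  split; first exact: measurableT_comp.
  by apply: eq_integrable f2 => // x _ /=; rewrite real_normK// num_real.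
have := sqi_CS sf s1; under eq_Rintegral do rewrite mulr1.
have -> : \int[mu]_x `|fld u j x| ^+ 2 = \int[mu]_x fld u j x ^+ 2.
  by apply: eq_Rintegral => x _; rewrite real_normK// num_real.
move=> H.
have I0 : 0 <= \int[mu]_x `|fld u j x| by apply: Rintegral_ge0.
rewrite -(@ler_pXn2r _ 2)// ?nnegrE// ?mulr_ge0// ?sqrtr_ge0//.
apply: (le_trans H); rewrite exprMn sqr_sqrtr// mulrC ler_wpM2l//.
exact: fld_sqr_le.
Qed.

(** By density.  The map [x |-> min(|x|, n)^4] is Lipschitz, so the truncated
    bound survives a limit in [L^1] of elements of [E]; Fatou's lemma then removes
    the truncation. *)
Lemma V_bounds : exists2 C : R, 0 < C & forall u, V_set Om u ->
  `|u| <= C * normV u /\ forall j, 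
    mu.-integrable setT (EFin \o (fun x => fld u j x ^+ 4)) /\
    \int[mu]_x fld u j x ^+ 4 <= C * normV u ^+ 4.
Proof.
have [C C0 HC] := E_set_bounds Om; exists C => // u Vu.
have [M M0 HM] := fld_L1_le.
have nE e phi : E_set Om phi -> normV (u - phi) < e -> normV phi <= normV u + e.
  move=> Ephi ne.
  have -> : phi = u - (u - phi) by rewrite opprB addrC subrK.
  have Hup := H1B (V_H1 Vu) (E_set_H1 Ephi).
  apply: (le_trans (normVD (V_H1 Vu) (H1N Hup))).
  by rewrite (normVN Hup) lerD2l ltW.
split.
  apply: (@le_of_le_addMe _ _ _ (1 + C)); first by rewrite addr_ge0// ltW.
  move=> e e0 _; have [phi [Ephi n1 n2]] := V_approx Vu e0.
  have [P _ _] := HC _ Ephi.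
  have -> : u = (u - phi) + phi by rewrite subrK.
  apply: (le_trans (ler_normD _ _)); rewrite subrK.
  apply: (@le_trans _ _ (e + C * (normV u + e))).
    by apply: lerD; [exact: ltW|apply: (le_trans P); rewrite ler_pM2l//; exact: nE].
  by move: (normV u) => a; rewrite le_eqVlt; apply/orP; left; apply/eqP; ring.
move=> j; have [mf f2] := sqi_fld u j.
have mm n : measurable_fun setT (fun x => Num.min `|fld u j x| n%:R ^+ 4).
  apply: measurable_funX; apply: measurable_minr => //.
  exact: measurableT_comp.
have mm0 n x : 0 <= Num.min `|fld u j x| n%:R ^+ 4 by rewrite exprn_even_ge0.
have im n : mu.-integrable setT (EFin \o (fun x => Num.min `|fld u j x| n%:R ^+ 4)).
  apply: (@bounded_integrable_domain _ _ _ (n%:R ^+ 4)) => // x.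
  rewrite ger0_norm ?mm0// lerXn2r// ?nnegrE ?le_min ?normr_ge0 ?ler0n//.
  by rewrite ge_min lexx orbT.
have bound n : \int[mu]_x Num.min `|fld u j x| n%:R ^+ 4 <= C * normV u ^+ 4.
  pose a := normV u; have a0 : 0 <= a by exact: normV_ge0.
  apply: (@le_of_le_addMe _ _ _ (C * (4 * a ^+ 3 + 6 * a ^+ 2 + 4 * a + 1) + 4 * n%:R ^+ 3 * M)).
    by rewrite addr_ge0 ?mulr_ge0 ?addr_ge0 ?mulr_ge0 ?exprn_ge0// ltW.
  move=> e e0 e1; have [phi [Ephi n1 n2]] := V_approx Vu e0.
  have [_ _ /(_ j)[i4 P4]] := HC _ Ephi.
  have mph : measurable_fun setT (fld phi j) by exact: measurable_fld.
  have iup : mu.-integrable setT (EFin \o (fun x => `|fld (u - phi) j x|)).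
    by apply: integrable_norm; apply: sqi_integrable; exact: sqi_fld.
  have i4n : mu.-integrable setT (EFin \o (fun x => 4 * n%:R ^+ 3 * `|fld (u - phi) j x|)).
    by have := integrableZl measurableT (4 * n%:R ^+ 3) iup.
  have S1 : \int[mu]_x Num.min `|fld u j x| n%:R ^+ 4
      <= \int[mu]_x (fld phi j x ^+ 4 + 4 * n%:R ^+ 3 * `|fld (u - phi) j x|).
    have iS : mu.-integrable setT (EFin \o (fun x => fld phi j x ^+ 4 + 4 * n%:R ^+ 3 * `|fld (u - phi) j x|)).
      by have := integrableD measurableT i4 i4n.
    rewrite -lee_fin EFin_Rintegral// EFin_Rintegral//.
    apply: ae_ge0_le_integral => //.
    - exact: measurable_int (im n).
    - by move=> x _; rewrite lee_fin; apply: addr_ge0; [exact: exprn_even_ge0|by rewrite !mulr_ge0// exprn_ge0].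
    - exact: measurable_int iS.
    - apply: filterS (fldB u phi j) => x /(_ I) -> _.
      by rewrite lee_fin; exact: pow4_min_le.
  apply: (le_trans S1); rewrite RintegralD//.
  rewrite RintegralZl//.
  have S2 : \int[mu]_x fld phi j x ^+ 4 <= C * (a ^+ 4 + e * (4 * a ^+ 3 + 6 * a ^+ 2 + 4 * a + 1)).
    apply: (le_trans P4); rewrite ler_pM2l//.
    apply: (@le_trans _ _ ((a + e) ^+ 4)); last by apply: pow4_add_le => //; exact: ltW.
    have := nE _ _ Ephi n2; have := normV_ge0 phi; rewrite -/a.
    move: (normV phi) => b b0 ba; apply: lerXn2r => //.
    by rewrite nnegrE (le_trans b0 ba).
  have S3 : 4 * n%:R ^+ 3 * \int[mu]_x `|fld (u - phi) j x| <= 4 * n%:R ^+ 3 * (M * e).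
    apply: ler_wpM2l; first by rewrite mulr_ge0// exprn_ge0.
    by apply: (le_trans (HM _ j)); rewrite ler_wpM2l// ltW.
  apply: (le_trans (lerD S2 S3)).
  rewrite -/a; clearbody a.
  by move: (n%:R ^+ 3) => N3; rewrite le_eqVlt; apply/orP; left; apply/eqP; ring.
have fat : (\int[mu]_x (fld u j x ^+ 4)%:E <= (C * normV u ^+ 4)%:E)%E.
  have mEm n : measurable_fun setT (fun x => (Num.min `|fld u j x| n%:R ^+ 4)%:E) by exact/measurable_EFinP.
  have := @fatou _ _ _ mu setT measurableT (fun n x => (Num.min `|fld u j x| n%:R ^+ 4)%:E) mEm (fun n x _ => mm0 n x).
  rewrite (_ : (fun x => limn_einf _) = (fun x => (fld u j x ^+ 4)%:E)); last first.
    apply/funext => x; apply: (fun H => (cvg_limn_einf_sup H).1).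
    apply: cvg_near_cst; near=> n.
    rewrite min_l; first by rewrite -normrX ger0_norm// exprn_even_ge0.
    by near: n; exact: nbhs_infty_ger.
  move=> H; apply: (le_trans H); apply: limn_einf_le_cst => n.
  by rewrite -EFin_Rintegral// lee_fin.
have i4 : mu.-integrable setT (EFin \o (fun x => fld u j x ^+ 4)).
  apply: integrable_EFin_ge0 => //; first exact: measurable_funX.
  - by move=> x _; rewrite exprn_even_ge0.
  - by apply: (le_lt_trans fat); rewrite ltry.
by split => //; rewrite -lee_fin EFin_Rintegral.
Unshelve. all: by end_near. Qed.

End V_estimates.

(** * The trilinear form *)
Section trilinear_form.
Context {R : realType} (Om : smooth_domain R).
Local Notation mu := (domain_measure Om).
Local Notation wp i u j := (wpartial Om i (fld u j)).
Implicit Types (u v w : L2field Om).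
Local Notation T i j u v w := (fun x => fld u i x * wp i v j x * fld w j x).

#[local] Opaque dotV normV.

Lemma measurable_wp u i j : measurable_fun setT (wp i u j).
Proof. exact: (sqi_wp i u j).1. Qed.

Lemma measurable_T i j u v w : measurable_fun setT (T i j u v w).
Proof.
apply: measurable_funM; last exact: measurable_fld.
by apply: measurable_funM; [exact: measurable_fld|exact: measurable_wp].
Qed.

(** Hoelder's inequality with exponents 4, 2 and 4, as two applications of
    Cauchy-Schwarz. *)
Lemma T_bound : exists2 C : R, 0 < C & forall u v w i j, V_set Om u -> V_set Om w ->
  mu.-integrable setT (EFin \o T i j u v w) /\
  `|\int[mu]_x T i j u v w x| <= C * (normV u * normV v * normV w).
Proof.
have [C C0 HC] := V_bounds Om; exists (Num.sqrt C); first by rewrite sqrtr_gt0.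
move=> u v w i j Vu Vw.
have [_ /(_ i)[u4 u4l]] := HC _ Vu; have [_ /(_ j)[w4 w4l]] := HC _ Vw.
have sq2 (f : mspace R -> R) : measurable_fun setT f -> mu.-integrable setT (EFin \o (fun x => f x ^+ 4)) ->
    sqi mu (fun x => f x ^+ 2).
  move=> mf f4; split; first exact: measurable_funX.
  by apply: eq_integrable f4 => // x _ /=; rewrite -exprM.
have su := sq2 _ (measurable_fld u i) u4; have sw := sq2 _ (measurable_fld w j) w4.
have suw : sqi mu (fun x => fld u i x * fld w j x).
  split; first by apply: measurable_funM; exact: measurable_fld.
  by apply: eq_integrable (sqiM su sw) => // x _ /=; rewrite exprMn.
have sv := sqi_wp i v j.
have E x : T i j u v w x = fld u i x * fld w j x * wp i v j x by rewrite mulrAC.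
split.
  by apply: eq_integrable (sqiM suw sv) => // x _ /=; rewrite E.
have -> : \int[mu]_x T i j u v w x = \int[mu]_x (fld u i x * fld w j x * wp i v j x).
  by apply: eq_Rintegral => x _; exact: E.
have H1 := sqi_CS suw sv; have H2 := sqi_CS su sw.
have H3 := wp_sqr_le v i j.
have E4 (f : mspace R -> R) : \int[mu]_x (f x ^+ 2) ^+ 2 = \int[mu]_x f x ^+ 4.
  by apply: eq_Rintegral => x _; rewrite -exprM.
rewrite (E4 (fld u i)) (E4 (fld w j)) in H2.
have E2 : \int[mu]_x (fld u i x * fld w j x) ^+ 2 = \int[mu]_x (fld u i x ^+ 2 * fld w j x ^+ 2).
  by apply: eq_Rintegral => x _; rewrite exprMn.
rewrite E2 in H1.
have p0 : 0 <= \int[mu]_x (fld u i x ^+ 2 * fld w j x ^+ 2).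
  by apply: Rintegral_ge0 => x _; rewrite mulr_ge0 ?sqr_ge0.
have u40 : 0 <= \int[mu]_x fld u i x ^+ 4.
  by apply: Rintegral_ge0 => x _; rewrite exprn_even_ge0.
have w40 : 0 <= \int[mu]_x fld w j x ^+ 4.
  by apply: Rintegral_ge0 => x _; rewrite exprn_even_ge0.
have v0 : 0 <= \int[mu]_x wp i v j x ^+ 2.
  by apply: Rintegral_ge0 => x _; rewrite sqr_ge0.
have := normV_ge0 u; have := normV_ge0 v; have := normV_ge0 w.
move: H1 H2 H3 u4l w4l p0 u40 w40 v0.
move: (normV u) (normV v) (normV w) => a b c.
move: (\int[mu]_x (fld u i x * fld w j x * wp i v j x)) => I.
move: (\int[mu]_x (fld u i x ^+ 2 * fld w j x ^+ 2)) => P.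
move: (\int[mu]_x fld u i x ^+ 4) (\int[mu]_x fld w j x ^+ 4) => U W.
move: (\int[mu]_x wp i v j x ^+ 2) => D.
move=> H1 H2 H3 u4l w4l p0 u40 w40 v0 c0 b0 a0.
have PC : P <= C * (a * c) ^+ 2.
  rewrite -(@ler_pXn2r _ 2)// ?nnegrE ?mulr_ge0 ?exprn_ge0 ?mulr_ge0// ?(ltW C0)//.
  apply: (le_trans H2); apply: (@le_trans _ _ ((C * a ^+ 4) * (C * c ^+ 4))).
    by apply: ler_pM.
  by rewrite le_eqVlt; apply/orP; left; apply/eqP; ring.
rewrite -(@ler_pXn2r _ 2)// ?nnegrE ?normr_ge0 ?mulr_ge0 ?sqrtr_ge0//.
rewrite real_normK ?num_real// exprMn sqr_sqrtr ?(ltW C0)//.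
apply: (le_trans H1); apply: (@le_trans _ _ (C * (a * c) ^+ 2 * b ^+ 2)).
  by apply: ler_pM.
by rewrite le_eqVlt; apply/orP; left; apply/eqP; ring.
Qed.

Lemma T_integrable u v w i j : V_set Om u -> V_set Om w ->
  mu.-integrable setT (EFin \o T i j u v w).
Proof. by move=> Vu Vw; have [C _ /(_ u v w i j Vu Vw)[]] := T_bound. Qed.

Lemma trilinear_bound : exists2 C : R, 0 < C & forall u v w,
  V_set Om u -> V_set Om w ->
  `|trilinear u v w| <= C * (normV u * normV v * normV w).
Proof.
have [C C0 HC] := T_bound; exists (9 * C); first by rewrite mulr_gt0.
move=> u v w Vu Vw.
apply: (le_trans (ler_norm_sum _ _ _)).
have S i : `|\sum_j \int[mu]_x T i j u v w x| <= 3 * C * (normV u * normV v * normV w).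
  apply: (le_trans (ler_norm_sum _ _ _)).
  apply: (@le_trans _ _ (\sum_(j < 3) C * (normV u * normV v * normV w))).
    by apply: ler_sum => j _; exact: (HC u v w i j Vu Vw).2.
  move: (normV u * _ * _) => t; rewrite sumr_const card_ord.
  by rewrite le_eqVlt; apply/orP; left; apply/eqP; ring.
apply: (@le_trans _ _ (\sum_(i < 3) 3 * C * (normV u * normV v * normV w))).
  by apply: ler_sum => i _; exact: S.
rewrite sumr_const card_ord.
by move: (normV u * _ * _) => t; rewrite le_eqVlt; apply/orP; left; apply/eqP; ring.
Qed.

Lemma trilinear_add (a b c a1 b1 c1 a2 b2 c2 : L2field Om) :
  V_set Om a1 -> V_set Om c1 -> V_set Om a2 -> V_set Om c2 ->
  (forall i j, T i j a b c = (fun x => T i j a1 b1 c1 x + T i j a2 b2 c2 x) %[ae mu]) ->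
  trilinear a b c = trilinear a1 b1 c1 + trilinear a2 b2 c2.
Proof.
move=> Va1 Vc1 Va2 Vc2 H.
have S i j : \int[mu]_x T i j a b c x = \int[mu]_x T i j a1 b1 c1 x + \int[mu]_x T i j a2 b2 c2 x.
  rewrite -RintegralD//; [|exact: T_integrable|exact: T_integrable].
  apply: (ae_eq_Rintegral _ _ (H i j)); first exact: measurable_T.
  by apply: measurable_funD; exact: measurable_T.
rewrite /trilinear -big_split; apply: eq_bigr => i _.
by rewrite -[RHS]big_split; apply: eq_bigr => j _; exact: S.
Qed.

Lemma trilinearD1 u u' v w : V_set Om u -> V_set Om u' -> V_set Om w ->
  trilinear (u + u') v w = trilinear u v w + trilinear u' v w.
Proof.
move=> Vu Vu' Vw; apply: trilinear_add => // i j.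
by apply: filterS (fldD u u' i) => x /(_ I) -> _ /=; rewrite !mulrDl.
Qed.

Lemma trilinearD2 u v v' w : V_set Om u -> V_set Om v -> V_set Om v' -> V_set Om w ->
  trilinear u (v + v') w = trilinear u v w + trilinear u v' w.
Proof.
move=> Vu Vv Vv' Vw; apply: trilinear_add => // i j.
have [_ H] := H1D (V_H1 Vv) (V_H1 Vv').
by apply: filterS (H i j) => x /(_ I) -> _ /=; rewrite mulrDr mulrDl.
Qed.

Lemma trilinearD3 u v w w' : V_set Om u -> V_set Om w -> V_set Om w' ->
  trilinear u v (w + w') = trilinear u v w + trilinear u v w'.
Proof.
move=> Vu Vw Vw'; apply: trilinear_add => // i j.
by apply: filterS (fldD w w' j) => x /(_ I) -> _ /=; rewrite mulrDr.
Qed.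

Lemma E_set_V u : E_set Om u -> V_set Om u.
Proof.
move=> Eu; apply: V_intro; first exact: E_set_H1.
have H0 := V_H1 (V0 Om).
move=> e e0; exists u; rewrite subrr; split=> //; first by rewrite normr0 ltW.
by rewrite -(scale0r (0 : L2field Om)) (normVZ _ H0) normr0 mul0r ltW.
Qed.

Let cubic_bound (C a b d e : R) : 0 <= C -> 0 <= a -> 0 <= b -> 0 <= d ->
  b <= a + 1 -> d <= e ->
  C * (d * a * a) + C * (b * d * a) + C * (b * b * d) <= 0 + e * (3 * C * (a + 1) ^+ 2).
Proof.
move=> C0 a0 b0 d0 ba de; have aa : a <= a + 1 by rewrite lerDl.
have -> : 0 + e * (3 * C * (a + 1) ^+ 2) = C * (e * (a + 1) * (a + 1))
  + C * ((a + 1) * e * (a + 1)) + C * ((a + 1) * (a + 1) * e) by ring.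
by rewrite !lerD// ler_wpM2l// !ler_pM// mulr_ge0.
Qed.

(** Approximate [u] by [v] in [E] and expand along [u = v + (u - v)]: the form
    vanishes at [v], and every other term has a factor [u - v]. *)
Lemma trilinear_eq0 u : V_set Om u -> trilinear u u u = 0.
Proof.
move=> Vu; have [C C0 HC] := trilinear_bound.
have [K K0 HK] := E_set_bounds Om.
apply/eqP; rewrite -normr_le0.
have a0 := normV_ge0 u; set a := normV u in a0.
apply: (@le_of_le_addMe _ _ _ (3 * C * (a + 1) ^+ 2)).
  by rewrite mulr_ge0 ?sqr_ge0// mulr_ge0// ltW.
move=> e e0 e1; have [v [Ev n1 n2]] := V_approx Vu e0.
have Vv := E_set_V Ev; have [_ v0 _] := HK _ Ev; have Vd := VB Vu Vv.
have nv : normV v <= a + 1.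
  have -> : v = u - (u - v) by rewrite opprB addrC subrK.
  have Huv := H1B (V_H1 Vu) (V_H1 Vv).
  apply: (le_trans (normVD (V_H1 Vu) (H1N Huv))).
  by rewrite (normVN Huv) lerD2l (le_trans (ltW n2)).
have E : u = v + (u - v) by rewrite addrC subrK.
have -> : trilinear u u u =
   trilinear (u - v) u u + trilinear v (u - v) u + trilinear v v (u - v).
  have e1' : trilinear u u u = trilinear v u u + trilinear (u - v) u u.
    by rewrite -(trilinearD1 _ Vv Vd Vu) -E.
  have e2 : trilinear v u u = trilinear v v u + trilinear v (u - v) u.
    by rewrite -(trilinearD2 Vv Vv Vd Vu) -E.
  have e3 : trilinear v v u = trilinear v v v + trilinear v v (u - v).
    by rewrite -(trilinearD3 _ Vv Vv Vd) -E.
  rewrite e1' e2 e3 v0 add0r.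
  by move: (trilinear v v (u - v)) (trilinear v (u - v) u) (trilinear (u - v) u u) => p q r; ring.
have h1 := HC (u - v) u u Vd Vu; have h2 := HC v (u - v) u Vv Vu; have h3 := HC v v (u - v) Vv Vd.
apply: (le_trans (ler_normD _ _)); apply: (le_trans (lerD (ler_normD _ _) (lexx _))).
apply: (le_trans (lerD (lerD h1 h2) h3)).
move: n2 nv (normV_ge0 v) (normV_ge0 (u - v)); rewrite -/a.
move: (normV v) (normV (u - v)) => b d /ltW de ba b0 d0.
exact: (cubic_bound (ltW C0) a0 b0 d0 ba de).
Qed.

End trilinear_form.

(** * Real functions of time *)
Section absorption.
Context {R : realType}.

(** Going back in time by [1 / (c Z(t))] doubles [Z].  If [Z b] exceeded the bound,
    the geometric series of these steps would fit into [[a, b]], and [Z a] would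
    be at least [2^k Z b] for every [k]. *)
Lemma absorption (Z : R -> R) (c a b : R) : 0 < c -> a < b ->
  (forall s t, a <= s -> s <= t -> t <= b -> 0 < Z t ->
    Z t + c * (t - s) * Z t ^+ 2 <= Z s) ->
  Z b <= 2 / (c * (b - a)).
Proof.
move=> c0 ab H; rewrite leNgt; apply/negP => Zb.
have cab : 0 < c * (b - a) by rewrite mulr_gt0// subr_gt0.
have iterk k t : a <= t -> t <= b -> 0 < Z t -> 2 <= c * (t - a) * Z t -> 2 ^+ k * Z t <= Z a.
  elim: k t => [|k ih] t at_ tb Zt0 large.
    rewrite expr0 mul1r; apply: le_trans (H a t (lexx _) at_ tb Zt0).
    by rewrite lerDl !mulr_ge0// ?subr_ge0 ?sqr_ge0// ltW.
  pose d := (c * Z t)^-1.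
  have cZ : 0 < c * Z t by rewrite mulr_gt0.
  have d0 : 0 < d by rewrite invr_gt0.
  have dE : c * d * Z t = 1 by rewrite /d invfM; field; rewrite !gt_eqF.
  have h1 : a <= t - d.
    rewrite lerBrDr addrC -lerBrDr /d -div1r ler_pdivrMr//.
    by move: large; nra.
  have td : t - d <= t by rewrite gerBl ltW.
  have := H (t - d) t h1 td tb Zt0; have -> : t - (t - d) = d by ring.
  move=> H2.
  have Z2 : 2 * Z t <= Z (t - d).
    by move: H2; rewrite expr2 [c * d * _]mulrA dE mul1r; lra.
  rewrite exprSr -mulrA; apply: (@le_trans _ _ (2 ^+ k * Z (t - d))).
    by rewrite ler_wpM2l// exprn_ge0.
  apply: ih => //.
  - exact: le_trans td tb.
  - by apply: lt_le_trans Z2; rewrite mulr_gt0.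
  - apply: (@le_trans _ _ (c * (t - d - a) * (2 * Z t))).
      by move: dE large; nra.
    by rewrite ler_wpM2l// mulr_ge0// ?subr_ge0// ltW.
have Zb0 : 0 < Z b by apply: lt_trans Zb; rewrite divr_gt0.
have large : 2 <= c * (b - a) * Z b.
  by rewrite -ler_pdivrMl// mulrC ltW.
have K k : 2 ^+ k * Z b <= Z a by apply: iterk => //; exact: ltW.
have [n nP] : exists n : nat, Z a / Z b < n%:R.
  by exists (Num.truncn (Z a / Z b)).+1; exact: truncnS_gt.
have := K n; rewrite leNgt => /negP; apply.
rewrite -ltr_pdivrMr//; apply: (lt_le_trans nP).
by rewrite -natrX ler_nat ltnW// ltn_expl.
Qed.

End absorption.

Section time_line.
Context {R : realType}.
Local Notation leb := (@lebesgue_measure R).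
Implicit Types (w G : R -> R).

Lemma ae_imp (P Q : R -> Prop) : (forall x, P x -> Q x) ->
  {ae leb, forall x, P x} -> {ae leb, forall x, Q x}.
Proof.
move=> PQ [N [mN N0 PN]]; exists N; split => // x nQ; apply: PN => Px.
exact/nQ/PQ.
Qed.

Lemma smooth_step_derive_bounded : exists2 M : R, 0 <= M &
  forall x : R, `|(smooth_step^`())%classic x| <= M /\ (~ (0 <= x <= 1) -> (smooth_step^`())%classic x = 0).
Proof.
have C1 := CnS_derive1 (@Cn_smooth_step R 1).
have out (x : R) : ~ (0 <= x <= 1) -> (smooth_step^`())%classic x = 0.
  move=> x01; rewrite derive1E.
  have [x0|x0] := ltP x 0.
    rewrite -(derive_cst (0 : R) x (1 : R)); apply: near_eq_derive.
    near=> y; rewrite smooth_step_eq0//; apply: ltW.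
    by near: y; exact: lt_nbhsl.
  have x1 : 1 < x by rewrite ltNge; apply/negP => x1; apply: x01; rewrite x0.
  rewrite -(derive_cst (1 : R) x (1 : R)); apply: near_eq_derive.
  near=> y; rewrite smooth_step_eq1//; apply: ltW.
  by near: y; exact: lt_nbhsr.
have /compact_bounded[M [_ HM]] : compact ((smooth_step^`())%classic @` `[(0:R), 1]%classic).
  apply: continuous_compact; last exact: segment_compact.
  by apply: continuous_subspaceT => x; exact: C1.
exists (`|M| + 1) => [|x]; first by rewrite addr_ge0.
split; last exact: out.
have [x01|x01] := pselect (0 <= x <= 1); last by rewrite out// normr0 addr_ge0.
by apply: (HM (`|M| + 1)); [rewrite (le_lt_trans (ler_norm M))// ltrDl|exists x].
Unshelve. all: by end_near. Qed.

Lemma is_derive_ramp (b : R) (n : nat) (x : R) :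
  is_derive x 1 (ramp b n) (n%:R * (smooth_step^`())%classic (n%:R * x + - (n%:R * b))).
Proof.
have D := Cn_is_derive (n%:R * x + - (n%:R * b)) (@Cn_smooth_step R 1).
have H := is_deriveD (is_deriveZ n%:R (is_derive_id x (1 : R))) (is_derive_cst (- (n%:R * b)) x (1 : R)).
have H' : is_derive x 1 (fun y : R => n%:R * y + - (n%:R * b)) n%:R.
  by apply: is_derive_eq; rewrite addr0 [_ *: _]mulr1.
have K := @is_derive1_comp R (@smooth_step R) (fun y : R => n%:R * y + - (n%:R * b)) x _ _ D H'.
by rewrite [X in is_derive _ _ _ X]mulrC; exact: K.
Qed.

Lemma ramp_derive (b : R) (n : nat) (x : R) : ((ramp b n)^`())%classic x =
  n%:R * (smooth_step^`())%classic (n%:R * x + - (n%:R * b)).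
Proof. by rewrite derive1E; have D := is_derive_ramp b n x; rewrite derive_val. Qed.

Lemma continuous_ramp_derive (b : R) (n : nat) : continuous ((ramp b n)^`())%classic.
Proof. exact: (CnS_derive1 (@Cn_ramp R 1 b n)). Qed.

Lemma ramp_derive_out (b : R) (n : nat) (x : R) : (0 < n)%N -> ~ (b <= x <= b + n%:R^-1) ->
  ((ramp b n)^`())%classic x = 0.
Proof.
move=> n0 xb; rewrite ramp_derive; have [M M0 HM] := smooth_step_derive_bounded.
rewrite (HM _).2 ?mulr0// => /andP[h1 h2]; apply: xb.
have np : 0 < n%:R :> R by rewrite ltr0n.
move: h1 h2; rewrite -mulrBr => h1 h2.
apply/andP; split; first by move: h1; rewrite pmulr_rge0// subr_ge0.
by rewrite -lerBlDl -[_^-1]mulr1 ler_pdivlMl.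
Qed.

(** The derivative of [ramp b n] has integral 1 and lives on [[b, b + 1/n]]. *)
Lemma ramp_derive_cvg w b : continuous w ->
  \int[leb]_x (w x * ((ramp b n)^`())%classic x) @[n --> \oo] --> w b.
Proof.
move=> cw; have [M M0 HM] := smooth_step_derive_bounded.
have mw : measurable_fun setT w by exact: continuous_measurable_fun.
have mr n : measurable_fun setT ((ramp b n)^`())%classic.
  by apply: continuous_measurable_fun; exact: continuous_ramp_derive.
apply/cvgrPdist_le => /= e e0.
have e1 : 0 < e / (M + 1) by rewrite divr_gt0// ltr_wpDl.
have /cvgrPdist_le/(_ _ e1)/nbhs_ballP[d /= d0 Hd] := cw b.
near=> n.
have n0 : (0 < n)%N by near: n; exact: nbhs_infty_gt.
have np : 0 < n%:R :> R by rewrite ltr0n.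
have nd : n%:R^-1 < d.
  rewrite -[ltRHS]invrK ltf_pV2// ?posrE ?invr_gt0//.
  by near: n; exact: nbhs_infty_gtr.
pose I : set R := `[b, b + n%:R^-1]%classic.
have mI : measurable (I : set (measurableTypeR R)) by exact: measurable_itv.
have bI : b < b + n%:R^-1 by rewrite ltrDl invr_gt0.
have lebI : leb I = (n%:R^-1)%:E.
  by rewrite /I lebesgue_measure_itv/= lte_fin bI -EFinB addrC addKr.
have restrict (f : R -> R) : \int[leb]_x (f x * ((ramp b n)^`())%classic x)
    = \int[leb]_(x in I) (f x * ((ramp b n)^`())%classic x).
  rewrite [RHS]Rintegral_mkcond; apply: eq_Rintegral => x _.
  rewrite patchE; case: ifPn => //; rewrite notin_setE /I/= in_itv/= => /ramp_derive_out ->//.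
  by rewrite mulr0.
have cI (f : R -> R) : continuous f -> leb.-integrable I (EFin \o f).
  by move=> cf; apply: continuous_compact_integrable; [exact: segment_compact|exact: continuous_subspaceT].
have cwr : continuous (fun x => w x * ((ramp b n)^`())%classic x).
  by move=> x; apply: continuousM; [exact: cw|exact: continuous_ramp_derive].
have one : \int[leb]_(x in I) ((ramp b n)^`())%classic x = 1.
  rewrite /Rintegral (@continuous_FTC2 _ _ (ramp b n) b (b + n%:R^-1))//.
  - have -> : ramp b n (b + n%:R^-1) = 1.
      by rewrite /ramp smooth_step_eq1// mulrDr divff ?gt_eqF//; lra.
    have -> : ramp b n b = 0 by rewrite /ramp smooth_step_eq0// subrr.
    by rewrite -EFinB subr0.
  - by apply: continuous_subspaceT; exact: continuous_ramp_derive.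
  - have cr : continuous (ramp b n) by exact: (@Cn_ramp R 0 b n).
    split.
    + by move=> x _; have [] := is_derive_ramp b n x.
    + by apply: cvg_at_right_filter; exact: cr.
    + by apply: cvg_at_left_filter; exact: cr.
rewrite restrict.
have -> : w b = \int[leb]_(x in I) (w b * ((ramp b n)^`())%classic x).
  by rewrite RintegralZl// ?one ?mulr1//; apply: cI; exact: continuous_ramp_derive.
have cbr : continuous (fun x => w b * ((ramp b n)^`())%classic x).
  by move=> x; apply: continuousM; [exact: cvg_cst|exact: continuous_ramp_derive].
rewrite -RintegralB//; [|exact: cI|exact: cI].
have cdr : continuous (fun x => w b * ((ramp b n)^`())%classic x - w x * ((ramp b n)^`())%classic x).
  by move=> x; exact: (cvgB (cbr x) (cwr x)).
apply: (le_trans (le_normr_Rintegral mI (cI _ cdr))).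
apply: (@le_trans _ _ (\int[leb]_(x in I) (e / (M + 1) * (n%:R * M)))).
  apply: le_Rintegral => //.
  - by apply: cI => x; exact: (cvg_norm (cdr x)).
  - by apply: cI => x; exact: cvg_cst.
  - move=> x; rewrite /I/= in_itv/= => /andP[bx xb].
    rewrite -mulrBl normrM ramp_derive normrM [`|n%:R|]ger0_norm//.
    rewrite ler_pM ?mulr_ge0//; last by rewrite ler_wpM2l// (HM _).1.
    apply: Hd; rewrite /ball/= distrC ger0_norm ?subr_ge0//.
    by apply: le_lt_trans nd; rewrite lerBlDl.
have -> : \int[leb]_(x in I) (e / (M + 1) * (n%:R * M)) = e / (M + 1) * (n%:R * M) * n%:R^-1.
  apply: etrans (Rintegral_cst leb mI _) _; congr (_ * _).
  by rewrite -[RHS]/(fine (n%:R^-1)%:E) -lebI.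
have -> : e / (M + 1) * (n%:R * M) / n%:R = e * (M / (M + 1)).
  have M10 : M + 1 != 0 by rewrite gt_eqF// ltr_wpDl.
  have nn : n%:R != 0 :> R by rewrite gt_eqF.
  by field; rewrite ?M10 ?nn.
have q1 : M / (M + 1) <= 1.
  by rewrite ler_pdivrMr ?mul1r ?lerDl// ltr_wpDl.
by rewrite -[leRHS]mulr1 ler_wpM2l// ltW.
Unshelve. all: by end_near. Qed.

Lemma integrable_ramp_derive w (b : R) n : (0 < n)%N -> continuous w ->
  leb.-integrable setT (EFin \o (fun x => w x * ((ramp b n)^`())%classic x)).
Proof.
move=> n0 cw; pose I : set R := `[b, b + n%:R^-1]%classic.
have -> : EFin \o (fun x => w x * ((ramp b n)^`())%classic x) =
    (EFin \o (fun x => w x * ((ramp b n)^`())%classic x)) \_ I.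
  apply/funext => x; rewrite patchE; case: ifPn => //.
  rewrite notin_setE /I/= in_itv/= => /ramp_derive_out ->//.
  by rewrite mulr0.
have mI : measurable (I : set (measurableTypeR R)) by exact: measurable_itv.
apply/integrable_restrict => //; rewrite setTI.
apply: continuous_compact_integrable; first exact: segment_compact.
by apply: continuous_subspaceT => x; exact: (continuousM (cw x) (@continuous_ramp_derive b n x)).
Qed.

Lemma test_function_ramps (a b s t : R) n : a < s -> s < t -> t + n%:R^-1 < b -> (0 < n)%N ->
  test_function `]a, b[%classic (fun x : R => ramp s n x + -1 * ramp t n x).
Proof.
move=> as_ st tb n0; pose f (x : R) := ramp s n x + -1 * ramp t n x; rewrite -/f.
have np : 0 < n%:R :> R by rewrite ltr0n.
have sub : closure [set x | f x != 0] `<=` `[s, t + n%:R^-1]%classic.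
  have cl : closed (`[s, t + n%:R^-1]%classic : set R) by exact: itv_closed.
  rewrite [X in _ `<=` X](closure_id _).1//; apply: closureS => x /= fx.
  rewrite in_itv/=; apply/negP => /negP; rewrite negb_and -!ltNge => H.
  move: fx; rewrite /f /ramp; case/orP: H => H.
    rewrite !smooth_step_eq0 ?mulr0 ?addr0 ?eqxx//.
      by rewrite -mulrBr pmulr_rle0// subr_le0 ltW// (lt_trans H).
    by rewrite -mulrBr pmulr_rle0// subr_le0 ltW.
  have H1 : 1 <= n%:R * x + - (n%:R * t).
    rewrite -mulrBr mulrC -ler_pdivrMr// div1r; lra.
  have H2 : 1 <= n%:R * x + - (n%:R * s).
    by apply: (le_trans H1); rewrite lerD2l lerN2 ler_wpM2l// ltW.
  by rewrite !smooth_step_eq1// mulr1 subrr eqxx.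
split.
- apply: Cn_smooth => k; apply: CnD; first exact: Cn_ramp.
  by apply: CnM; [exact: Cn_cst|exact: Cn_ramp].
- by apply: subclosed_compact sub; [exact: closed_closure|exact: segment_compact].
- apply: (subset_trans sub) => x /=; rewrite !in_itv/= => /andP[sx xt].
  by rewrite (lt_le_trans as_ sx) (le_lt_trans xt tb).
Qed.

(** The test function [ramp s n - ramp t n] tends to the indicator of [`]s, t]],
    and its derivative to the difference of the Dirac masses at [s] and [t]. *)
Lemma weak_primitive w G (a b : R) : continuous w ->
  leb.-integrable setT (EFin \o G) ->
  (forall phi : R -> R, test_function `]a, b[%classic phi ->
     \int[leb]_x (w x * (phi^`())%classic x) = \int[leb]_x (G x * phi x)) ->
  forall s t, a < s -> s < t -> t < b ->
    w t - w s = - \int[leb]_(x in `]s, t]) G x.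
Proof.
move=> cw iG H s t as_ st tb.
have mG : measurable_fun setT G by apply/measurable_EFinP; exact: measurable_int iG.
pose f n x := ramp s n x + -1 * ramp t n x.
pose m1 n x := w x * ((ramp s n)^`())%classic x.
pose m2 n x := w x * ((ramp t n)^`())%classic x.
have mI : measurable (`]s, t]%classic : set (measurableTypeR R)) by exact: measurable_itv.
have lhs : \int[leb]_x (m1 n x) - \int[leb]_x (m2 n x) @[n --> \oo] --> w s - w t.
  by apply: cvgB; exact: ramp_derive_cvg.
have [iGI rhs] : leb.-integrable setT (EFin \o (G \_ `]s, t]%classic)) /\
    ((\int[leb]_x (G x * f n x)%:E)%E @[n --> \oo] -->
    (\int[leb]_x ((G \_ `]s, t]%classic) x)%:E)%E).
  have mf n : measurable_fun setT (f n).
    apply: measurable_funD; last apply: measurable_funM => //;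
      by apply: continuous_measurable_fun; exact: (@Cn_ramp R 0).
  have [] // := @dominated_convergence _ _ _ leb setT measurableT
    (fun n => EFin \o (fun x => G x * f n x)) (EFin \o (G \_ `]s, t]%classic))
    (fun x => `|(G x)%:E|%E).
  - by move=> n; apply/measurable_EFinP; exact: (measurable_funM mG (mf n)).
  - apply/measurable_EFinP; apply/(measurable_restrictT _ _).1 => //.
    exact: measurable_funTS.
  - apply: aeW => x _; apply: cvg_near_cst.
    near=> n; rewrite /= /f patchE.
    have -> : ramp s n x = (s < x)%R%:R by near: n; exact: near_ramp.
    have -> : ramp t n x = (t < x)%R%:R by near: n; exact: near_ramp.
    case: ifPn; rewrite ?inE ?notin_setE/= in_itv/=.
      by move=> /andP[-> xt]; rewrite ltNge xt/= mulr0 addr0 mulr1.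
    move/negP; rewrite negb_and -leNgt -ltNge => /orP[xs|tx].
      by rewrite !ltNge xs (le_trans xs (ltW st))/= mulr0 addr0 mulr0.
    by rewrite tx (lt_trans st tx)/= mulr1 subrr mulr0.
  - exact: integrable_abse.
  - apply: aeW => x n _ /=; rewrite lee_fin normrM ler_piMr//.
    have /andP[h1 h2] := ramp01 s n x; have /andP[h3 h4] := ramp01 t n x.
    by rewrite /f ler_norml; lra.
have rhs' : \int[leb]_x (m1 n x) - \int[leb]_x (m2 n x) @[n --> \oo] --> \int[leb]_(x in `]s, t]) G x.
  have -> : \int[leb]_(x in `]s, t]) G x = fine (\int[leb]_x ((G \_ `]s, t]%classic) x)%:E)%E.
    by rewrite Rintegral_mkcond.
  have rhs2 : fine (\int[leb]_x (G x * f n x)%:E)%E @[n --> \oo] -->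
      fine (\int[leb]_x ((G \_ `]s, t]%classic) x)%:E)%E.
    by apply: fine_cvg; rewrite fineK//; exact: (integrable_fin_num measurableT iGI).
  apply: cvg_trans rhs2.
  apply: near_eq_cvg; near=> n.
  have n0 : (0 < n)%N by near: n; exact: nbhs_infty_gt.
  have np : 0 < n%:R :> R by rewrite ltr0n.
  rewrite -RintegralB//; [|exact: integrable_ramp_derive..].
  have tn : t + n%:R^-1 < b.
    rewrite -ltrBrDl -[ltRHS]invrK ltf_pV2// ?posrE ?invr_gt0 ?subr_gt0//.
    by near: n; exact: nbhs_infty_gtr.
  rewrite -[LHS]/(\int[leb]_x (G x * f n x)) -H; last exact: test_function_ramps.
  apply: eq_Rintegral => x _; rewrite /m1 /m2 -mulrBr; congr (_ * _).
  rewrite derive1E; have D1 := is_derive_ramp s n x; have D2 := is_derive_ramp t n x.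
  rewrite !derive1E.
  have -> : 'D_1 (f n) x = 'D_1 (ramp s n) x + -1 * 'D_1 (ramp t n) x.
    have D := is_deriveD D1 (is_deriveZ (-1) D2).
    by rewrite !derive_val.
  by rewrite mulN1r.
by rewrite -(cvg_unique (@Rhausdorff R) lhs rhs') opprB.
Unshelve. all: by end_near. Qed.

Lemma integrable_itv_cst (a b c : R) : leb.-integrable `[a, b] (EFin \o (fun=> c)).
Proof.
by apply: continuous_compact_integrable;
  [exact: segment_compact|apply: continuous_subspaceT => ?; exact: cvg_cst].
Qed.

Lemma derive_backward (W : R -> R) (x l c : R) : 0 < c -> is_derive x 1 W l ->
  (W x - W (x - c / n.+1%:R)) / (c / n.+1%:R) @[n --> \oo] --> l.
Proof.
move=> c0 [+ DE]; rewrite /derivable => dW.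
have {}dW : h^-1 *: ((W \o shift x) (h *: (1 : R)) - W x) @[h --> 0^'] --> l.
  by rewrite -DE; exact: dW.
have hn : - (c / n.+1%:R) @[n --> \oo] --> (0 : R)^'.
  have dn0 : (- (c / n.+1%:R)) @[n --> \oo] --> (0 : R).
    rewrite -oppr0 -(mulr0 c); apply: cvgN; apply: cvgM; first exact: cvg_cst.
    exact: cvg_harmonic.
  move=> P P0.
  have P1 : \forall n \near \oo, - (c / n.+1%:R) != 0 -> P (- (c / n.+1%:R)) := dn0 _ P0.
  suff : \forall n \near \oo, P (- (c / n.+1%:R)) by [].
  by apply: filterS P1 => n; apply; rewrite oppr_eq0 gt_eqF// divr_gt0// ltr0Sn.
have := cvg_comp _ _ hn dW; apply: cvg_trans; apply: near_eq_cvg.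
apply: nearW => n /=; rewrite [_ *: (1 : R)]mulr1 [_ *: _]mulrC invrN mulrN -mulNr opprB.
by rewrite [- (c / n.+1%:R) + x]addrC.
Qed.

(** The integral of the backward quotients over [[a, b]] is a difference of averages
    of [Z] over short intervals ending at [b] and at [a], hence tends to
    [Z b - Z a].  The bounds [d] may depend on [s] in a non-measurable way: they
    only serve to show that the minimum of the quotient and [z], which is
    dominated by [|z| + |q|], tends to [z]. *)
Lemma dini_integral (Z z q : R -> R) (a b c : R) : a < b -> 0 < c -> continuous Z ->
  leb.-integrable `[a, b] (EFin \o z) -> leb.-integrable `[a, b] (EFin \o q) ->
  {ae leb, forall s, `[a, b]%classic s -> exists2 d : nat -> R,
     (forall n, - q s <= d n <= (Z s - Z (s - c / n.+1%:R)) / (c / n.+1%:R))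
     & d n @[n --> \oo] --> z s} ->
  \int[leb]_(s in `[a, b]) z s <= Z b - Z a.
Proof.
move=> ab c0 cZ iz iq H.
pose del (n : nat) : R := c / n.+1%:R.
have del0 n : 0 < del n by rewrite divr_gt0// ltr0Sn.
have del_le n : del n <= c by rewrite ler_pdivrMr ?ltr0Sn// ler_peMr// ?(ltW c0)// (ler_nat R 1).
pose F n s := (Z s - Z (s - del n)) / del n.
have cF n : continuous (F n).
  move=> s; apply: cvgM; last exact: cvg_cst.
  apply: cvgB; first exact: cZ.
  apply: (@continuous_comp _ _ _ (fun s => s - del n) Z); last exact: cZ.
  by apply: cvgB; [exact: cvg_id|exact: cvg_cst].
have mI : measurable (`[a, b]%classic : set (measurableTypeR R)) by exact: measurable_itv.
have iF n : leb.-integrable `[a, b] (EFin \o F n).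
  by apply: continuous_compact_integrable; [exact: segment_compact|exact: continuous_subspaceT].
have mz : measurable_fun `[a, b] z by apply/measurable_EFinP; exact: measurable_int iz.
pose a0 := a - c - 1.
pose W x := \int[leb]_(s in `[a0, x]) Z s.
have W' x : a0 < x -> is_derive x 1 W (Z x).
  move=> ax.
  have xu : x < x + 1 by lra.
  have ii : leb.-integrable `[a0, x + 1] (EFin \o Z).
    by apply: continuous_compact_integrable; [exact: segment_compact|exact: continuous_subspaceT].
  have [d1 d2] := continuous_FTC1_closed xu ii ax (cZ x).
  by rewrite -d2 derive1E; exact: DeriveDef.
have intF n : \int[leb]_(s in `[a, b]) F n s =
    (W b - W (b - del n)) / del n - (W a - W (a - del n)) / del n.
  pose P s := (W s - W (s - del n)) / del n.
  have P' x : a <= x -> is_derive x 1 P (F n x).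
    move=> ax.
    have h1 : a0 < x by rewrite /a0; move: c0 ax; lra.
    have h2 : a0 < x - del n by rewrite /a0; move: c0 ax (del_le n); lra.
    have D1 := W' _ h1; have D2 := W' _ h2.
    have D3 : is_derive x 1 (fun s : R => s - del n) 1.
      have D := is_deriveB (is_derive_id x (1 : R)) (is_derive_cst (del n) x (1 : R)).
      by apply: is_derive_eq; rewrite subr0.
    have D4 := @is_derive1_comp R W (fun s : R => s - del n) x _ _ D2 D3.
    have D5 := is_deriveZ (del n)^-1 (is_deriveB D1 D4).
    have -> : P = (del n)^-1 \*: (W - (W \o (fun s : R => s - del n))).
      by apply/funext => s; rewrite /P mulrC.
    by apply: is_derive_eq; rewrite mulr1 /F mulrC.
  have cP x : a <= x -> {for x, continuous P}.
    move=> ax; apply: differentiable_continuous; apply/derivable1_diffP.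
    by have [] := P' x ax.
  rewrite /Rintegral (@continuous_FTC2 _ _ P a b)//.
  - by apply: continuous_subspaceT; exact: cF.
  - split.
    + by move=> x; rewrite in_itv/= => /andP[ax _]; have [] := P' x (ltW ax).
    + by apply: cvg_at_right_filter; apply: cP.
    + by apply: cvg_at_left_filter; apply: cP; exact: ltW.
  - move=> x; rewrite in_itv/= => /andP[ax _]; have D := P' x (ltW ax).
    by rewrite derive1E derive_val.
have Wcvg x : a0 < x -> (W x - W (x - del n)) / del n @[n --> \oo] --> Z x.
  by move=> ax; exact: derive_backward c0 (W' x ax).
have limF : \int[leb]_(s in `[a, b]) F n s @[n --> \oo] --> Z b - Z a.
  under eq_fun do rewrite intF.
  by apply: cvgB; apply: Wcvg; rewrite /a0; lra.
pose h n s := Num.min (F n s) (z s).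
have mh n : measurable_fun `[a, b] (h n).
  by apply: measurable_minr => //; apply/measurable_EFinP; exact: measurable_int (iF n).
have dom s n : (- q s <= F n s) -> `|h n s| <= `|z s| + `|q s|.
  move=> qF; rewrite ler_norml /h; apply/andP; split.
    rewrite le_min; apply/andP; split.
      have := ler_norm (q s); have := normr_ge0 (z s); lra.
    have := ler_norm (- z s); rewrite normrN; have := normr_ge0 (q s); lra.
  by rewrite ge_min; apply/orP; right; rewrite (le_trans (ler_norm _))// lerDl.
have [ih _ lim] : [/\ leb.-integrable `[a, b] (EFin \o z),
  [sequence \int[leb]_(s in `[a, b]) (`|(h n s)%:E - (z s)%:E|)]_n @ \oo --> 0 &
  [sequence \int[leb]_(s in `[a, b]) (h n s)%:E]_n @ \oo --> \int[leb]_(s in `[a, b]) (z s)%:E]%E.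
  apply: (@dominated_convergence _ _ _ leb _ mI (fun n => EFin \o h n) (EFin \o z)
    (fun s => (`|z s| + `|q s|)%:E)).
  - by move=> n; apply/measurable_EFinP; exact: (mh n).
  - by apply/measurable_EFinP; exact: mz.
  - apply: ae_imp H => s H sI; have [d dP dz] := H sI; apply/fine_cvgP; split.
      by apply: nearW.
    apply: (@squeeze_cvgr _ _ _ _ (fun n => Num.min (d n) (z s)) (fun=> z s)).
    + apply: nearW => n /=; have /andP[_ dF] := dP n; apply/andP; split.
        by rewrite /h le_min; apply/andP; split; rewrite ge_min; apply/orP; [left|right].
      by rewrite /h ge_min; apply/orP; right.
    + apply/cvgrPdist_le => e e0; move/cvgrPdist_le/(_ e e0): dz; apply: filterS => n.
      by case: (leP (d n) (z s)) => // _ _; rewrite subrr normr0 ltW.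
    + exact: cvg_cst.
  - have i1 := integrable_norm iz; have i2 := integrable_norm iq.
    by have := integrableD mI i1 i2; apply: eq_integrable => // s _.
  - apply: ae_imp H => s H n sI; have [d dP dz] := H sI.
    rewrite lee_fin; apply: dom; have /andP[h1 h2] := dP n; exact: le_trans h1 h2.
have limh : \int[leb]_(s in `[a, b]) h n s @[n --> \oo] --> \int[leb]_(s in `[a, b]) z s.
  apply: fine_cvg; rewrite fineK; first exact: lim.
  exact: integrable_fin_num iz.
apply: (ler_cvg_to limh limF); apply: nearW => n; apply: le_Rintegral => //.
- have ig : leb.-integrable `[a, b] (EFin \o (fun s => `|F n s| + `|z s|)).
    have := integrableD mI (integrable_norm (iF n)) (integrable_norm iz).
    by apply: eq_integrable => // s _.
  apply: (@le_integrable_EFin _ _ _ leb _ _ _ mI (mh n) _ ig) => s _.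
  by rewrite /h; case: (leP (F n s) (z s)) => _; rewrite ?lerDl ?lerDr.
- by move=> s _; rewrite /h ge_min; apply/orP; left.
Qed.

End time_line.

(** * The energy inequality *)
Section averages.
Context {R : realType}.
Local Notation leb := (@lebesgue_measure R).

Lemma integrable_itvT (G : R -> R) (i : interval R) : leb.-integrable setT (EFin \o G) ->
  leb.-integrable [set` i] (EFin \o G).
Proof. by move=> iG; apply: integrableS iG. Qed.

Lemma average_cvg (G : R -> R) (c : R) : 0 < c -> leb.-integrable setT (EFin \o G) ->
  {ae leb, forall s, (\int[leb]_(r in `]s - c / n.+1%:R, s]) G r) / (c / n.+1%:R)
     @[n --> \oo] --> G s}.
Proof.
move=> c0 iG.
have locG : locally_integrable [set: R] G.
  by have := @integrable_locally R G setT measurableT iG; rewrite patch_setT.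
have H := @FTC1Ny R G (fun y => integrable_itvT _ iG) locG.
apply: ae_imp H => s [dF F'].
pose F x := \int[leb]_(t in `]-oo, x]) G t.
have D : is_derive s 1 F (G s) by rewrite -F' derive1E; exact: DeriveDef.
have := derive_backward c0 D; apply: cvg_trans; apply: near_eq_cvg.
apply: nearW => n /=; congr (_ / _); rewrite /F.
have d0 : 0 < c / n.+1%:R by rewrite divr_gt0// ltr0Sn.
by rewrite Rintegral_itvB//; [exact: integrable_itvT|rewrite bnd_simp gerBl ltW].
Qed.

Lemma ae_seq (T : choiceType) (l : seq T) (P : T -> R -> Prop) :
  (forall v, v \in l -> {ae leb, forall x, P v x}) ->
  {ae leb, forall x, forall v, v \in l -> P v x}.
Proof.
elim: l => [|v l ih] H; first by exists set0; split => // x [].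
have [N1 [mN1 N10 P1]] : {ae leb, forall x, forall v, v \in l -> P v x}.
  by apply: ih => w wl; apply: H; rewrite inE wl orbT.
have [N2 [mN2 N20 P2]] := H v (mem_head _ _).
exists (N1 `|` N2); split; first exact: measurableU.
  by rewrite measureU0.
move=> x nP; have [/P2|NP2] := pselect (~ P v x); first by right.
left; apply: P1 => K; apply: nP => w; rewrite inE => /orP[/eqP ->|/K//].
exact: contrapT.
Qed.

Lemma ae_nat (P : nat -> R -> Prop) : (forall n, {ae leb, forall x, P n x}) ->
  {ae leb, forall x, forall n, P n x}.
Proof.
move=> H.
have := @negligible_bigcup _ _ _ leb (fun n => [set x | ~ P n x]) H.
move=> [N [mN N0 NP]]; exists N; split => // x nP; apply: NP.
by apply: contrapT => K; apply: nP => n; apply: contrapT => nPn; apply: K; exists n.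
Qed.

Lemma ae_and (P Q : R -> Prop) : {ae leb, forall x, P x} -> {ae leb, forall x, Q x} ->
  {ae leb, forall x, P x /\ Q x}.
Proof.
move=> HP HQ; pose F (n : nat) := if n is 0%N then P else Q.
have : {ae leb, forall x, forall n, F n x} by apply: ae_nat => -[].
by apply: ae_imp => x K; split; [exact: (K 0%N)|exact: (K 1%N)].
Qed.

(** The projection of the line onto [[a, b]]; it extends functions that are
    continuous on [[a, b]] to the whole line. *)
Definition clamp (a b x : R) : R := Num.max a (Num.min x b).

Lemma clamp_itv a b x : a <= b -> a <= clamp a b x <= b.
Proof. by move=> ab; rewrite /clamp le_max lexx/= ge_max ab ge_min lexx orbT. Qed.

Lemma clamp_id a b x : a <= x <= b -> clamp a b x = x.
Proof. by move=> /andP[ax xb]; rewrite /clamp min_l// max_r. Qed.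

Lemma clamp_contraction a b x y : `|clamp a b x - clamp a b y| <= `|x - y|.
Proof.
have n1 := ler_norm (x - y); have n2 := ler_norm (- (x - y)); rewrite normrN in n2.
rewrite /clamp ler_norml; move: n1 n2; move: (`|x - y|) => n n1 n2.
by case: (leP x b) => xb; case: (leP y b) => yb; rewrite !maxEle;
  repeat (case: ifPn; rewrite -?ltNge => ?); apply/andP; split; lra.
Qed.

Lemma continuous_clamp (W : normedModType R) (f : R -> W) a b : a <= b ->
  {within `[a, b], continuous f} -> continuous (f \o clamp a b).
Proof.
move=> ab /subspace_continuousP H x.
have yab : `[a, b]%classic (clamp a b x) by rewrite /= in_itv/= clamp_itv.
apply/cvgrPdist_lt => e e0.
have /cvgrPdist_lt/(_ e e0) := H _ yab.
rewrite near_withinE => /nbhs_ballP[d /= d0 Hd].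
apply/nbhs_ballP; exists d => //= z xz; apply: Hd; last by rewrite /= in_itv/= clamp_itv.
by apply: le_lt_trans xz; exact: clamp_contraction.
Qed.

(** Interchange of limits: [X] is uniformly close to sequences [x k] with known
    limits, up to a factor that converges. *)
Lemma approximate_limit (x : nat -> nat -> R) (y X M e : nat -> R) (Y L : R) :
  (forall k, x k n @[n --> \oo] --> y k) -> M n @[n --> \oo] --> L ->
  e k @[k --> \oo] --> 0 ->
  (forall k n, `|X n - x k n| <= M n * e k) -> (forall k, `|Y - y k| <= L * e k) ->
  X n @[n --> \oo] --> Y.
Proof.
move=> xy ML e0 Xx Yy; apply/cvgrPdist_le => r r0.
have D0 : 0 < r / (2 * (`|L| + 1) + 1).
  by rewrite divr_gt0// ltr_wpDl// mulr_ge0// addr_ge0.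
pose D := r / (2 * (`|L| + 1) + 1).
have DE : D * (2 * (`|L| + 1) + 1) = r by rewrite divfK// gt_eqF// ltr_wpDl// mulr_ge0// addr_ge0.
have [k ek] : exists k, `|e k| <= D.
  move/cvgrPdist_le/(_ _ D0): e0 => [k _ /(_ k (leqnn k))].
  by rewrite sub0r normrN => ?; exists k.
have /cvgrPdist_le/(_ _ D0) xk := xy k.
have /cvgrPdist_le/(_ _ ltr01) Mn := ML.
near=> n.
have h1 : `|y k - x k n| <= D by near: n.
have h2 : `|L - M n| <= 1 by near: n.
have LM : `|M n| <= `|L| + 1.
  by rewrite -[M n](subKr L) (le_trans (ler_normB _ _))// lerD2l.
have h3 : `|X n - x k n| <= (`|L| + 1) * D.
  apply: (le_trans (Xx k n)); apply: (le_trans (ler_norm _)).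
  by rewrite normrM ler_pM.
have h4 : `|Y - y k| <= (`|L| + 1) * D.
  apply: (le_trans (Yy k)); apply: (le_trans (ler_norm _)).
  by rewrite normrM ler_pM// lerDl.
have -> : Y - X n = (Y - y k) + (y k - x k n) - (X n - x k n) by ring.
apply: (le_trans (ler_normB _ _)); have := ler_normD (Y - y k) (y k - x k n).
move: DE h1 h3 h4; move: (`|L|) => l; nra.
Unshelve. all: by end_near. Qed.

End averages.

Section energy.
Context {R : realType} (Om : smooth_domain R).
Local Notation leb := (@lebesgue_measure R).
Local Notation V := (V_set Om).
#[local] Opaque dotV normV.

(** This convexity bound stands for the chain rule of [|u|^2]: it needs the
    increment of [u] tested with its final value only. *)
Lemma backward_difference (x y : L2field Om) :
  `|x| ^+ 2 - `|y| ^+ 2 <= 2 * (L2_dot x x - L2_dot y x).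
Proof.
have := L2_dot_ge0 (x - y); rewrite L2_dotDl ![L2_dot _ (x - y)]L2_dotC !L2_dotDl.
have N (v : L2field Om) : - v = (-1) *: v by rewrite scaleN1r.
rewrite N !L2_dotZl ![L2_dot _ (-1 *: y)]L2_dotC !L2_dotZl !sqr_L2_norm.
by move: (L2_dot x x) (L2_dot y x) (L2_dot y y) => p q r; lra.
Qed.

(** [G v r] is the equation at time [r] tested with [v]; it is Lipschitz in [v] with
    a constant [m r] that is integrable in time.  The lower bound of [G] at
    [v = u s] by [- m r - q s] separates the variables [r] and [s], and turns into
    an integrable lower bound of the difference quotients once a primitive of [m]
    is added to [- |u|^2 / 2]. *)
Lemma energy_inequality (u : R -> L2field Om) (s_ : nat -> R -> L2field Om)
    (G : L2field Om -> R -> R) (m q : R -> R) (K t0 a b t1 : R) :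
  t0 < a -> a < b -> b < t1 ->
  {within `[t0, t1], continuous u} ->
  (forall k, simple_in V (s_ k)) ->
  {ae leb, forall t, `]t0, t1[%classic t -> [/\ V (u t),
    normV (s_ k t - u t) @[k --> \oo] --> (0 : R) & K * normV (u t) ^+ 4 <= q t]} ->
  leb.-integrable setT (EFin \o m) -> leb.-integrable setT (EFin \o q) ->
  (forall v, V v -> leb.-integrable setT (EFin \o G v)) ->
  (forall r v w, V v -> V w -> `|G v r - G w r| <= m r * normV (v - w)) ->
  (forall r v, V v -> - G v r <= m r + K * normV v ^+ 4) ->
  (forall v, V v -> forall s t, t0 < s -> s < t -> t < t1 ->
     L2_dot (u t) v - L2_dot (u s) v = - \int[leb]_(r in `]s, t]) G v r) ->
  leb.-integrable `[a, b] (EFin \o (fun s => G (u s) s)) ->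
  `|u b| ^+ 2 - `|u a| ^+ 2 <= - 2 * \int[leb]_(s in `[a, b]) G (u s) s.
Proof.
move=> ta ab bt cu ss su im iq iG Glip Glow weak iGu.
have t01 : t0 < t1 by rewrite (lt_trans ta)// (lt_trans ab).
pose p := clamp t0 t1; pose c := (a - t0) / 2.
have c0 : 0 < c by rewrite /c; lra.
pose del (n : nat) : R := c / n.+1%:R.
have del0 n : 0 < del n by rewrite divr_gt0// ltr0Sn.
have del_le n : del n <= c.
  by rewrite ler_pdivrMr ?ltr0Sn// ler_peMr// ?(ltW c0)// (ler_nat R 1).
pose Pm (x : R) := \int[leb]_(r in `[t0, x]) m r.
have PmE x y : t0 <= x -> x <= y -> Pm y - Pm x = \int[leb]_(r in `]x, y]) m r.
  by move=> tx xy; rewrite /Pm Rintegral_itvB//; exact: integrable_itvT.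
pose Z x := Pm (p x) - 2^-1 * `|u (p x)| ^+ 2.
have im01 : leb.-integrable `[t0, t1] (EFin \o m) by exact: integrable_itvT.
have cZ : continuous Z.
  have c1 := continuous_clamp (ltW t01) (parameterized_integral_continuous (ltW t01) im01).
  have c2 := continuous_clamp (ltW t01) cu.
  move=> x; apply: cvgB; first exact: c1.
  apply: cvgM; first exact: cvg_cst.
  apply: (@continuous_comp _ _ _ (fun x => `|u (p x)|) (fun y => y ^+ 2)); last exact: exprn_continuous.
  exact: (cvg_norm (c2 x)).
pose z s := G (u s) s + m s.
have mI : measurable (`[a, b]%classic : set (measurableTypeR R)) by exact: measurable_itv.
have iz : leb.-integrable `[a, b] (EFin \o z).
  by have := integrableD mI iGu (integrable_itvT `[a, b] im); apply: eq_integrable.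
(* Lebesgue points, for each of the finitely many values of the k-th simple function *)
have simple_avg k : {ae leb, forall s, (\int[leb]_(r in `]s - del n, s]) G (s_ k s) r) / del n
     @[n --> \oo] --> G (s_ k s) s}.
  have [/finite_seqP[l rl] sV _] := ss k.
  have : {ae leb, forall s, forall v, v \in l ->
      (\int[leb]_(r in `]s - del n, s]) G v r) / del n @[n --> \oo] --> G v s}.
    apply: ae_seq => v vl; apply: average_cvg => //; apply: iG; apply: sV.
    by rewrite rl.
  apply: ae_imp => s; apply.
  by have : range (s_ k) (s_ k s) by []; rewrite rl.
have main : {ae leb, forall s, `[a, b]%classic s -> exists2 d : nat -> R,
     (forall n, - q s <= d n <= (Z s - Z (s - c / n.+1%:R)) / (c / n.+1%:R))
     & d n @[n --> \oo] --> z s}.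
  have := ae_and su (ae_and (ae_nat simple_avg) (average_cvg c0 im)).
  apply: ae_imp => s [Hu [Hs Hm]]; rewrite /= in_itv/= => /andP[as_ sb].
  have st : `]t0, t1[%classic s.
    by rewrite /= in_itv/= (lt_le_trans ta as_) (le_lt_trans sb bt).
  have [Vus cvs qs] := Hu st.
  pose d n := (\int[leb]_(r in `]s - del n, s]) G (u s) r) / del n
    + (\int[leb]_(r in `]s - del n, s]) m r) / del n.
  have s1 n : t0 < s - del n by have := del_le n; rewrite /c; lra.
  have s2 n : s - del n < s by have := del0 n; lra.
  exists d => [n|]; last first.
    apply: cvgD; last exact: Hm.
    apply: (@approximate_limit _ (fun k n => (\int[leb]_(r in `]s - del n, s]) G (s_ k s) r) / del n)
      (fun k => G (s_ k s) s) _ (fun n => (\int[leb]_(r in `]s - del n, s]) m r) / del n)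
      (fun k => normV (s_ k s - u s)) _ (m s)) => //.
    - move=> k n.
      have Vk : V (s_ k s) by have [_ sV _] := ss k; apply: sV; exists s.
      rewrite -mulrBl normrM [`|(del n)^-1|]gtr0_norm ?invr_gt0// [leRHS]mulrAC.
      apply: ler_wpM2r; first by rewrite invr_ge0 ltW.
      rewrite -RintegralB//; [|exact/integrable_itvT/iG..].
      have iB : leb.-integrable `]s - del n, s] (EFin \o (fun r => G (u s) r - G (s_ k s) r)).
        have mJ : measurable (`]s - del n, s]%classic : set (measurableTypeR R)) by exact: measurable_itv.
        have := integrableB mJ (integrable_itvT _ (iG _ Vus)) (integrable_itvT _ (iG _ Vk)).
        by apply: eq_integrable.
      apply: (le_trans (le_normr_Rintegral _ iB)); first exact: measurable_itv.
      rewrite -RintegralZr//; last exact: integrable_itvT.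
      apply: le_Rintegral; [exact: measurable_itv|exact: integrable_norm| |].
        have mJ : measurable (`]s - del n, s]%classic : set (measurableTypeR R)) by exact: measurable_itv.
        have := integrableZr mJ (normV (s_ k s - u s)) (integrable_itvT `]s - del n, s] im).
        by apply: eq_integrable.
      by move=> r _; rewrite distrC; apply: Glip.
    - move=> k.
      have Vk : V (s_ k s) by have [_ sV _] := ss k; apply: sV; exists s.
      by rewrite distrC; apply: Glip.
  rewrite /d -mulrDl; apply/andP; split.
    apply: (@le_trans _ _ (- (K * normV (u s) ^+ 4))); first by rewrite lerN2.
    have iJ : leb.-integrable `]s - del n, s] (EFin \o m) by exact: integrable_itvT.
    have iC : leb.-integrable `]s - del n, s] (EFin \o (fun=> - (K * normV (u s) ^+ 4))).
      apply: (@integrableS _ _ _ leb `[s - del n, s]%classic) => //;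
        [exact: subset_itv_oc_cc|exact: integrable_itv_cst].
    have mJ : measurable (`]s - del n, s]%classic : set (measurableTypeR R)) by exact: measurable_itv.
    have lJ : leb (`]s - del n, s]%classic : set R) = (del n)%:E.
      by rewrite lebesgue_measure_itv/= lte_fin s2 -EFinB opprB addrC subrK.
    rewrite ler_pdivlMr// -RintegralD//; last exact/integrable_itvT/iG.
    have -> : - (K * normV (u s) ^+ 4) * del n
        = \int[leb]_(r in `]s - del n, s]) (- (K * normV (u s) ^+ 4)).
      apply: esym; apply: etrans (Rintegral_cst leb mJ _) _; congr (_ * _).
      rewrite -[RHS]/(fine (del n)%:E); congr fine.
      exact: lJ.
    apply: le_Rintegral => //.
    - by have := integrableD mJ (integrable_itvT _ (iG _ Vus)) iJ; apply: eq_integrable.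
    - by move=> r _; have := Glow r _ Vus; move: (G _ _) (m r) (_ ^+ 4) => *; lra.
  rewrite -/(del n) ler_pM2r ?invr_gt0//.
  have ps : p s = s by apply: clamp_id; move: st; rewrite /= in_itv/= => /andP[/ltW -> /ltW ->].
  have psn : p (s - del n) = s - del n.
    by apply: clamp_id; have h1 := s1 n; have h2 := s2 n; apply/andP; split; lra.
  have w := weak _ Vus _ _ (s1 n) (s2 n) (le_lt_trans sb bt).
  have bd := backward_difference (u s) (u (s - del n)).
  rewrite w in bd; have PE := PmE _ _ (ltW (s1 n)) (ltW (s2 n)).
  rewrite /Z ps psn -PE; move: bd; move: (Rintegral _ _ _) (Pm s) (Pm _) (_ ^+ 2) (_ ^+ 2) => *; lra.
have := dini_integral ab c0 cZ iz (integrable_itvT _ iq) main.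
have pa : p a = a by rewrite /p clamp_id// (ltW ta)/= ltW// (lt_trans ab).
have pb : p b = b by rewrite /p clamp_id// (ltW bt) andbT ltW// (lt_trans ta).
have PE : \int[leb]_(r in `[a, b]) m r = Pm b - Pm a.
  rewrite PmE ?ltW// Rintegral_itv_obnd_cbnd//.
  exact: integrable_itvT.
rewrite /z RintegralD//; last exact: integrable_itvT.
rewrite /Z pa pb PE; move: (Rintegral _ _ _) (Pm a) (Pm b) (_ ^+ 2) (_ ^+ 2) => *; lra.
Qed.

End energy.

(** * Terms of the equation as functions of time *)
Section bochner_measurable.
Context {R : realType}.
Local Notation leb := (@lebesgue_measure R).

Lemma dominated_cvg_seq (x e : nat -> R) (l : R) : (forall k, `|x k - l| <= e k) ->
  e k @[k --> \oo] --> (0 : R) -> x k @[k --> \oo] --> l.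
Proof.
move=> xe e0; apply/cvgrPdist_le => r r0; move/cvgrPdist_le/(_ r r0): e0.
apply: filterS => k; rewrite sub0r normrN distrC => ek.
by apply: (le_trans (xe k)); apply: le_trans ek; exact: ler_norm.
Qed.

Lemma cvg0_mul (x y : nat -> R) (l : R) : x k @[k --> \oo] --> (0 : R) ->
  y k @[k --> \oo] --> l -> x k * y k @[k --> \oo] --> (0 : R).
Proof. by move=> x0 yl; rewrite -(mul0r l); exact: cvgM. Qed.

Lemma cvg0_mulr (x : nat -> R) (l : R) : x k @[k --> \oo] --> (0 : R) ->
  x k * l @[k --> \oo] --> (0 : R).
Proof. by move=> x0; exact: (cvg0_mul x0 (cvg_cst l)). Qed.

Lemma cvg0_add (x y : nat -> R) : x k @[k --> \oo] --> (0 : R) ->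
  y k @[k --> \oo] --> (0 : R) -> x k + y k @[k --> \oo] --> (0 : R).
Proof. by move=> x0 y0; rewrite -(addr0 0); exact: cvgD. Qed.

Lemma measurable_fun_finite_range (W : choiceType) (s : R -> W) (Phi : W -> R) :
  finite_set (range s) -> (forall y, measurable (s @^-1` [set y])) ->
  measurable_fun setT (Phi \o s).
Proof.
move=> fs ms _ B mB; rewrite setTI.
have -> : (Phi \o s) @^-1` B = \bigcup_(y in range s) (s @^-1` [set y] `&` [set _ | B (Phi y)]).
  apply/seteqP; split=> [t Bt|t [_ [r _ <-]] [/= -> ]]//.
  by exists (s t) => //; split.
apply: fin_bigcup_measurable => // y _; apply: measurableI => //.
have [By|nBy] := pselect (B (Phi y)).
  by rewrite (_ : [set _ | _] = setT)//; apply/seteqP; split.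
by rewrite (_ : [set _ | _] = set0)//; apply/seteqP; split.
Qed.

(** Off a Borel null set the approximation by simple functions holds everywhere;
    on the rest, limits of functions of these approximations are measurable. *)
Lemma strongly_measurable_good (W : normedModType R) (D : set R) (X : set W) (N : W -> R)
    (u : R -> W) : measurable (D : set (measurableTypeR R)) -> strongly_measurable D X N u ->
  exists s_ A, [/\ forall k, simple_in X (s_ k), measurable (A : set (measurableTypeR R)),
    A `<=` D, leb (D `\` A) = 0%E
    & forall t, A t -> X (u t) /\ N (s_ k t - u t) @[k --> \oo] --> (0 : R)].
Proof.
move=> mD [s_ [ss [N0 [mN N00 HN]]]]; exists s_, (D `\` N0); split => //.
- exact: measurableD.
- apply/eqP; rewrite eq_le measure_ge0 andbT -N00; apply: le_measure; rewrite ?inE//.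
    by apply: measurableD => //; exact: measurableD.
  by move=> x [Dx nx]; apply: contrapT => H; apply: nx.
- by move=> t [Dt nNt]; apply: contrapT => H; apply: nNt; apply: HN => /(_ Dt).
Qed.

Lemma measurable_limit_simple (W1 W2 : normedModType R) (X1 : set W1) (X2 : set W2)
    (s1 : nat -> R -> W1) (s2 : nat -> R -> W2) (A : set R) (u1 : R -> W1) (u2 : R -> W2)
    (Phi : W1 -> W2 -> R) : measurable (A : set (measurableTypeR R)) ->
  (forall k, simple_in X1 (s1 k)) -> (forall k, simple_in X2 (s2 k)) ->
  (forall t, A t -> Phi (s1 k t) (s2 k t) @[k --> \oo] --> Phi (u1 t) (u2 t)) ->
  measurable_fun A (fun t => Phi (u1 t) (u2 t)).
Proof.
move=> mA h1 h2 cv.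
apply: (@measurable_fun_cvg _ _ _ _ (fun k t => Phi (s1 k t) (s2 k t))) => // k.
apply: measurable_funTS.
have [f1 _ m1] := h1 k; have [f2 _ m2] := h2 k.
apply: (@measurable_fun_finite_range _ (fun t => (s1 k t, s2 k t)) (fun p => Phi p.1 p.2)).
  apply: (@sub_finite_set _ _ (range (s1 k) `*` range (s2 k))); last exact: finite_setX.
  by move=> _ [t _ <-]; split; exists t.
move=> [y1 y2]; rewrite (_ : _ @^-1` _ = s1 k @^-1` [set y1] `&` s2 k @^-1` [set y2]).
  exact: measurableI.
by apply/seteqP; split=> t /= [-> ->].
Qed.

End bochner_measurable.

Section reaction.
Context {R : realType} (Om : smooth_domain R) (nu nu0 : R).
Local Notation V := (V_set Om).
#[local] Opaque dotV normV trilinear L2_dot.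
Implicit Types (u v w h : L2field Om).

(** The stationary part of the equation, tested with [v]. *)
Definition reaction u v := (nu + nu0 * normV u ^+ 2) * dotV u v + trilinear u u v.

Lemma reactionB u v w : V u -> V v -> V w -> reaction u v - reaction u w = reaction u (v - w).
Proof.
move=> Vu Vv Vw; have Vd := VB Vv Vw.
have e1 : dotV u v = dotV u (v - w) + dotV u w.
  by rewrite dotVC [dotV u (v - w)]dotVC [dotV u w]dotVC -dotVDl ?subrK//; exact: V_H1.
have e2 : trilinear u u v = trilinear u u (v - w) + trilinear u u w.
  by rewrite -trilinearD3// subrK.
rewrite /reaction e1 e2; move: (dotV _ _) (dotV _ _) (trilinear _ _ _) (trilinear _ _ _) (_ + _ * _).
by move=> p q r t k; ring.
Qed.

Lemma reaction_self u : V u -> reaction u u = (nu + nu0 * normV u ^+ 2) * normV u ^+ 2.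
Proof. by move=> Vu; rewrite /reaction trilinear_eq0// addr0 -sqr_normV. Qed.

Lemma expr_le_quartic k (a : R) : (k <= 4)%N -> 0 <= a -> a ^+ k <= 1 + a ^+ 4.
Proof.
move=> k4 a0; have [a1|a1] := leP a 1.
  by rewrite (le_trans (exprn_ile1 k a0 a1))// lerDl exprn_ge0.
by rewrite (le_trans (ler_weXn2l (ltW a1) k4))// lerDr.
Qed.

Lemma monomial_le_quartic i j (a b : R) : (i + j <= 4)%N -> 0 <= a -> 0 <= b ->
  a ^+ i * b ^+ j <= 1 + a ^+ 4 + b ^+ 4.
Proof.
move=> ij a0 b0; pose M := Num.max a b.
have [aM bM] : a <= M /\ b <= M by rewrite !le_max !lexx orbT.
have M0 : 0 <= M by exact: le_trans aM.
apply: (@le_trans _ _ (M ^+ (i + j))).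
  by rewrite exprD; apply: ler_pM; rewrite ?exprn_ge0// lerXn2r.
apply: (le_trans (expr_le_quartic ij M0)); rewrite -addrA lerD2l.
by rewrite /M; case: (leP a b) => _; rewrite ?lerDl ?lerDr exprn_ge0.
Qed.

Let affine_norm (p q x : R) : `|p + q * x ^+ 2| <= `|p| + `|q| * x ^+ 2.
Proof. by rewrite (le_trans (ler_normD _ _))// normrM [`|x ^+ 2|]ger0_norm// sqr_ge0. Qed.

(** The first bound gives a Lipschitz constant in [v] that is integrable in time
    when [u] is in [L^4(V)].  At [v = u s], where [s] is another time, it would
    involve the product of [||u r||^4] and [||u s||]; the second bound separates
    the two. *)
Lemma reaction_bound : exists2 C, 0 < C & forall u v, V u -> V v ->
  `|reaction u v| <= C * (1 + normV u ^+ 4) * normV v /\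
  `|reaction u v| <= C * (1 + normV u ^+ 4 + normV v ^+ 4).
Proof.
have [C C0 HC] := trilinear_bound Om; pose K := `|nu| + `|nu0| + C.
have K0 : 0 < K by rewrite /K ltr_wpDl// addr_ge0.
suff H u v : V u -> V v -> `|reaction u v| <= K * ((1 + normV u ^+ 2) * (normV u * normV v)).
  exists (2 * K) => [|u v Vu Vv]; first by rewrite mulr_gt0.
  have hK := H u v Vu Vv; move: (normV_ge0 u) (normV_ge0 v) hK.
  move: (`|reaction u v|) (normV u) (normV v) => r a b a0 b0 hK.
  have E (x : R) : 2 * K * x = K * (x + x) by ring.
  rewrite !E; split; apply: (le_trans hK); last first.
    rewrite ler_wpM2l ?(ltW K0)// mulrDl mul1r lerD//.
      exact: (@monomial_le_quartic 1 1).
    by have := @monomial_le_quartic 3 1 a b isT a0 b0; rewrite expr1 exprSr mulrA.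
  have -> : K * (1 + a ^+ 4 + (1 + a ^+ 4)) * b = K * ((1 + a ^+ 4) * b + (1 + a ^+ 4) * b) by ring.
  rewrite ler_wpM2l ?(ltW K0)// mulrDl mul1r lerD// ?mulrA ler_wpM2r//.
    exact: (@expr_le_quartic 1).
  by rewrite -exprSr; exact: (@expr_le_quartic 3).
move=> Vu Vv; apply: (le_trans (ler_normD _ _)); rewrite normrM.
have h1 := dotV_CS (V_H1 Vu) (V_H1 Vv); have h2 := HC u u v Vu Vv.
have h3 := affine_norm nu nu0 (normV u).
move: (normr_ge0 (nu + nu0 * normV u ^+ 2)) (normr_ge0 (dotV u v)).
move: (normV_ge0 u) (normV_ge0 v) (normr_ge0 nu) (normr_ge0 nu0) h1 h2 h3; rewrite /K.
move: (`|nu + nu0 * normV u ^+ 2|) (`|dotV u v|) (`|trilinear u u v|) (normV u) (normV v) (`|nu|) (`|nu0|).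
move=> s d t a b n n0 a0 b0 n00 n10 h1 h2 h3 s0 d0.
apply: (@le_trans _ _ ((n + n0 * a ^+ 2) * (a * b) + C * (a * a * b))).
  by apply: lerD => //; exact: ler_pM.
have -> : (n + n0 * a ^+ 2) * (a * b) + C * (a * a * b)
    = (n + n0 * a ^+ 2 + C * a) * (a * b) by ring.
have -> : (n + n0 + C) * ((1 + a ^+ 2) * (a * b))
    = (n * (1 + a ^+ 2) + n0 * (1 + a ^+ 2) + C * (1 + a ^+ 2)) * (a * b) by ring.
have a2 := sqr_ge0 a.
have aa : a <= 1 + a ^+ 2 by have := sqr_ge0 (a - 1); rewrite sqrrB; move: (a ^+ 2) a2 => y; lra.
rewrite ler_wpM2r ?mulr_ge0// !lerD//.
- by rewrite -[leLHS]mulr1 ler_wpM2l// lerDl.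
- by rewrite ler_wpM2l// lerDr.
- by rewrite ler_wpM2l// ltW.
Qed.

Lemma cvg_normV (s_ : nat -> L2field Om) u : (forall k, V (s_ k)) -> V u ->
  normV (s_ k - u) @[k --> \oo] --> (0 : R) -> normV (s_ k) @[k --> \oo] --> normV u.
Proof.
move=> Vs Vu; apply: dominated_cvg_seq => k.
have Hs := V_H1 (Vs k); have Hu := V_H1 Vu; have Hd := H1B Hs Hu.
have h1 := normVD Hd Hu; rewrite subrK in h1.
have h2 := normVD (H1N Hd) Hs; rewrite opprB subrK -opprB normVN// in h2.
rewrite ler_norml; move: (normV (s_ k - u)) (normV u) (normV (s_ k)) h1 h2 => *; lra.
Qed.

Let two_term_bound (A B C x y z w : R) : A <= C * (x * y * w) -> B <= C * (z * x * w) ->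
  A + B <= C * (x * (y + z) * w).
Proof. by move=> hA hB; apply: (le_trans (lerD hA hB)); rewrite le_eqVlt; apply/orP; left; apply/eqP; ring. Qed.

Lemma cvg_reaction (s_ : nat -> L2field Om) u v : (forall k, V (s_ k)) -> V u -> V v ->
  normV (s_ k - u) @[k --> \oo] --> (0 : R) -> reaction (s_ k) v @[k --> \oo] --> reaction u v.
Proof.
move=> Vs Vu Vv su; have nsu := cvg_normV Vs Vu su.
apply: cvgD.
  apply: cvgM.
    apply: cvgD; first exact: cvg_cst.
    apply: cvgM; first exact: cvg_cst.
    apply: (@cvg_comp _ _ _ (fun k => normV (s_ k)) (fun x => x ^+ 2)); first exact: nsu.
    exact: exprn_continuous.
  apply: (@dominated_cvg_seq _ _ (fun k => normV (s_ k - u) * normV v)).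
    move=> k; have Hs := V_H1 (Vs k); have Hu := V_H1 Vu; have Hd := H1B Hs Hu.
    have := dotV_CS Hd (V_H1 Vv); have := dotVDl v Hd Hu; rewrite subrK => ->.
    by rewrite addrK.
  exact: (cvg0_mulr (normV v) su).
have [C C0 HC] := trilinear_bound Om.
apply: (@dominated_cvg_seq _ _ (fun k => C * (normV (s_ k - u) * (normV (s_ k) + normV u) * normV v))).
  move=> k; have Vd := VB (Vs k) Vu.
  have -> : trilinear (s_ k) (s_ k) v - trilinear u u v
      = trilinear (s_ k - u) (s_ k) v + trilinear u (s_ k - u) v.
    have := trilinearD1 (s_ k) Vd Vu Vv; have := trilinearD2 Vu Vd Vu Vv; rewrite subrK => -> ->.
    by move: (trilinear _ _ _) (trilinear _ _ _) (trilinear _ _ _) => x y z; ring.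
  apply: (le_trans (ler_normD _ _)).
  exact: two_term_bound (HC _ (s_ k) _ Vd Vv) (HC _ (s_ k - u) _ Vu Vv).
have c1 : normV (s_ k) + normV u @[k --> \oo] --> normV u + normV u.
  exact: (cvgD nsu (cvg_cst (normV u))).
have c2 := cvg0_mulr (normV v) (cvg0_mul su c1).
have := cvg0_mulr C c2; apply: cvg_trans; apply: near_eq_cvg; apply: nearW => k /=.
by rewrite mulrC.
Qed.

Lemma L2_dot_CS (x y : L2field Om) : `|L2_dot x y| <= `|x| * `|y|.
Proof.
rewrite ler_norml L2_cauchy_schwarz andbT -[leRHS]opprK lerN2 -[- L2_dot _ _]mulN1r -L2_dotZl scaleN1r.
by rewrite (le_trans (L2_cauchy_schwarz _ _))// -!L2_normE normrN.
Qed.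

Lemma L2_dotBr (x y z : L2field Om) : L2_dot x (y - z) = L2_dot x y - L2_dot x z.
Proof.
by rewrite L2_dotC L2_dotDl -scaleN1r L2_dotZl mulN1r ![L2_dot _ x]L2_dotC.
Qed.

Lemma L2_dotDD (x h y u : L2field Om) :
  L2_dot (x + h) (y + u) = L2_dot x y + L2_dot x u + L2_dot h y + L2_dot h u.
Proof.
by rewrite L2_dotDl ![L2_dot _ (y + u)]L2_dotC !L2_dotDl ![L2_dot y _]L2_dotC ![L2_dot u _]L2_dotC addrA.
Qed.

Lemma cvg_L2_dot (s_ h_ : nat -> L2field Om) u h : `|s_ k - u| @[k --> \oo] --> (0 : R) ->
  `|h_ k - h| @[k --> \oo] --> (0 : R) ->
  L2_dot (h_ k) (s_ k) @[k --> \oo] --> L2_dot h u.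
Proof.
move=> su hh.
pose e k := `|h_ k - h| * `|s_ k - u| + `|h_ k - h| * `|u| + `|h| * `|s_ k - u|.
apply: (@dominated_cvg_seq _ _ e); last first.
  have c1 := cvg0_mul hh su; have c2 := cvg0_mulr `|u| hh.
  have c3 := cvg0_mulr `|h| su.
  have := cvg0_add (cvg0_add c1 c2) c3.
  apply: cvg_trans; apply: near_eq_cvg; apply: nearW => k /=.
  by rewrite /e [`|h| * _]mulrC.
move=> k.
have E := L2_dotDD (h_ k - h) h (s_ k - u) u; rewrite !subrK in E; rewrite E addrK.
apply: (le_trans (ler_normD _ _)); apply: lerD; last exact: L2_dot_CS.
by apply: (le_trans (ler_normD _ _)); apply: lerD; exact: L2_dot_CS.
Qed.

End reaction.

(** * Energy of weak solutions *)
Section solutions.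
Context {R : realType} (Om : smooth_domain R).
Local Notation leb := (@lebesgue_measure R).
Local Notation V := (V_set Om).
Local Notation H := (H_set Om).

Lemma patch_null_integral (D A : set R) (f : R -> R) : measurable (D `\` A : set (measurableTypeR R)) ->
  leb (D `\` A) = 0%E -> A `<=` D ->
  (\int[leb]_x ((f \_ A) x)%:E = \int[leb]_(x in D) (f x)%:E)%E.
Proof.
move=> mN N0 AD; rewrite [RHS]integral_mkcond; apply: (integral_null_eq mN N0) => x _ Nx.
rewrite !patchE; have [xA|xA] := boolP (x \in A).
  by rewrite ifT// inE; apply: AD; rewrite inE in xA.
rewrite ifF//; apply/negP; rewrite inE => xD; apply: Nx; split => //.
by rewrite notin_setE in xA.
Qed.

Lemma patch_null_Rintegral (D E A : set R) (f g : R -> R) :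
  measurable (D `\` A : set (measurableTypeR R)) ->
  leb (D `\` A) = 0%E -> D `<=` E -> A `<=` D -> (forall x, ~ D x -> g x = 0) ->
  \int[leb]_x ((f \_ A) x * g x) = \int[leb]_(x in E) (f x * g x).
Proof.
move=> mN N0 DE AD g0; rewrite [RHS]Rintegral_mkcond.
apply: (Rintegral_null_eq mN N0) => x _ Nx; rewrite !patchE.
have [xA|xA] := boolP (x \in A).
  by rewrite ifT// inE; apply/DE/AD; rewrite inE in xA.
have [xD|xD] := pselect (D x).
  by case: Nx; split => //; rewrite notin_setE in xA.
by rewrite g0// !mulr0; case: ifP.
Qed.

Lemma patch_one (t0 t1 : R) (A : set R) : measurable (A : set (measurableTypeR R)) ->
  A `<=` `]t0, t1[%classic -> leb (`]t0, t1[%classic `\` A) = 0%E ->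
  leb.-integrable setT (EFin \o ((fun=> 1 : R) \_ A)) /\
  forall s t, t0 < s -> s <= t -> t < t1 -> \int[leb]_(r in `[s, t]) ((fun=> 1 : R) \_ A) r = t - s.
Proof.
move=> mA AD N0; split.
  rewrite -restrict_EFin; apply/integrable_restrict => //; rewrite setTI.
  apply: (@integrableS _ _ _ leb `[t0, t1]%classic) => //.
    by apply: (subset_trans AD); exact: subset_itv_oo_cc.
  exact: integrable_itv_cst.
move=> s t ts st tt.
have mD : measurable (`]t0, t1[%classic : set (measurableTypeR R)) by exact: measurable_itv.
have mI : measurable (`[s, t]%classic : set (measurableTypeR R)) by exact: measurable_itv.
have lI : leb (`[s, t]%classic : set R) = (t - s)%:E.
  rewrite lebesgue_measure_itv/= lte_fin; case: ltP => //.
  by rewrite le_eqVlt ltNge st orbF => /eqP ->; rewrite subrr.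
rewrite (Rintegral_null_eq (measurableD mD mA) N0 (g := fun=> 1)).
  apply: etrans (Rintegral_cst leb mI _) _; rewrite mul1r.
  by rewrite -[RHS]/(fine (t - s)%:E) -lI.
move=> r /=; rewrite in_itv/= => /andP[sr rt] nA; rewrite patchE ifT// inE.
apply: contrapT => nAr; apply: nA; split => //.
by rewrite /= in_itv/= (lt_le_trans ts sr) (le_lt_trans rt tt).
Qed.

Lemma test_function_bounded (t0 t1 : R) (phi : R -> R) :
  test_function `]t0, t1[%classic phi -> exists M, forall x, `|phi x| <= M.
Proof.
move=> tp; have [sp _ _] := tp.
have cp : continuous phi by have [c _] := sp [::].
have /compact_bounded[M [_ HM]] : compact (phi @` `[t0, t1]%classic).
  apply: continuous_compact; last exact: segment_compact.
  by apply: continuous_subspaceT.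
exists (`|M| + 1) => x; have [xI|xI] := pselect (`]t0, t1[%classic x).
  apply: (HM (`|M| + 1)); first by rewrite (le_lt_trans (ler_norm M))// ltrDl.
  by exists x => //; apply: subset_itv_oo_cc.
by rewrite (test_function_eq0 tp xI).1 normr0 addr_ge0.
Qed.

Lemma test_functionS (O O' : set R) (phi : R -> R) : O `<=` O' ->
  test_function O phi -> test_function O' phi.
Proof. by move=> OO [sp cp sO]; split => //; exact: subset_trans OO. Qed.

End solutions.

Lemma integrable_mul_bounded (R : realType) (f phi : R -> R) (M : R) :
  (@lebesgue_measure R).-integrable setT (EFin \o f) -> measurable_fun setT phi ->
  (forall x, `|phi x| <= M) ->
  (@lebesgue_measure R).-integrable setT (EFin \o (fun x => f x * phi x)).
Proof.
move=> fi mphi HM.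
apply: (@le_integrable_EFin _ _ _ lebesgue_measure _ _ (fun t => `|f t| * M)) => //.
- by apply: measurable_funM => //; apply/measurable_EFinP; exact: measurable_int fi.
- by move=> r _; rewrite normrM ler_wpM2l.
- by have := integrableZr measurableT M (integrable_norm fi); apply: eq_integrable.
Qed.

(** Moves the two integrals of a weak formulation from [E] to the set of full
    measure [A], where the integrands are measurable and can be subtracted. *)
Lemma patch_weak_form (R : realType) (D E A : set R) (re du phi : R -> R) (X M : R) :
  measurable (D `\` A : set (measurableTypeR R)) ->
  (@lebesgue_measure R) (D `\` A) = 0%E -> D `<=` E -> A `<=` D ->
  (@lebesgue_measure R).-integrable setT (EFin \o (re \_ A)) ->
  (@lebesgue_measure R).-integrable setT (EFin \o ((fun r => re r - du r) \_ A)) ->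
  measurable_fun setT phi -> (forall x, `|phi x| <= M) -> (forall x, ~ D x -> phi x = 0) ->
  - X + \int[@lebesgue_measure R]_(t in E) (re t * phi t)
    = \int[@lebesgue_measure R]_(t in E) (du t * phi t) ->
  X = \int[@lebesgue_measure R]_t (((fun r => re r - du r) \_ A) t * phi t).
Proof.
move=> mN N0 DE AD ire iG mphi HM phi0 wk.
have EG r : ((fun r => re r - du r) \_ A) r = (re \_ A) r - (du \_ A) r.
  by rewrite !patchE; case: ifP => _; rewrite ?subr0.
have idu : (@lebesgue_measure R).-integrable setT (EFin \o (du \_ A)).
  have := integrableB measurableT ire iG; apply: eq_integrable => // r _.
  by rewrite /= EG -EFinB opprB addrC subrK.
have -> : \int[lebesgue_measure]_t (((fun r => re r - du r) \_ A) t * phi t)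
    = \int[lebesgue_measure]_t ((re \_ A) t * phi t - (du \_ A) t * phi t).
  by apply: eq_Rintegral => r _; rewrite EG mulrBl.
rewrite RintegralB//; [|exact: integrable_mul_bounded mphi HM..].
rewrite (patch_null_Rintegral re mN N0 DE AD phi0) (patch_null_Rintegral du mN N0 DE AD phi0) -wk.
by move: (Rintegral _ _ _) => p; ring.
Qed.

Section energy_of_solutions.
Context {R : realType} (Om : smooth_domain R).
Local Notation leb := (@lebesgue_measure R).
Local Notation V := (V_set Om).
Local Notation H := (H_set Om).
Local Notation normH := (fun u : L2field Om => `|u|).
#[local] Opaque dotV normV trilinear L2_dot.

Let scaled_sum (e C a h b r d K : R) : 0 <= e -> 0 <= C -> 0 <= a -> 0 <= h -> 0 <= b ->
  r <= K * (1 + a ^+ 4) * b -> r <= K * (1 + a ^+ 4 + b ^+ 4) -> d <= h * (C * b) -> 0 <= K ->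
  r + e * d <= (K + e * C) * (1 + a ^+ 4 + h ^+ 2) * b /\
  r + e * d <= (K + e * C) * (1 + a ^+ 4 + h ^+ 2) + (K + e * C) * b ^+ 4.
Proof.
move=> e0 C0 a0 h0 b0 r1 r2 d1 K0.
have a4 : 0 <= a ^+ 4 by rewrite exprn_ge0.
have b4 : 0 <= b ^+ 4 by rewrite exprn_ge0.
have h2 := sqr_ge0 h; have eC : 0 <= e * C by rewrite mulr_ge0.
have ed : e * d <= e * C * (h * b).
  apply: (le_trans (ler_wpM2l e0 d1)).
  by rewrite le_eqVlt; apply/orP; left; apply/eqP; ring.
have hh : h <= 1 + h ^+ 2 by have := sqr_ge0 (h - 1); rewrite sqrrB; move: (h ^+ 2) h2 => y; lra.
have hb : h * b <= h ^+ 2 + b ^+ 2.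
  by have := sqr_ge0 (h - b); rewrite sqrrB; move: (h ^+ 2) (b ^+ 2) h2 (sqr_ge0 b) => *; lra.
have b2 := @expr_le_quartic _ 2 b isT b0.
have Ka : 0 <= K * a ^+ 4 by rewrite mulr_ge0.
have Kh : 0 <= K * h ^+ 2 by rewrite mulr_ge0.
split.
  have k1 : e * C * (h * b) <= e * C * (1 + a ^+ 4 + h ^+ 2) * b.
    rewrite mulrA ler_wpM2r// ler_wpM2l//; apply: (le_trans hh).
    by move: (a ^+ 4) a4 (h ^+ 2) => *; lra.
  have k2 : K * (1 + a ^+ 4) * b <= K * (1 + a ^+ 4 + h ^+ 2) * b.
    by rewrite ler_wpM2r// ler_wpM2l// lerDl.
  by rewrite [(K + e * C) * _]mulrDl mulrDl lerD// ?(le_trans r1)// (le_trans ed).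
have k1 : e * C * (h * b) <= e * C * (1 + a ^+ 4 + h ^+ 2 + b ^+ 4).
  rewrite ler_wpM2l//; apply: (le_trans hb).
  by move: (a ^+ 4) (b ^+ 4) (h ^+ 2) (b ^+ 2) a4 b4 h2 b2 => *; lra.
have k2 : K * (1 + a ^+ 4 + b ^+ 4) <= K * (1 + a ^+ 4 + h ^+ 2 + b ^+ 4).
  by rewrite ler_wpM2l// lerD2r lerDl.
rewrite -mulrDr mulrDl; apply: lerD; first exact: le_trans k2.
exact: le_trans k1.
Qed.

Lemma continuous_L2_dot (v : L2field Om) : continuous (fun x : L2field Om => L2_dot x v).
Proof.
move=> x; apply: (@cvgrPdist_le _ _ _ (nbhs x) (nbhs_filter x) (fun y => L2_dot y v) (L2_dot x v)).2 => e e0.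
have d0 : 0 < e / (`|v| + 1) by rewrite divr_gt0// ltr_wpDl.
have /cvgrPdist_lt/(_ _ d0) : (fun y : L2field Om => y) @ x --> x by exact: cvg_id.
apply: filterS => y /ltW xy.
have -> : L2_dot x v - L2_dot y v = L2_dot (x - y) v by rewrite ![L2_dot _ v]L2_dotC L2_dotBr.
apply: (le_trans (L2_dot_CS _ _)).
apply: (@le_trans _ _ (e / (`|v| + 1) * (`|v| + 1))); last first.
  by rewrite divfK// gt_eqF// ltr_wpDl.
by apply: ler_pM => //; rewrite lerDl.
Qed.

(** On [A] the approximations of [u] and [h] by simple functions converge, so that
    all the terms are Borel functions of time there; off [A] they are replaced by
    0.  At [v = u] the trilinear form drops out. *)
Lemma solution_energy (nu nu0 eps t0 t1 : R) (h u : R -> L2field Om) u0 :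
  0 <= eps -> t0 < t1 -> bochner_Lp `]t0, t1[%classic H normH 2 h ->
  weak_solution nu nu0 (fun t => dual_of (eps *: h t)) t0 u0 u ->
  exists (A : set R), [/\ measurable (A : set (measurableTypeR R)), A `<=` `]t0, t1[%classic,
    leb (`]t0, t1[%classic `\` A) = 0%E,
    forall t, A t -> V (u t) &
    [/\ leb.-integrable setT (EFin \o ((fun t => `|h t| ^+ 2) \_ A)),
        leb.-integrable setT (EFin \o ((fun t => normV (u t) ^+ 4) \_ A)),
        leb.-integrable setT (EFin \o
          ((fun t => (nu + nu0 * normV (u t) ^+ 2) * normV (u t) ^+ 2 - eps * L2_dot (h t) (u t)) \_ A))
      & forall a b, t0 < a -> a < b -> b < t1 ->
        `|u b| ^+ 2 - `|u a| ^+ 2 <= - 2 * \int[leb]_(s in `[a, b])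
          ((fun t => (nu + nu0 * normV (u t) ^+ 2) * normV (u t) ^+ 2 - eps * L2_dot (h t) (u t)) \_ A) s]].
Proof.
move=> eps0 t01 [smh Ih] [_ cu _ /(_ _ t01)[smu Iu] weak].
pose D : set R := `]t0, t1[%classic.
have mD : measurable (D : set (measurableTypeR R)) by exact: measurable_itv.
have [s_ [A1 [ss mA1 A1D N1 cs]]] := strongly_measurable_good mD smu.
have [r_ [A2 [sr mA2 A2D N2 cr]]] := strongly_measurable_good mD smh.
pose A := A1 `&` A2.
have mA : measurable (A : set (measurableTypeR R)) by exact: measurableI.
have AD : A `<=` D by move=> t [/A1D].
have mN : measurable (D `\` A : set (measurableTypeR R)) by exact: measurableD.
have N0 : leb (D `\` A) = 0%E.
  by rewrite setDIr measureU0//; exact: measurableD.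
have As t : A t -> V (u t) /\ normV (s_ k t - u t) @[k --> \oo] --> (0 : R) by move=> [/cs].
have Ar t : A t -> `|r_ k t - h t| @[k --> \oo] --> (0 : R) by move=> [_ /cr[]].
have Vs k t : V (s_ k t) by have [_ sV _] := ss k; apply: sV; exists t.
have [C C0 HC] := V_bounds Om.
have AsH t : A t -> `|s_ k t - u t| @[k --> \oo] --> (0 : R).
  move=> At; have [Vu sut] := As t At.
  have cC : C * normV (s_ k t - u t) @[k --> \oo] --> (0 : R).
    by have := cvg0_mulr C sut; apply: cvg_trans; apply: near_eq_cvg; apply: nearW => k; rewrite mulrC.
  apply: (dominated_cvg_seq _ cC) => k; rewrite subr0 normr_id.
  by have [] := HC _ (VB (Vs k t) Vu).
have mlim (Phi : L2field Om -> L2field Om -> R) :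
    (forall t, A t -> Phi (s_ k t) (r_ k t) @[k --> \oo] --> Phi (u t) (h t)) ->
    measurable_fun A (fun t => Phi (u t) (h t)).
  exact: measurable_limit_simple mA ss sr.
have mNu : measurable_fun A (fun t => normV (u t)).
  apply: (mlim (fun x _ => normV x)) => t At.
  by have [Vu sut] := As t At; exact: (@cvg_normV R Om (fun k => s_ k t) (u t) (fun k => Vs k t) Vu sut).
have mh : measurable_fun A (fun t => `|h t|).
  apply: (mlim (fun _ y => `|y|)) => t At.
  apply: (dominated_cvg_seq _ (Ar t At)) => k; exact: ler_dist_dist.
have mhu : measurable_fun A (fun t => L2_dot (h t) (u t)).
  apply: (mlim (fun x y => L2_dot y x)) => t At.
  exact: (@cvg_L2_dot R Om (fun k => s_ k t) (fun k => r_ k t) _ _ (AsH t At) (Ar t At)).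
have mhv v : measurable_fun A (fun t => L2_dot (h t) v).
  apply: (mlim (fun _ y => L2_dot y v)) => t At.
  have vv : `|v - v| @[_ --> \oo] --> (0 : R) by rewrite subrr normr0; exact: cvg_cst.
  exact: (@cvg_L2_dot R Om (fun=> v) (fun k => r_ k t) _ _ vv (Ar t At)).
have mre v : V v -> measurable_fun A (fun t => reaction nu nu0 (u t) v).
  move=> Vv; apply: (mlim (fun x _ => reaction nu nu0 x v)) => t At.
  have [Vu sut] := As t At.
  exact: (@cvg_reaction R Om nu nu0 (fun k => s_ k t) (u t) v (fun k => Vs k t) Vu Vv sut).
have mpatch (f : R -> R) : measurable_fun A f -> measurable_fun setT (f \_ A).
  exact: (measurable_restrictT _ mA).1.
pose N4 := (fun t => normV (u t) ^+ 4) \_ A.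
pose H2 := (fun t => `|h t| ^+ 2) \_ A.
have iN4 : leb.-integrable setT (EFin \o N4).
  apply: integrable_EFin_ge0 => //.
  - by apply: mpatch; exact: measurable_funX.
  - by move=> t _; rewrite /N4 patchE; case: ifP => // _; rewrite exprn_ge0 ?normV_ge0.
  - by rewrite /N4 (patch_null_integral _ mN N0 AD).
have iH2 : leb.-integrable setT (EFin \o H2).
  apply: integrable_EFin_ge0 => //.
  - by apply: mpatch; exact: measurable_funX.
  - by move=> t _; rewrite /H2 patchE; case: ifP => // _; rewrite exprn_ge0.
  - by rewrite /H2 (patch_null_integral _ mN N0 AD).
have [i1 _] := patch_one mA AD N0.
pose m0 t := ((fun=> 1 : R) \_ A) t + N4 t + H2 t.
have im0 : leb.-integrable setT (EFin \o m0).
  by have := integrableD measurableT (integrableD measurableT i1 iN4) iH2; apply: eq_integrable.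
have [K K0 HK] := reaction_bound Om nu nu0.
pose KK := K + eps * C.
have KK0 : 0 <= KK by rewrite /KK addr_ge0 ?mulr_ge0// ltW.
pose G v := (fun r => reaction nu nu0 (u r) v - eps * L2_dot (h r) v) \_ A.
have Gbound r v : V v -> `|G v r| <= KK * m0 r * normV v /\
    `|G v r| <= KK * m0 r + KK * normV v ^+ 4.
  move=> Vv; rewrite /G /m0 /N4 /H2 !patchE; case: ifPn => [|_]; last first.
    rewrite !addr0 mulr0 mul0r normr0 add0r; split => //.
    by rewrite mulr_ge0// exprn_ge0// normV_ge0.
  rewrite inE => At; have [Vu _] := As r At; have [k1 k2] := HK _ _ Vu Vv.
  have [Cv _] := HC _ Vv; have dv : `|L2_dot (h r) v| <= `|h r| * (C * normV v).
    by apply: (le_trans (L2_dot_CS _ _)); rewrite ler_wpM2l.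
  have tri : `|reaction nu nu0 (u r) v - eps * L2_dot (h r) v|
      <= `|reaction nu nu0 (u r) v| + eps * `|L2_dot (h r) v|.
    by rewrite (le_trans (ler_normB _ _))// normrM (ger0_norm eps0).
  have [j1 j2] := scaled_sum eps0 (ltW C0) (normV_ge0 (u r)) (normr_ge0 (h r)) (normV_ge0 v)
    k1 k2 dv (ltW K0).
  by split; [exact: le_trans j1|exact: le_trans j2].
have GB r v w : V v -> V w -> G v r - G w r = G (v - w) r.
  move=> Vv Vw; rewrite /G !patchE; case: ifPn => [|_]; last by rewrite subr0.
  rewrite inE => At; have [Vu _] := As r At; rewrite -reactionB// L2_dotBr.
  by move: (reaction _ _ _ _) (reaction _ _ _ _) (L2_dot _ _) (L2_dot _ _) => *; ring.
have im : leb.-integrable setT (EFin \o (fun t => KK * m0 t)).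
  by have := integrableZl measurableT KK im0; apply: eq_integrable.
have iq : leb.-integrable setT (EFin \o (fun t => KK * N4 t)).
  by have := integrableZl measurableT KK iN4; apply: eq_integrable.
have iG v : V v -> leb.-integrable setT (EFin \o G v).
  move=> Vv; apply: (@le_integrable_EFin _ _ _ leb _ _ (fun t => KK * m0 t * normV v)) => //.
  - apply: mpatch; apply: measurable_funB; first exact: mre.
    by apply: measurable_funM => //; exact: mhv.
  - by move=> t _; have [] := Gbound t _ Vv.
  - by have := integrableZr measurableT (normV v) im; apply: eq_integrable.
pose z := (fun t => (nu + nu0 * normV (u t) ^+ 2) * normV (u t) ^+ 2 - eps * L2_dot (h t) (u t)) \_ A.
have zE t : z t = G (u t) t.
  rewrite /z /G !patchE; case: ifPn => //; rewrite inE => At.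
  by have [Vu _] := As t At; rewrite reaction_self.
have iz : leb.-integrable setT (EFin \o z).
  apply: (@le_integrable_EFin _ _ _ leb _ _ (fun t => KK * m0 t + KK * N4 t)) => //.
  - apply: mpatch; apply: measurable_funB; last exact: measurable_funM.
    have mN2 : measurable_fun A (fun t => normV (u t) ^+ 2) by exact: measurable_funX.
    by apply: measurable_funM => //; apply: measurable_funD => //; exact: measurable_funM.
  - move=> t _; have [At|At] := boolP (t \in A).
      have At' := At; rewrite inE in At'; have [Vu _] := As t At'.
      have [_ gb] := Gbound t _ Vu; rewrite zE; apply: (le_trans gb).
      by rewrite /N4 patchE At.
    rewrite /z /m0 /N4 /H2 !patchE (negbTE At) normr0 !addr0 !mulr0 addr0.
    exact: lexx.
  - by have := integrableD measurableT im iq; apply: eq_integrable.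
exists A; rewrite -/z; split => //; first by move=> t /As[].
split => // a b ta ab bt.
have zI : \int[leb]_(s in `[a, b]) z s = \int[leb]_(s in `[a, b]) G (u s) s.
  by apply: eq_Rintegral => t _; exact: zE.
have cu01 : {within `[t0, t1], continuous u}.
  by apply: continuous_subspaceW cu => t; rewrite /= !in_itv/= andbT => /andP[].
have su : {ae leb, forall t, `]t0, t1[%classic t -> [/\ V (u t),
    normV (s_ k t - u t) @[k --> \oo] --> (0 : R) & KK * normV (u t) ^+ 4 <= KK * N4 t]}.
  exists (D `\` A); split => // t; apply: contra_notP => nDA Dt.
  have At : A t by apply: contrapT => nA; apply: nDA.
  by have [Vu sut] := As t At; split => //; rewrite /N4 patchE ifT// inE.
have Glip r v w : V v -> V w -> `|G v r - G w r| <= KK * m0 r * normV (v - w).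
  by move=> Vv Vw; rewrite GB//; have [] := Gbound r _ (VB Vv Vw).
have Glow r v : V v -> - G v r <= KK * m0 r + KK * normV v ^+ 4.
  move=> Vv; have [_ gb] := Gbound r _ Vv; apply: le_trans gb.
  by rewrite -normrN; exact: ler_norm.
have iGu : leb.-integrable `[a, b] (EFin \o (fun t => G (u t) t)).
  have mI : measurable (`[a, b]%classic : set (measurableTypeR R)) by exact: measurable_itv.
  have := integrable_itvT `[a, b] iz; apply: eq_integrable => // t _ /=.
  by rewrite zE.
have weakG v : V v -> forall s t, t0 < s -> s < t -> t < t1 ->
    L2_dot (u t) v - L2_dot (u s) v = - \int[leb]_(r in `]s, t]) G v r.
  move=> Vv.
  pose w t := L2_dot (u (clamp t0 t1 t)) v.
  have cw : continuous w.
    have cc := continuous_clamp (ltW t01) cu01.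
    move=> t; exact: (@continuous_comp _ _ _ (u \o clamp t0 t1) (fun x => L2_dot x v) t
      (cc t) (@continuous_L2_dot v _)).
  have W phi : test_function D phi ->
      \int[leb]_x (w x * (phi^`())%classic x) = \int[leb]_x (G v x * phi x).
    move=> tp; have tpE := test_functionS (subset_itvl (isT : (BLeft t1 <= +oo)%O) : D `<=` `]t0, +oo[%classic) tp.
    have DE : D `<=` `]t0, +oo[%classic by move=> r; rewrite /D /= !in_itv/= andbT => /andP[].
    have wk := weak v Vv phi tpE.
    have [M HM] := test_function_bounded tp.
    have mphi : measurable_fun setT phi.
      by have [sp _ _] := tp; have [c _] := sp [::]; exact: continuous_measurable_fun.
    have phi0 r : ~ D r -> phi r = 0 by move=> /(test_function_eq0 tp)[].
    pose re r := reaction nu nu0 (u r) v; pose du r := dual_of (eps *: h r) v.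
    have GE : G v = (fun r => re r - du r) \_ A.
      apply/funext => r; rewrite /G !patchE /re /du /dual_of; case: (r \in A) => //.
      by rewrite (L2_dotZl eps (h r) v).
    have I1 : \int[leb]_x (w x * (phi^`())%classic x)
        = \int[leb]_(t in `]t0, +oo[) (L2_dot (u t) v * (phi^`())%classic t).
      rewrite [RHS]Rintegral_mkcond; apply: eq_Rintegral => r _; rewrite patchE.
      have [Dr|nDr] := pselect (D r).
        rewrite ifT; last by rewrite inE; exact: DE.
        by move: Dr; rewrite /D/= in_itv/= => /andP[r0 r1]; rewrite /w clamp_id// !ltW.
      by rewrite derive1E (test_function_eq0 tp nDr).2 !mulr0; case: ifP.
    have ire : leb.-integrable setT (EFin \o (re \_ A)).
      have bnd r : setT r -> `|(re \_ A) r| <= K * m0 r * normV v.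
        move=> _; rewrite /m0 /N4 /H2 !patchE; case: ifPn => [|_]; last first.
          by rewrite normr0 !addr0 mulr0 mul0r.
        rewrite inE => Ar'; have [Vu _] := As r Ar'; have [k1 _] := HK _ _ Vu Vv.
        apply: (le_trans k1); apply: ler_wpM2r; first exact: normV_ge0.
        by apply: ler_wpM2l; [exact: ltW|rewrite lerDl sqr_ge0].
      have ig : leb.-integrable setT (EFin \o (fun r => K * m0 r * normV v)).
        have := integrableZr measurableT (normV v) (integrableZl measurableT K im0).
        by apply: eq_integrable.
      exact: (@le_integrable_EFin _ _ _ leb _ _ _ measurableT (mpatch _ (mre v Vv)) bnd ig).
    have iGr : leb.-integrable setT (EFin \o ((fun r => re r - du r) \_ A)).
      by have := iG v Vv; rewrite GE.
    have -> : G v = (fun r => re r - du r) \_ A by exact: GE.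
    rewrite I1; exact: (patch_weak_form mN N0 DE AD ire iGr mphi HM phi0 wk).
  have WP := weak_primitive cw (iG v Vv) W.
  move=> s t ts st tt.
  have ct : clamp t0 t1 t = t by apply: clamp_id; rewrite (ltW tt) andbT ltW// (lt_trans ts).
  have cs' : clamp t0 t1 s = s by apply: clamp_id; rewrite (ltW ts)/= ltW// (lt_trans st).
  by have := WP s t ts st tt; rewrite /w ct cs'.
by rewrite zI; exact: (energy_inequality ta ab bt cu01 ss su im iq iG Glip Glow weakG iGu).
Qed.

End energy_of_solutions.

(** * Absorption and the attractors *)
Section absorbing_bound.
Context {R : realType} (Om : smooth_domain R).
Local Notation leb := (@lebesgue_measure R).
Local Notation V := (V_set Om).
Local Notation H := (H_set Om).
Local Notation normH := (fun u : L2field Om => `|u|).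
#[local] Opaque dotV normV trilinear L2_dot.

(** Of the damping [2 nu0 N^4], which is at least [2 c U^4] with [c = nu0 / C^4],
    one half absorbs the forcing, through [2 eps h U <= eps h^2 + eps U^2] and
    [eps U^2 <= c U^4 + eps^2 / (4 c)]. *)
Let dissipation (nu nu0 C N U h d eps y : R) : 0 <= nu -> 0 < nu0 -> 0 < C -> 0 <= eps ->
  0 <= U -> U <= C * N -> d <= h * U -> 0 <= y -> y <= U ^+ 2 ->
  - 2 * ((nu + nu0 * N ^+ 2) * N ^+ 2 - eps * d)
    <= eps * h ^+ 2 + eps ^+ 2 / (4 * (nu0 / C ^+ 4)) - nu0 / C ^+ 4 * y ^+ 2.
Proof.
move=> nu0' nu00 C0 eps0 U0 UN dU y0 yU.
set c := nu0 / C ^+ 4.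
have c0 : 0 < c by rewrite divr_gt0// exprn_gt0.
have cE : c * C ^+ 4 = nu0 by rewrite divfK// gt_eqF// exprn_gt0.
have h1 : c * (U ^+ 2) ^+ 2 <= nu0 * (N ^+ 2) ^+ 2.
  have N0 : 0 <= C * N by exact: le_trans UN.
  rewrite -cE -mulrA ler_wpM2l ?(ltW c0)// -!exprM -exprMn.
  by rewrite lerXn2r ?nnegrE.
have h2 : c * y ^+ 2 <= c * (U ^+ 2) ^+ 2.
  by rewrite ler_wpM2l ?(ltW c0)// lerXn2r ?nnegrE// sqr_ge0.
have h3 : eps * d <= eps * (h * U) by rewrite ler_wpM2l.
have h4 : 2 * (eps * (h * U)) <= eps * h ^+ 2 + eps * U ^+ 2.
  have -> : 2 * (eps * (h * U)) = eps * (2 * (h * U)) by ring.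
  rewrite -mulrDr ler_wpM2l//; have := sqr_ge0 (h - U); rewrite sqrrB -mulr_natl; lra.
have h5 : eps * U ^+ 2 <= c * (U ^+ 2) ^+ 2 + eps ^+ 2 / (4 * c).
  have := sqr_ge0 (2 * c * U ^+ 2 - eps).
  have -> : (2 * c * U ^+ 2 - eps) ^+ 2
      = 4 * c * (c * (U ^+ 2) ^+ 2 + eps ^+ 2 / (4 * c) - eps * U ^+ 2).
    by field; rewrite gt_eqF.
  have c40 : 0 < 4 * c by rewrite mulr_gt0.
  by rewrite (pmulr_rge0 _ c40) subr_ge0.
have h6 : 0 <= nu * N ^+ 2 by rewrite mulr_ge0// sqr_ge0.
have -> : - 2 * ((nu + nu0 * N ^+ 2) * N ^+ 2 - eps * d)
  = - 2 * (nu * N ^+ 2) - 2 * (nu0 * (N ^+ 2) ^+ 2) + 2 * (eps * d) by ring.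
move: (nu0 * _) (c * _) (c * _) (eps ^+ 2 / _) (eps * h ^+ 2) (eps * d) (eps * (h * U)) (eps * U ^+ 2)
  (nu * _) h1 h2 h3 h4 h5 h6 => *; lra.
Qed.

(** Subtract from [|u|^2] the energy [E] brought by the forcing since time [a].
    The difference [Z] is nonincreasing; when [Z t] is positive, it bounds
    [|u|^2] from below before [t], which is what [absorption] requires. *)
Lemma absorbing_bound (nu nu0 : R) : 0 < nu -> 0 < nu0 -> exists2 c : R, 0 < c &
  forall (eps t0 t1 : R) (h u : R -> L2field Om) u0, 0 <= eps -> t0 < t1 ->
    bochner_Lp `]t0, t1[%classic H normH 2 h ->
    weak_solution nu nu0 (fun t => dual_of (eps *: h t)) t0 u0 u ->
    forall a b, t0 < a -> a < b -> b < t1 ->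
      `|u b| ^+ 2 <= 2 / (c * (b - a)) + (eps * \int[leb]_(t in `]t0, t1[) `|h t| ^+ 2
        + eps ^+ 2 / (4 * c) * (b - a)).
Proof.
move=> nup nu0p; have [C C0 HC] := V_bounds Om.
exists (nu0 / C ^+ 4); first by rewrite divr_gt0// exprn_gt0.
move=> eps t0 t1 h u u0 eps0 t01 bh sol a b ta ab bt.
have [A [mA AD N0 AV [iH2 _ iz en]]] := solution_energy eps0 t01 bh sol.
set c := nu0 / C ^+ 4.
have c0 : 0 < c by rewrite divr_gt0// exprn_gt0.
have [i1 I1] := patch_one mA AD N0.
pose one := (fun=> 1 : R) \_ A; pose H2 := (fun t => `|h t| ^+ 2) \_ A.
pose z := (fun t => (nu + nu0 * normV (u t) ^+ 2) * normV (u t) ^+ 2 - eps * L2_dot (h t) (u t)) \_ A.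
rewrite -/one in i1 I1; rewrite -/H2 in iH2; rewrite -/z in iz en.
pose k := eps ^+ 2 / (4 * c).
have k0 : 0 <= k by rewrite divr_ge0 ?sqr_ge0// mulr_ge0// ltW.
pose e r := eps * H2 r + k * one r.
have e0 r : 0 <= e r.
  rewrite /e /H2 /one !patchE; case: ifP => _; last by rewrite !mulr0 addr0.
  by apply: addr_ge0; apply: mulr_ge0 => //; exact: sqr_ge0.
have ie : leb.-integrable setT (EFin \o e).
  have := integrableD measurableT (integrableZl measurableT eps iH2) (integrableZl measurableT k i1).
  by apply: eq_integrable.
pose E t := \int[leb]_(r in `[a, t]) e r.
have E0 t : 0 <= E t by apply: Rintegral_ge0 => r _; exact: e0.
have Eadd s t : a <= s -> s <= t -> E t - E s = \int[leb]_(r in `[s, t]) e r.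
  move=> as_ st; rewrite /E Rintegral_itvB//; last exact: integrable_itvT.
  by rewrite Rintegral_itv_obnd_cbnd//; exact: integrable_itvT.
have step s t y : a <= s -> s <= t -> t <= b -> 0 <= y ->
    (forall r, s <= r <= t -> y <= `|u r| ^+ 2) ->
    `|u t| ^+ 2 - `|u s| ^+ 2 <= E t - E s - c * y ^+ 2 * (t - s).
  move=> as_ st tb y0 Hy.
  have ts : t0 < s by exact: lt_le_trans as_.
  have tt : t < t1 by exact: le_lt_trans bt.
  move: (st); rewrite le_eqVlt => /orP[/eqP <-|sltt]; first by rewrite !subrr mulr0 subr0.
  apply: (le_trans (en _ _ ts sltt tt)).
  have mI : measurable (`[s, t]%classic : set (measurableTypeR R)) by exact: measurable_itv.
  have iz2 : leb.-integrable `[s, t] (EFin \o (fun r => - 2 * z r)).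
    by have := integrableZl mI (- 2) (integrable_itvT `[s, t] iz); apply: eq_integrable.
  have ic : leb.-integrable `[s, t] (EFin \o (fun r => c * y ^+ 2 * one r)).
    by have := integrableZl mI (c * y ^+ 2) (integrable_itvT `[s, t] i1); apply: eq_integrable.
  have ie' := integrable_itvT `[s, t] ie.
  rewrite -RintegralZl//; last exact: integrable_itvT.
  rewrite Eadd// -(I1 _ _ ts st tt) -RintegralZl//; last exact: integrable_itvT.
  rewrite -RintegralB//; apply: le_Rintegral => //.
    by have := integrableB mI ie' ic; apply: eq_integrable.
  move=> r; rewrite /= in_itv/= => sr; rewrite /z /e /one /H2 !patchE.
  case: ifPn => [|_]; last by rewrite !mulr0 addr0 subr0.
  rewrite inE => Ar; rewrite !mulr1; have [UC _] := HC _ (AV _ Ar).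
  exact: (dissipation (ltW nup) nu0p C0 eps0 (normr_ge0 _) UC
    (le_trans (ler_norm _) (L2_dot_CS _ _)) y0 (Hy _ sr)).
pose Z t := `|u t| ^+ 2 - E t.
have Zmono s t : a <= s -> s <= t -> t <= b -> Z t <= Z s.
  move=> as_ st tb; have := step s t 0 as_ st tb (lexx _) (fun r _ => sqr_ge0 _).
  by rewrite expr0n/= mulr0 mul0r subr0 /Z; move: (`|u t| ^+ 2) (`|u s| ^+ 2) => *; lra.
have Zb : Z b <= 2 / (c * (b - a)).
  apply: absorption => // s t as_ st tb Zt.
  have := step s t (Z t) as_ st tb (ltW Zt) _.
  have Hr r : s <= r <= t -> Z t <= `|u r| ^+ 2.
    move=> /andP[sr rt]; have := Zmono r t (le_trans as_ sr) rt tb.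
    by have := E0 r; rewrite {2}/Z; move: (Z t) (`|u r| ^+ 2) => *; lra.
  move=> /(_ Hr); rewrite [c * Z t ^+ 2 * _]mulrAC; move: (c * (t - s) * _); rewrite /Z.
  by move: (`|u t| ^+ 2) (`|u s| ^+ 2) => *; lra.
have IH2 : \int[leb]_(r in `[a, b]) H2 r <= \int[leb]_(t in `]t0, t1[) `|h t| ^+ 2.
  have mD : measurable (`]t0, t1[%classic : set (measurableTypeR R)) by exact: measurable_itv.
  have mI : measurable (`[a, b]%classic : set (measurableTypeR R)) by exact: measurable_itv.
  have -> : \int[leb]_(t in `]t0, t1[) `|h t| ^+ 2 = \int[leb]_t H2 t.
    by congr fine; rewrite -(patch_null_integral _ (measurableD mD mA) N0 AD).
  have HH r : 0 <= H2 r by rewrite /H2 patchE; case: ifP => // _; rewrite sqr_ge0.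
  rewrite Rintegral_mkcond; apply: le_Rintegral => //.
    by rewrite -restrict_EFin; apply/integrable_restrict => //; rewrite setTI; exact: integrable_itvT.
  by move=> r _; rewrite patchE; case: ifP.
have Eb : E b <= eps * \int[leb]_(t in `]t0, t1[) `|h t| ^+ 2 + k * (b - a).
  have mI : measurable (`[a, b]%classic : set (measurableTypeR R)) by exact: measurable_itv.
  have ja := integrable_itvT `[a, b] iH2; have jb := integrable_itvT `[a, b] i1.
  rewrite /E /e RintegralD//.
  - rewrite !RintegralZl// (I1 _ _ ta (ltW ab) bt) lerD2r.
    exact: ler_wpM2l.
  - by have := integrableZl mI eps ja; apply: eq_integrable.
  - by have := integrableZl mI k jb; apply: eq_integrable.
have -> : `|u b| ^+ 2 = Z b + E b by rewrite /Z subrK.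
exact: lerD.
Qed.

End absorbing_bound.

Section zero_attractor.
Context {R : realType} (Om : smooth_domain R).
Local Notation leb := (@lebesgue_measure R).
Implicit Types (B C : set (L2field Om)).

Lemma distH_ge0 B C : B !=set0 -> (0 <= distH B C)%E.
Proof.
move=> [x Bx]; apply: (@le_trans _ _ (ereal_inf [set `|x - y|%:E | y in C])).
  by apply: le_ereal_inf_tmp => _ [y Cy <-]; rewrite lee_fin.
by apply: ereal_sup_ubound; exists x.
Qed.

Lemma distH_le B C (r : R) : C 0 -> (forall x, B x -> `|x| <= r) -> (distH B C <= r%:E)%E.
Proof.
move=> C0 Br; apply: ge_ereal_sup => _ [x Bx <-].
apply: (@le_trans _ _ `|x|%:E); last by rewrite lee_fin; exact: Br.
by apply: ereal_inf_lbound; exists 0; rewrite ?subr0.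
Qed.

Lemma cvge0_at_right (f : R -> \bar R) :
  (forall d : R, 0 < d -> \forall e \near 0^'+, (0 <= f e <= d%:E)%E) ->
  f e @[e --> 0^'+] --> 0%E.
Proof.
move=> H; apply/fine_cvgP; split.
  apply: filterS (H 1 ltr01) => e /andP[f0 f1].
  by rewrite ge0_fin_numE// (le_lt_trans f1)// ltry.
apply/cvgrPdist_le => d d0; apply: filterS (H d d0) => e /andP[f0 f1].
have ff : f e \is a fin_num by rewrite ge0_fin_numE// (le_lt_trans f1)// ltry.
by rewrite sub0r normrN ger0_norm ?fine_ge0// -lee_fin fineK.
Qed.

End zero_attractor.

Theorem theorem3p13 (R : realType) (Om : smooth_domain R)
  (nu nu0 lambda1 eta : R) (h : R -> L2field Om)
  (S : R -> R -> R -> L2field Om -> L2field Om)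
  (A : R -> R -> set (L2field Om))
  (S0 : R -> R -> L2field Om -> L2field Om) (A0 : set (L2field Om)) :
  0 < nu -> 0 < nu0 ->
  first_stokes_eigenvalue Om lambda1 ->
  0 < eta <= nu * lambda1 ->
  (forall a b, a < b ->
    bochner_Lp `]a, b[ (H_set Om) (fun v => `|v|) 2 h) ->
  (forall t, (\int[@lebesgue_measure R]_(s in `]-oo, t])
    (expR (eta * s) * `|h s| ^+ 2)%:E < +oo)%E) ->
  (forall eps, 0 < eps ->
    solution_process nu nu0 (fun t => dual_of (eps *: h t)) (S eps)) ->
  (forall eps, 0 < eps -> pullback_attractor (S eps) (A eps)) ->
  solution_process nu nu0 (fun _ => dual_of 0) S0 ->
  global_attractor (fun t => S0 t 0) A0 ->
  forall t, distH (A eps t) A0 @[eps --> 0^'+] --> 0%E.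
Proof.
move=> nup nu0p _ _ hL2 _ solS attA solS0 [A0H [a0 A0a0] _ A0inv _] t.
have [c c0 bound] := absorbing_bound Om nup nu0p.
pose M (T : R) := \int[@lebesgue_measure R]_(r in `]t - T, t + 1[) `|h r| ^+ 2.
have M0 T : 0 <= M T by apply: Rintegral_ge0 => r _; exact: sqr_ge0.
have Abound eps T x : 0 < eps -> 0 < T -> A eps t x ->
    `|x| ^+ 2 <= 2 / (c * (T / 2)) + (eps * M T + eps ^+ 2 / (4 * c) * (T / 2)).
  move=> eps0 T0; have [AH inv _ _] := attA eps eps0.
  have tT : t - T <= t by rewrite gerBl ltW.
  rewrite -(inv _ _ tT) => -[y Ay <-].
  have Hy : H_set Om y by have [AH' _ _] := AH (t - T); exact: AH'.
  have t01 : t - T < t + 1 by lra.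
  have b := bound eps (t - T) (t + 1) h _ y (ltW eps0) t01 (hL2 _ _ t01) (solS eps eps0 (t - T) y Hy).
  have ta : t - T < t - T / 2 by lra.
  have ab : t - T / 2 < t by lra.
  have bt : t < t + 1 by lra.
  have := b _ _ ta ab bt; have -> // : t - (t - T / 2) = T / 2 by ring.
have A0bound T x : 0 < T -> A0 x -> `|x| ^+ 2 <= 2 / (c * (T / 2)).
  move=> T0; rewrite -(A0inv T (ltW T0)) => -[y A0y <-].
  have t01 : 0 < T + 1 by rewrite addr_gt0.
  have sol : weak_solution nu nu0 (fun t => dual_of (0 *: h t)) 0 y (fun t => S0 t 0 y).
    have -> : (fun t => dual_of (0 *: h t)) = (fun=> dual_of 0).
      by apply/funext => r; rewrite scale0r.
    exact/solS0/A0H.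
  have b := bound 0 0 (T + 1) h _ y (lexx 0) t01 (hL2 _ _ t01) sol.
  have ta : 0 < T / 2 by lra.
  have ab : T / 2 < T by lra.
  have bt : T < T + 1 by lra.
  have := b _ _ ta ab bt; have -> : T - T / 2 = T / 2 by lra.
  by rewrite expr0n/= !mul0r !addr0.
(* the length 8 / (c d^2) of the time interval makes the first term of the bound d^2 / 2 *)
have TE (d : R) : 0 < d -> 2 / (c * (8 / (c * d ^+ 2) / 2)) = d ^+ 2 / 2.
  by move=> d0; field; rewrite ?gt_eqF.
have A00 : A0 0.
  suff <- : a0 = 0 by [].
  apply/eqP; rewrite -normr_le0 leNgt; apply/negP => x0.
  have T0 : 0 < 8 / (c * `|a0| ^+ 2) by rewrite divr_gt0// mulr_gt0// exprn_gt0.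
  have := A0bound _ _ T0 A0a0; rewrite TE//.
  by have := exprn_gt0 2 x0; move: (`|a0| ^+ 2) => *; lra.
apply: cvge0_at_right => d d0.
pose T := 8 / (c * d ^+ 2).
have T0 : 0 < T by rewrite divr_gt0// mulr_gt0// exprn_gt0.
pose K := M T + (4 * c)^-1 * (T / 2) + 1.
have cT0 : 0 < (4 * c)^-1 * (T / 2) by apply: mulr_gt0; [rewrite invr_gt0 mulr_gt0|rewrite divr_gt0].
have K0 : 0 < K by rewrite /K ltr_wpDl// addr_ge0// ltW.
near=> eps.
have eps0 : 0 < eps by near: eps; exact: nbhs_right_gt.
have eps1 : eps < 1 by near: eps; exact: nbhs_right_lt.
have epsK : eps < d ^+ 2 / 2 / K.
  by near: eps; apply: nbhs_right_lt; rewrite !divr_gt0// exprn_gt0.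
apply/andP; split.
  by apply: distH_ge0; have [AH _ _ _] := attA eps eps0; have [] := AH t.
apply: distH_le => // x Ax.
have := Abound eps T x eps0 T0 Ax; rewrite {1}/T TE// => Hx.
rewrite -(ler_pXn2r (n := 2))// ?nnegrE ?(ltW d0)//; apply: (le_trans Hx).
have k1 : eps * K < d ^+ 2 / 2 by rewrite -ltr_pdivlMr.
have k2 : eps ^+ 2 / (4 * c) * (T / 2) <= eps * ((4 * c)^-1 * (T / 2)).
  move: ((4 * c)^-1) (T / 2) cT0 => p q pq0.
  have -> : eps ^+ 2 * p * q = eps * (eps * (p * q)) by ring.
  by apply: ler_wpM2l; [exact: ltW|rewrite (ger_pMl _ pq0) ltW].
have k3 : eps * K = eps * M T + eps * ((4 * c)^-1 * (T / 2)) + eps by rewrite /K; ring.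
move: k1 k2 k3; move: (eps * K) (eps * M T) (_ * (T / 2)) (eps * (_ * _)) (d ^+ 2) => *; lra.
Unshelve. all: by end_near. Qed.
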